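(* Let $w\in\mathcal S'(\mathbb R^m)$, $\gamma$ an admissible scaling, and $\chi\in\mathcal S(\mathbb R^m)$ with $\int\chi=1$. Then $WF^\gamma_g(\iota^\gamma_\chi(w))=WF(w)$, where $WF(w)$ is the usual (smooth) wave front set of $w$.
   Context: Colombeau framework: for $q\in\mathbb N_0$, $\mathcal A_q(\mathbb R)$ is the set of $\phi_0\in\mathcal D(\mathbb R)$ with $\int\phi_0=1$ and $\int t^j\phi_0(t)\,dt=0$ for $1\le j\le q$; $\mathcal A_q(\mathbb R^m)$ is the set of $\phi=\phi_0\otimes\cdots\otimes\phi_0$ ($m$ factors) with $\phi_0\in\mathcal A_q(\mathbb R)$. For $\varepsilon>0$, $\phi_\varepsilon(x)=\varepsilon^{-m}\phi(x/\varepsilon)$, and $l(\phi_0)=\sup\{|t|:\phi_0(t)\ne0\}$. $\mathcal G(\mathbb R^m)$ is the (special-variant) Colombeau algebra: classes of moderate maps $U:\mathcal A_0(\mathbb R^m)\times\mathbb R^m\to\mathbb C$, smooth in $x$, modulo negligible ones; $U(\phi,x)$ denotes a representative. An admissible scaling is a continuous $\gamma:(0,1)\to\mathbb R_+$ with $\gamma(r)=O(1/r)$, $\gamma(r)\to\infty$, and $\gamma(sr)=O(\gamma(r))$ for each fixed $0<s<1$, as $r\to0$. Embedding: for $\chi\in\mathcal S(\mathbb R^m)$ with $\int\chi=1$ and $u\in\mathcal S'(\mathbb R^m)$, $\iota^\gamma_\chi(u)$ is the class of $(\phi,x)\mapsto u*\chi^\gamma(\phi,\cdot)(x)$, where $\chi^\gamma(\phi,x)=\gamma(l(\phi_0))^m\chi(\gamma(l(\phi_0))x)$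 for $\phi=\phi_0\otimes\cdots\otimes\phi_0\in\mathcal A_0(\mathbb R^m)$. Write $\gamma_\varepsilon:=\gamma(\varepsilon l(\phi_0))$. $\gamma$-wave front set: for $U\in\mathcal G(\mathbb R^m)$ and $\psi\in\mathcal D(\mathbb R^m)$, a direction $\xi_0\ne0$ is not in $\Sigma^\gamma_g(\psi U)$ if there are an open conic neighbourhood $\Gamma$ of $\xi_0$ and $N\in\mathbb N_0$ such that for every $k\in\mathbb N_0$ there is $M\in\mathbb N_0$ with $\sup_{\xi\in\Gamma}(1+|\xi|)^k|\mathcal F(\psi U(\phi_\varepsilon,\cdot))(\xi)|=O(\gamma_\varepsilon^N)$ as $\varepsilon\to0$ for all $\phi\in\mathcal A_M(\mathbb R^m)$. Then $WF^\gamma_g(U)$ is the set of $(x_0,\xi_0)\in\mathbb R^m\times(\mathbb R^m\setminus0)$ such that $\xi_0\in\Sigma^\gamma_g(\psi U)$ for every $\psi\in\mathcal D(\mathbb R^m)$ with $\psi(x_0)\ne0$. *)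

(* Defs.v *)
From mathcomp Require Import all_boot all_order all_algebra.
From mathcomp Require Import all_classical all_reals all_analysis.
From mathcomp Require Import complex.
Set Implicit Arguments. Unset Strict Implicit. Unset Printing Implicit Defensive.
Import Order.TTheory GRing.Theory Num.Theory numFieldNormedType.Exports.
Local Open Scope classical_set_scope.
Local Open Scope ring_scope.
Local Open Scope complex_scope.

Section ColombeauWF.
Variable R : realType.
Local Notation C := R[i].

Definition cabs (z : C) : R := Num.sqrt (complex.Re z ^+ 2 + complex.Im z ^+ 2).
Definition expi (t : R) : C := cos t +i* sin t.

Definition int1 (f : R -> R) : R := Rintegral lebesgue_measure setT f.

Definition smooth1 (f : R -> R) : Prop :=
  forall n : nat, continuous (derive1n n f) /\
    forall t : R, derivable (derive1n n f) t 1.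

Definition compact_supp1 (f : R -> R) : Prop :=
  exists r : R, forall t : R, r < `|t| -> f t = 0.

Definition lsupp (f : R -> R) : R := sup [set `|t| | t in [set t | f t != 0]].

Definition Aq (q : nat) : set (R -> R) :=
  [set phi0 | [/\ smooth1 phi0, compact_supp1 phi0, int1 phi0 = 1 &
     forall j : nat, (1 <= j <= q)%N -> int1 (fun t => t ^+ j * phi0 t) = 0]].

(* If phi = phi0 (x) ... (x) phi0 then phi_eps = (eps^-1 phi0(./eps))^{(x) m} *)
Definition scale1 (eps : R) (phi0 : R -> R) : R -> R :=
  fun t => eps^-1 * phi0 (t / eps).

Section Rm.
Variable m : nat.
Local Notation V := 'rV[R]_m.

Definition ev (i : 'I_m) : V := delta_mx 0 i.

Definition pd (i : 'I_m) (f : V -> R) : V -> R := fun x => 'D_(ev i) f x.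
Definition dseq (s : seq 'I_m) (f : V -> R) : V -> R := foldr pd f s.

Definition smooth (f : V -> R) : Prop :=
  forall s : seq 'I_m, continuous (dseq s f) /\
    forall (i : 'I_m) (x : V), derivable (dseq s f) x (ev i).

Definition cdseq (s : seq 'I_m) (f : V -> C) : V -> C :=
  fun x => dseq s (fun y => complex.Re (f y)) x +i* dseq s (fun y => complex.Im (f y)) x.

Definition mono (a : 'I_m -> nat) (x : V) : R := \prod_i x 0 i ^+ a i.

Definition schwartz (f : V -> R) : Prop :=
  smooth f /\ forall (a : 'I_m -> nat) (s : seq 'I_m),
    exists M : R, forall x : V, `|mono a x * dseq s f x| <= M.
Definition cschwartz (f : V -> C) : Prop :=
  schwartz (fun x => complex.Re (f x)) /\ schwartz (fun x => complex.Im (f x)).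

Definition test (f : V -> R) : Prop :=
  smooth f /\ exists r : R, forall x : V, r < `|x| -> f x = 0.
Definition ctest (f : V -> C) : Prop :=
  test (fun x => complex.Re (f x)) /\ test (fun x => complex.Im (f x)).

(* tempered distributions: complex-linear functionals on S(R^m) that are
   continuous, i.e. bounded by finitely many Schwartz seminorms *)
Definition tempered (w : (V -> C) -> C) : Prop :=
  (forall (a : C) (f g : V -> C), cschwartz f -> cschwartz g ->
      w (fun x => a * f x + g x) = a * w f + w g) /\
  exists (K : R) (N : nat), forall f : V -> C, cschwartz f ->
    forall M : R,
      (forall (a : 'I_m -> nat) (s : seq 'I_m) (x : V),
         (\sum_i a i <= N)%N -> (size s <= N)%N ->
         `|mono a x| * cabs (cdseq s f x) <= M) ->
      cabs (w f) <= K * M.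

Definition dot (x y : V) : R := \sum_i x 0 i * y 0 i.
Definition enorm (x : V) : R := Num.sqrt (dot x x).

(* Lebesgue integral over R^m, computed as an iterated integral *)
Fixpoint iint (n : nat) : ('rV[R]_n -> R) -> R :=
  match n return ('rV[R]_n -> R) -> R with
  | 0 => fun f => f 0
  | n'.+1 => fun f =>
      int1 (fun t => iint (fun y : 'rV[R]_n' =>
        f (row_mx (const_mx t : 'rV[R]_1) y : 'rV[R]_(1 + n'))))
  end.
Definition cint (f : V -> C) : C :=
  iint (fun x => complex.Re (f x)) +i* iint (fun x => complex.Im (f x)).

Definition cFT (f : V -> C) (xi : V) : C := cint (fun x => f x * expi (- dot x xi)).

(* Fourier transform of the compactly supported distribution psi w *)
Definition distFT (w : (V -> C) -> C) (psi : V -> C) (xi : V) : C :=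
  w (fun x => psi x * expi (- dot x xi)).

Definition open_cone_nbhd (G : set V) (xi0 : V) : Prop :=
  [/\ open G, G xi0 & forall (xi : V) (t : R), G xi -> 0 < t -> G (t *: xi)].

Definition not_in_Sigma (w : (V -> C) -> C) (psi : V -> C) (xi0 : V) : Prop :=
  exists G : set V, open_cone_nbhd G xi0 /\
    forall k : nat, exists K : R, forall xi : V, G xi ->
      (1 + enorm xi) ^+ k * cabs (distFT w psi xi) <= K.

Definition WF (w : (V -> C) -> C) : set (V * V) :=
  [set p | p.2 != 0 /\
     forall psi : V -> C, ctest psi -> psi p.1 != 0 -> ~ not_in_Sigma w psi p.2].

(* A representative U(phi, x), where phi = phi0 (x) ... (x) phi0 is given by phi0 *)
Definition rep := (R -> R) -> V -> C.

Definition admissible (gamma : R -> R) : Prop :=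
  [/\ {within [set r | 0 < r < 1], continuous gamma},
      (forall r, 0 < r < 1 -> 0 < gamma r),
      (exists (K d : R), 0 < d /\ forall r, 0 < r < d -> gamma r <= K / r),
      (forall M : R, exists d : R, 0 < d /\ forall r, 0 < r < d -> M < gamma r) &
      (forall s : R, 0 < s < 1 ->
         exists (K d : R), 0 < d /\ forall r, 0 < r < d -> gamma (s * r) <= K * gamma r)].

Definition chi_gamma (gamma : R -> R) (chi : V -> C) (phi0 : R -> R) (x : V) : C :=
  (gamma (lsupp phi0) ^+ m)%:C * chi (gamma (lsupp phi0) *: x).

Definition embed (gamma : R -> R) (chi : V -> C) (w : (V -> C) -> C) : rep :=
  fun phi0 x => w (fun y => chi_gamma gamma chi phi0 (x - y)).

Definition not_in_SigmaG (gamma : R -> R) (U : rep) (psi : V -> C) (xi0 : V) : Prop :=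
  exists G : set V, open_cone_nbhd G xi0 /\
    exists N : nat, forall k : nat, exists M : nat, forall phi0 : R -> R, Aq M phi0 ->
      exists (K d : R), 0 < d /\ forall eps : R, 0 < eps < d ->
        forall xi : V, G xi ->
          (1 + enorm xi) ^+ k * cabs (cFT (fun x => psi x * U (scale1 eps phi0) x) xi)
            <= K * gamma (eps * lsupp phi0) ^+ N.

Definition WFg (gamma : R -> R) (U : rep) : set (V * V) :=
  [set p | p.2 != 0 /\
     forall psi : V -> C, ctest psi -> psi p.1 != 0 -> ~ not_in_SigmaG gamma U psi p.2].

End Rm.
End ColombeauWF.

(* Main.v *)
(* Write w_g for the regularization of w at scale g, so that the embedded
   distribution at eps is w_g with g = gamma_eps -> oo, and e_xi(x) = exp(-i x.xi).
   Riemann sums over a lattice, on which translations can be moved from w_g to the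
   test function, give
     F(psi w_g)(xi) = lim_h h^m sum_(z in h Z^m) chi(z) w((psi e_xi)(. + z/g)),
   so no Fourier inversion and no exchange of w with an integral is needed.
   - WF included in WFg: the limit formula bounds F(psi w_g)(xi) - F(psi w)(xi) by
     C (1 + |xi|)^p / g; by the intermediate value theorem eps can be chosen with
     g a large power of 1 + |xi|, and then the decay of F(psi w_g) carries over.
   - WFg included in WF: if g^2 < 1 + |xi|, summation by parts bounds
     F(psi' w_g)(xi) (1 + |xi|)^q by C g^(q + N0), which is enough.  If
     g^2 >= 1 + |xi|, the limit formula reduces the claim to a bound, uniform in
     small z, on w(psi'(. + z) e_xi).  Near x0 the cutoff psi'(. + z) is a multiple
     kappa_z psi, and expanding kappa_z by trigonometric interpolation with
     uniformly rapidly decreasing coefficients reduces it to the decay of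
     F(psi w) in a slightly larger cone. *)

Require Import Defs.
From mathcomp Require Import all_boot all_order all_algebra.
From mathcomp Require Import all_classical all_reals all_analysis.
From mathcomp Require Import measurable_realfun complex ring lra.
Set Implicit Arguments. Unset Strict Implicit. Unset Printing Implicit Defensive.
Import Order.TTheory GRing.Theory Num.Theory numFieldNormedType.Exports.
Local Open Scope classical_set_scope.
Local Open Scope ring_scope.
Local Open Scope complex_scope.
Local Notation cRe := complex.Re.
Local Notation cIm := complex.Im.

(** * Functions with bounded derivatives *)

(** A tempered distribution is controlled only by seminorm bounds, so it is applied to finite sums,
    through which linearity carries it, and limits are taken afterwards. All these limits rest on
    one principle: a sequence bounded in every Schwartz seminorm that tends to 0 locally uniformly
    tends to 0 in every seminorm, by Landau's inequality. It therefore suffices to compare functions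
    on a fine lattice, where both the substitution x = y + z/g in a lattice sum and trigonometric
    interpolation are exact identities.

    In the generalized wave front set the exponent N is fixed before k. For one inclusion this
    allows the factor T^N, with T a power of 1 + |xi|, to be paid for by asking for more decay. For
    the other, the threshold g^2 keeps N0 independent of k: if g^2 < 1 + |xi|, the choice q = 2k
    leaves a factor g^(2k) that is at most (1 + |xi|)^k, so only g^N0 survives; if g^2 >= 1 + |xi|,
    every two powers of 1/g gained from the tail of chi give one power of 1/(1 + |xi|). *)

Lemma ler_sum_term (R : numDomainType) (I : finType) (F : I -> R) (i : I) :
  (forall j, 0 <= F j) -> F i <= \sum_j F j.
Proof. by move=> F0; rewrite (bigD1 i)//= lerDl sumr_ge0. Qed.

Lemma le_of_eq (R : numDomainType) (x y : R) : x = y -> x <= y.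
Proof. by move=> ->. Qed.

Section Continuity.
Context (R : realType) (T : topologicalType).
Implicit Types f g : T -> R.

Lemma continuous_add f g : continuous f -> continuous g -> continuous (fun x => f x + g x).
Proof. by move=> cf cg x; apply: cvgD; [exact: cf|exact: cg]. Qed.

Lemma continuous_mul f g : continuous f -> continuous g -> continuous (fun x => f x * g x).
Proof. by move=> cf cg x; apply: cvgM; [exact: cf|exact: cg]. Qed.

Lemma continuous_scale (c : R) f : continuous f -> continuous (fun x => c * f x).
Proof. by move=> cf x; apply: cvgM; [exact: cvg_cst|exact: cf]. Qed.

Lemma continuous_affine (W : normedModType R) (a : R) (z : W) :
  continuous (fun x : W => a *: x + z).
Proof. by move=> x; apply: (@cvgD _ _ _ (nbhs x)); [apply: cvgZl_tmp; exact: cvg_id|exact: cvg_cst]. Qed.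

Lemma continuous_circ (S U : topologicalType) (f : S -> U) (g : T -> S) :
  continuous f -> continuous g -> continuous (fun x => f (g x)).
Proof. by move=> cf cg x; exact: (continuous_comp (cg x) (cf (g x))). Qed.

Lemma continuous_inv f : (forall x, f x != 0) -> continuous f -> continuous (fun x => (f x)^-1).
Proof. by move=> f0 cf x; apply: cvgV; [exact: f0|exact: cf]. Qed.

End Continuity.
Arguments continuous_add {R T f g} _ _.
Arguments continuous_mul {R T f g} _ _.
Arguments continuous_scale {R T} c {f} _.
Arguments continuous_inv {R T f} _ _.
Arguments continuous_affine {R W} a z.
Arguments continuous_circ {T S U f g} _ _.

(** * Partial derivatives as derivatives along lines *)

Section Slices.
Variables (R : realType) (m : nat).
Local Notation V := 'rV[R]_m.
Implicit Types (f g : V -> R) (x v : V).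

(** Both difference quotients are the same function of the increment. One-variable calculus thus
    applies to directional derivatives without any total differentiability. *)
Lemma slice_derive f x v (t : R) : derivable f (t *: v + x) v ->
  is_derive t (1 : R) (fun s : R => f (s *: v + x)) ('D_v f (t *: v + x)).
Proof.
move=> df.
have E : (fun h : R => h^-1 *: ((f \o shift (t *: v + x)) (h *: v) - f (t *: v + x)))
  = (fun h : R => h^-1 *: (((fun s : R => f (s *: v + x)) \o shift t) (h *: (1 : R))
       - f (t *: v + x))).
  by apply/funext => h /=; rewrite scaler1 scalerDl addrA.
split.
  by rewrite /derivable -E.
by rewrite /derive -E.
Qed.

Lemma derive_slice f x v : derivable (fun s : R => f (s *: v + x)) 0 1 ->
  derivable f x v /\ 'D_v f x = 'D_1 (fun s : R => f (s *: v + x)) 0.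
Proof.
have E : (fun h : R => h^-1 *: ((f \o shift x) (h *: v) - f x))
  = (fun h : R => h^-1 *: (((fun s : R => f (s *: v + x)) \o shift 0) (h *: (1 : R))
       - f (0 *: v + x))).
  by apply/funext => h /=; rewrite scaler1 scale0r add0r addr0.
by rewrite /derivable /derive E.
Qed.

(** The bound is required only on the segment |th| <= |t|, because the majorants used later decay in
    space and must be evaluated near [x]. *)
Lemma line_mvt f x v (t B : R) : (forall y, derivable f y v) ->
  (forall th : R, `|th| <= `|t| -> `|'D_v f (th *: v + x)| <= B) ->
  `|f (t *: v + x) - f x| <= `|t| * B.
Proof.
move=> df hB.
have D (s : R) := @slice_derive f x v s (df _).
have C (A : set R) : {within A, continuous (fun s : R => f (s *: v + x))}.
  apply: continuous_subspaceT => s.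
  apply: differentiable_continuous; apply/derivable1_diffP.
  by case: (D s).
have [t0|t0] := leP 0 t.
  have [c /[!in_itv]/= /andP[c0 ct]] := @MVT_segment R _ _ 0 t t0 (fun s _ => D s) (C _).
  rewrite scale0r add0r subr0 => ->.
  rewrite normrM mulrC ler_wpM2l// hB//.
  by rewrite !ger0_norm.
have [c /[!in_itv]/= /andP[c0 ct]] := @MVT_segment R _ _ t 0 (ltW t0) (fun s _ => D s) (C _).
rewrite scale0r add0r sub0r distrC => ->.
rewrite normrM normrN mulrC ler_wpM2l// hB//.
by rewrite ler0_norm// (ler0_norm (ltW t0)) lerN2.
Qed.

End Slices.

(** * Pointwise majorants for all derivatives up to a given order *)

Section BoundedDerivatives.
Variables (R : realType) (m : nat).
Local Notation V := 'rV[R]_m.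
Implicit Types (f g b : V -> R) (x y : V) (n : nat).

(** A quantitative substitute for Schwartz seminorms. The majorant is a function, so that it can
    carry decay in [x], and a single one serves all orders up to [n]. The recursion peels off the
    derivative applied first, which makes each closure rule an induction on [n] with [f] general. *)
Fixpoint dbound n f b : Prop :=
  [/\ forall x, `|f x| <= b x, continuous f &
   if n is n'.+1 then forall i, (forall x, derivable f x (ev R i)) /\ dbound n' (pd i f) b
   else True].

Lemma dbound_bound n f b : dbound n f b -> forall x, `|f x| <= b x.
Proof. by case: n => [|n] []. Qed.

Lemma dbound_cont n f b : dbound n f b -> continuous f.
Proof. by case: n => [|n] []. Qed.

Arguments dbound_cont [n f b] _.

Lemma dbound_derivable n f b : dbound n.+1 f b -> forall i x, derivable f x (ev R i).
Proof. by move=> [_ _ h] i x; case: (h i). Qed.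

Arguments dbound_derivable [n f b] _ i x.

Lemma dbound_pd n f b : dbound n.+1 f b -> forall i, dbound n (pd i f) b.
Proof. by move=> [_ _ h] i; case: (h i). Qed.

Lemma dbound_ge0 n f b : dbound n f b -> forall x, 0 <= b x.
Proof. by move=> /dbound_bound h x; apply: le_trans (h x). Qed.

Lemma dbound_le n f b b' : (forall x, b x <= b' x) -> dbound n f b -> dbound n f b'.
Proof.
move=> bb; elim: n f => [|n IH] f [h c h']; split => //.
- by move=> x; exact: le_trans (bb x).
- by move=> x; exact: le_trans (bb x).
- by move=> i; case: (h' i) => d H; split => //; exact: IH.
Qed.

Lemma dboundW n n' f b : (n' <= n)%N -> dbound n f b -> dbound n' f b.
Proof.
elim: n' n f => [|n' IH] [|n] f // nn [h c h']; split => // i.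
by case: (h' i) => d H; split => //; exact: IH H.
Qed.

Lemma pd_cst i (c : R) : pd i (cst c : V -> R) = cst 0.
Proof. by apply/funext => x; rewrite /pd derive_cst. Qed.

Lemma dbound_cst n (c : R) b : (forall x, `|c| <= b x) -> dbound n (cst c) b.
Proof.
elim: n c => [|n IH] c hc; split => //; try by move=> x; exact: cst_continuous.
move=> i; split; first by move=> x; exact: derivable_cst.
by rewrite pd_cst; apply: IH => x; rewrite normr0; exact: le_trans (hc x).
Qed.

Lemma dbound_add n f g b1 b2 : dbound n f b1 -> dbound n g b2 ->
  dbound n (fun x => f x + g x) (fun x => b1 x + b2 x).
Proof.
elim: n f g => [|n IH] f g hf hg; split => //.
- by move=> x; apply: le_trans (ler_normD _ _) _; rewrite lerD// (dbound_bound hf, dbound_bound hg).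
- exact: (continuous_add (dbound_cont hf) (dbound_cont hg)).
- by move=> x; apply: le_trans (ler_normD _ _) _; rewrite lerD// (dbound_bound hf, dbound_bound hg).
- exact: (continuous_add (dbound_cont hf) (dbound_cont hg)).
- move=> i.
  have df := dbound_derivable hf i; have dg := dbound_derivable hg i.
  split; first by move=> x; exact: derivableD.
  have -> : pd i (fun x => f x + g x) = (fun x => pd i f x + pd i g x).
    by apply/funext => x; rewrite /pd; rewrite -deriveD.
  by apply: IH; [exact: (dbound_pd hf)|exact: (dbound_pd hg)].
Qed.

Lemma dbound_scale n (c : R) f b : dbound n f b ->
  dbound n (fun x => c * f x) (fun x => `|c| * b x).
Proof.
elim: n f => [|n IH] f hf; split => //.
- by move=> x; rewrite normrM ler_wpM2l// (dbound_bound hf).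
- exact: (continuous_scale c (dbound_cont hf)).
- by move=> x; rewrite normrM ler_wpM2l// (dbound_bound hf).
- exact: (continuous_scale c (dbound_cont hf)).
- move=> i; have df := dbound_derivable hf i.
  split; first by move=> x; apply: derivableM => //; exact: derivable_cst.
  have -> : pd i (fun x => c * f x) = (fun x => c * pd i f x).
    by apply/funext => x; rewrite /pd; rewrite (deriveMl c (df x)).
  by apply: IH; exact: (dbound_pd hf).
Qed.

Lemma dbound_opp n f b : dbound n f b -> dbound n (fun x => - f x) b.
Proof.
move=> /(dbound_scale (-1)) H.
have -> : (fun x => - f x) = (fun x => -1 * f x) by apply/funext => x; rewrite mulN1r.
by apply: dbound_le H => x; rewrite normrN normr1 mul1r.
Qed.

Lemma dbound_sub n f g b1 b2 : dbound n f b1 -> dbound n g b2 ->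
  dbound n (fun x => f x - g x) (fun x => b1 x + b2 x).
Proof. by move=> hf hg; apply: dbound_add => //; exact: dbound_opp. Qed.

(** Each use of the Leibniz rule doubles the number of terms, whence 2 ^ n. *)
Lemma dbound_mul n f g b1 b2 : dbound n f b1 -> dbound n g b2 ->
  dbound n (fun x => f x * g x) (fun x => 2 ^+ n * (b1 x * b2 x)).
Proof.
elim: n f g => [|n IH] f g hf hg.
  split => //.
  - move=> x; rewrite expr0 mul1r normrM ler_pM//.
      exact: (dbound_bound hf).
    exact: (dbound_bound hg).
  - exact: (continuous_mul (dbound_cont hf) (dbound_cont hg)).
have p0 x : 0 <= b1 x * b2 x by rewrite mulr_ge0 ?(dbound_ge0 hf) ?(dbound_ge0 hg).
split => //.
- move=> x; rewrite normrM; apply: (@le_trans _ _ (b1 x * b2 x)).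
    by rewrite ler_pM// ?(dbound_bound hf) ?(dbound_bound hg).
  by rewrite ler_peMl// exprn_ege1// ler1n.
- exact: (continuous_mul (dbound_cont hf) (dbound_cont hg)).
move=> i; have df := dbound_derivable hf i; have dg := dbound_derivable hg i.
split; first by move=> x; exact: derivableM.
have -> : pd i (fun x => f x * g x) = (fun x => f x * pd i g x + pd i f x * g x).
  by apply/funext => x; rewrite [X in _ + X]mulrC; exact: (deriveM (df x) (dg x)).
have h1 := IH _ _ (dboundW (leqnSn n) hf) (dbound_pd hg i).
have h2 := IH _ _ (dbound_pd hf i) (dboundW (leqnSn n) hg).
apply: dbound_le (dbound_add h1 h2) => x.
by rewrite exprS -mulrA mulr_natl mulr2n.
Qed.

Lemma dbound_sum n (I : Type) (r : seq I) (F : I -> V -> R) (B : I -> V -> R) :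
  (forall j, dbound n (F j) (B j)) ->
  dbound n (fun x => \sum_(j <- r) F j x) (fun x => \sum_(j <- r) B j x).
Proof.
move=> h; elim: r => [|j r IH].
  have -> : (fun x => \sum_(j <- [::]) F j x) = cst 0 by apply/funext => x; rewrite big_nil.
  by apply: dbound_cst => x; rewrite big_nil normr0.
have -> : (fun x => \sum_(j <- j :: r) F j x) = (fun x => F j x + \sum_(j <- r) F j x).
  by apply/funext => x; rewrite big_cons.
by apply: dbound_le (dbound_add (h j) IH) => x; rewrite big_cons.
Qed.

Lemma ev_scale i (t a : R) x z : a *: (t *: ev R i + x) + z = (t * a) *: ev R i + (a *: x + z).
Proof. by rewrite scalerDr scalerA mulrC addrA. Qed.

Lemma pd_affine i f (a : R) (z : V) x :
  (forall y, derivable f y (ev R i)) ->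
  derivable (fun y => f (a *: y + z)) x (ev R i) /\
  pd i (fun y => f (a *: y + z)) x = a * pd i f (a *: x + z).
Proof.
move=> df; set g := fun y => _.
have S := @slice_derive R m f (a *: x + z) (ev R i) (0 * a) (df _).
have A : is_derive (0 : R) (1 : R) (fun s : R => s * a) a.
  have := @is_deriveM R R (fun s : R => s) (fun _ => a) 0 1 1 0 _ _.
  by rewrite scaler0 add0r scaler1; apply.
have C := @is_derive1_comp R _ (fun s : R => s * a) 0 _ _ S A.
have E : (fun s : R => g (s *: ev R i + x)) =
    (fun s : R => f (s *: ev R i + (a *: x + z))) \o (fun s : R => s * a).
  by apply/funext => s; rewrite /g /= ev_scale.
have [C1 C2] := C.
have [D1 D2] : derivable g x (ev R i) /\ 'D_(ev R i) g x = 'D_1 (fun s : R => g (s *: ev R i + x)) 0.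
  by apply: derive_slice; rewrite E.
split => //; rewrite /pd D2 E C2 mul0r scale0r add0r mulrC//.
Qed.

Lemma dbound_affine n f b (a : R) (z : V) : dbound n f b ->
  dbound n (fun x => f (a *: x + z)) (fun x => (1 + `|a|) ^+ n * b (a *: x + z)).
Proof.
have a1 : 1 <= 1 + `|a| by rewrite lerDl.
elim: n f => [|n IH] f hf.
  split => //; first by move=> x; rewrite expr0 mul1r (dbound_bound hf).
  exact: (continuous_circ (dbound_cont hf) (continuous_affine a z)).
split => //.
- move=> x; apply: le_trans (dbound_bound hf _) _.
  by rewrite ler_peMl ?(dbound_ge0 hf)// exprn_ege1.
- exact: (continuous_circ (dbound_cont hf) (continuous_affine a z)).
move=> i; have P x := @pd_affine i f a z x (dbound_derivable hf i).
split; first by move=> x; case: (P x).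
have -> : pd i (fun y => f (a *: y + z)) = (fun x => a * pd i f (a *: x + z)).
  by apply/funext => x; case: (P x).
apply: dbound_le (dbound_scale a (IH _ (dbound_pd hf i))) => x.
rewrite exprS -mulrA ler_wpM2r//; last by rewrite lerDr.
by rewrite mulr_ge0 ?(dbound_ge0 hf)// exprn_ge0// (le_trans ler01).
Qed.

End BoundedDerivatives.

Arguments dbound_cont {R m n f b} _.
Arguments dbound_derivable {R m n f b} _ i x.

Section SmoothCalculus.
Variables (R : realType) (m : nat).
Local Notation V := 'rV[R]_m.
Implicit Types (f g b p : V -> R) (x y : V) (n N : nat).

Lemma dseq_rcons s i f : dseq (rcons s i) f = dseq s (pd i f).
Proof. by rewrite /dseq foldr_rcons. Qed.

Lemma smooth_pd i f : smooth f -> smooth (pd i f).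
Proof. by move=> h s; rewrite -dseq_rcons; exact: h. Qed.

Lemma smooth_derivable f : smooth f -> forall i x, derivable f x (ev R i).
Proof. by move=> h i x; case: (h [::]). Qed.

Arguments smooth_derivable [f] _ i x.

Lemma smooth_continuous f : smooth f -> continuous f.
Proof. by move=> h; case: (h [::]). Qed.

Arguments smooth_continuous [f] _.

Lemma dbound_dseq n s f b : dbound (size s + n) f b -> dbound n (dseq s f) b.
Proof.
elim/last_ind: s f => [//|s i IH] f; rewrite size_rcons addSn => h.
by rewrite dseq_rcons; apply: IH; exact: dbound_pd.
Qed.

Lemma dbound_smooth f : (forall n, exists b, dbound n f b) -> smooth f.
Proof.
move=> h s; have [b hb] := h (size s + 1)%N.
have hs := dbound_dseq hb; split; first exact: (dbound_cont hs).
by move=> i x; exact: (dbound_derivable hs).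
Qed.

(** The constants depend on the sequence of derivatives, but only finitely many sequences have
    length at most [n]; the sum over directions merges them at each order. *)
Lemma smooth_dbound_weight (W : V -> R) n f : (forall x, 0 <= W x) -> smooth f ->
  (forall s, exists M, forall x, `|dseq s f x| <= M * W x) ->
  exists2 M, 0 <= M & dbound n f (fun x => M * W x).
Proof.
move=> W0; elim: n f => [|n IH] f sf hb; have [M0 hM0] := hb [::].
  exists `|M0| => //; split => //; last exact: smooth_continuous.
  by move=> x; apply: le_trans (hM0 x) _; rewrite ler_wpM2r// ler_norm.
have /choice[M hM] : forall i, exists M, 0 <= M /\ dbound n (pd i f) (fun x => M * W x).
  move=> i; have hi s : exists M, forall x, `|dseq s (pd i f) x| <= M * W x.
    by rewrite -dseq_rcons; exact: hb.
  have [M M0' hM] := IH (pd i f) (smooth_pd i sf) hi.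
  by exists M.
have S0 : 0 <= \sum_i M i by apply: sumr_ge0 => i _; case: (hM i).
exists (`|M0| + \sum_i M i); first by rewrite addr_ge0.
split; [|exact: smooth_continuous|].
  move=> x; apply: le_trans (hM0 x) _; rewrite ler_wpM2r//.
  by apply: le_trans (ler_norm _) _; rewrite lerDl.
move=> i; split; first exact: smooth_derivable.
case: (hM i) => _; apply: dbound_le => x; rewrite ler_wpM2r//.
by apply: le_trans (ler_sum_term (F := M) i _) _; rewrite /= ?lerDr// => j; case: (hM j).
Qed.

Lemma smooth_dbound_ex n f : smooth f -> exists b, dbound n f b.
Proof.
elim: n f => [|n IH] f sf.
  by exists (fun x => `|f x|); split => //; exact: smooth_continuous.
have /choice[b hb] : forall i, exists b, dbound n (pd i f) b.
  by move=> i; apply: IH; exact: smooth_pd.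
have b0 x : 0 <= \sum_i b i x by apply: sumr_ge0 => i _; apply: (dbound_ge0 (hb i)).
exists (fun x => `|f x| + \sum_i b i x); split; [|exact: smooth_continuous|].
  by move=> x; rewrite lerDl.
move=> i; split; first exact: smooth_derivable.
apply: dbound_le (hb i) => x.
by apply: le_trans (ler_sum_term (F := b^~ x) i _) _; rewrite /= ?lerDr// => j; exact: (dbound_ge0 (hb j)).
Qed.

Lemma smoothP f : smooth f <-> forall n, exists b, dbound n f b.
Proof. by split; [move=> sf n; exact: smooth_dbound_ex|exact: dbound_smooth]. Qed.

Lemma smooth_mul f g : smooth f -> smooth g -> smooth (fun x => f x * g x).
Proof.
move=> /smoothP sf /smoothP sg; apply/smoothP => n.
have [b1 h1] := sf n; have [b2 h2] := sg n.
by eexists; exact: dbound_mul h1 h2.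
Qed.

Lemma smooth_add f g : smooth f -> smooth g -> smooth (fun x => f x + g x).
Proof.
move=> /smoothP sf /smoothP sg; apply/smoothP => n.
have [b1 h1] := sf n; have [b2 h2] := sg n.
by eexists; exact: dbound_add h1 h2.
Qed.

Lemma smooth_opp f : smooth f -> smooth (fun x => - f x).
Proof.
move=> /smoothP sf; apply/smoothP => n; have [b1 h1] := sf n.
by eexists; exact: dbound_opp h1.
Qed.

Lemma smooth_cst (c : R) : smooth (fun _ : V => c).
Proof. by apply/smoothP => n; exists (fun _ => `|c|); exact: dbound_cst. Qed.

Lemma smooth_affine (a : R) (z : V) f : smooth f -> smooth (fun x => f (a *: x + z)).
Proof.
move=> /smoothP sf; apply/smoothP => n; have [b1 h1] := sf n.
by eexists; exact: dbound_affine h1.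
Qed.

Lemma smooth_sum (I : Type) (r : seq I) (F : I -> V -> R) :
  (forall j, smooth (F j)) -> smooth (fun x => \sum_(j <- r) F j x).
Proof.
move=> h; apply/smoothP => n.
have /choice[b hb] : forall j, exists b, dbound n (F j) b by move=> j; exact: smooth_dbound_ex.
by eexists; exact: dbound_sum hb.
Qed.

Lemma derivable_coord i j x : derivable (fun y : V => y 0 j) x (ev R i) /\
  pd i (fun y : V => y 0 j) x = (i == j)%:R.
Proof.
have E : (fun s : R => (s *: ev R i + x) 0 j) = (fun s : R => s * (i == j)%:R + x 0 j).
  by apply/funext => s; rewrite !mxE eqxx/= eq_sym.
have D : is_derive (0 : R) (1 : R) (fun s : R => (s *: ev R i + x) 0 j) ((i == j)%:R : R).
  rewrite E.
  have := @is_deriveD R R R (fun s : R => s * (i == j)%:R) (cst (x 0 j)) 0 1 (i == j)%:R 0.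
  rewrite addr0; apply.
  have := @is_deriveM R R (fun s : R => s) (fun _ => (i == j)%:R) 0 1 1 0 _ _.
  by rewrite scaler0 add0r scaler1; apply.
case: D => D1 D2.
have [D3 D4] := @derive_slice R m (fun y : V => y 0 j) x (ev R i) D1.
by split => //; rewrite /pd D4.
Qed.

Lemma smooth_coord j : smooth (fun y : V => y 0 j).
Proof.
apply/smoothP => -[|n].
  exists (fun y => `|y 0 j|); split => //; exact: coord_continuous.
exists (fun y => `|y 0 j| + 1); split; [by move=> x; rewrite lerDl|exact: coord_continuous|].
move=> i; split; first by move=> x; case: (derivable_coord i j x).
have -> : pd i (fun y : V => y 0 j) = cst (i == j)%:R.
  by apply/funext => x; case: (derivable_coord i j x).
apply: dbound_cst => x; rewrite normr_nat.
by rewrite (@le_trans _ _ 1)//; [case: (i == j) => //=; rewrite ler01|rewrite lerDr].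
Qed.

Lemma smooth1_derive (E : R -> R) : smooth1 E -> smooth1 (derive1 E).
Proof.
move=> h n; have := h n.+1.
by rewrite /derive1n iterSr.
Qed.

(** The chain rule produces [E'] composed with the same [p], so the induction on the order runs over
    all smooth outer functions at once. *)
Lemma smooth_comp (E : R -> R) p : smooth1 E -> smooth p -> smooth (fun x => E (p x)).
Proof.
move=> sE sp; apply/smoothP => n; elim: n E sE => [|n IH] E sE.
  exists (fun x => `|E (p x)|); split => //.
  apply: continuous_circ (smooth_continuous sp); by case: (sE 0%N).
have [b0 hb0] := IH _ (smooth1_derive sE).
have /choice[bp hbp] : forall i, exists b, dbound n (pd i p) b.
  by move=> i; apply: smooth_dbound_ex; exact: smooth_pd.
have P i x : derivable (fun x => E (p x)) x (ev R i) /\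
    pd i (fun x => E (p x)) x = (derive1 E) (p x) * pd i p x.
  have S := @slice_derive R m p x (ev R i) 0.
  rewrite scale0r add0r in S.
  have {}S := S (smooth_derivable sp _ _).
  have dE : is_derive (p (0 *: ev R i + x)) (1 : R) E (derive1 E (p x)).
    rewrite scale0r add0r.
    have [_ /(_ (p x)) d] := sE 0%N.
    by apply: DeriveDef => //; rewrite derive1E.
  have [C1 C2] := @is_derive1_comp R _ (fun s : R => p (s *: ev R i + x)) 0 _ _ dE S.
  have [D1 D2] := @derive_slice R m (fun x => E (p x)) x (ev R i) C1.
  by split => //; rewrite /pd D2; exact: C2.
have H i : dbound n (pd i (fun x => E (p x))) (fun x => 2 ^+ n * (b0 x * bp i x)).
  have -> : pd i (fun x => E (p x)) = (fun x => (derive1 E) (p x) * pd i p x).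
    by apply/funext => x; case: (P i x).
  exact: dbound_mul.
exists (fun x => `|E (p x)| + \sum_i 2 ^+ n * (b0 x * bp i x)); split.
- by move=> x; rewrite lerDl sumr_ge0// => i _; exact: (dbound_ge0 (H i)).
- apply: continuous_circ (smooth_continuous sp); by case: (sE 0%N).
- move=> i; split; first by move=> x; case: (P i x).
  apply: dbound_le (H i) => x.
  by apply: le_trans (ler_sum_term (F := fun j => 2 ^+ n * (b0 x * bp j x)) i _) _; rewrite /= ?lerDr// => j; exact: (dbound_ge0 (H j)).
Qed.

(** A derivative of 1/f is -(1/f)^2 times a derivative of f, so a majorant of order [n] for 1/f
    itself yields one of order [n + 1]. *)
Lemma smooth_inv f : smooth f -> (forall x, f x != 0) -> smooth (fun x => (f x)^-1).
Proof.
move=> sf f0.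
have C : continuous (fun x => (f x)^-1).
  exact: continuous_inv f0 (smooth_continuous sf).
have P i x : derivable (fun x => (f x)^-1) x (ev R i) /\
    pd i (fun x => (f x)^-1) x = (f x)^-1 * ((f x)^-1 * - pd i f x).
  have df := smooth_derivable sf i x.
  split; first exact: derivableV.
  by rewrite /pd (deriveV (f0 x) df) scaleNr mulrN mulrN expr2 invfM mulrA.
apply/smoothP => n; elim: n => [|n [b hb]].
  by exists (fun x => `|(f x)^-1|); split.
have /choice[bp hbp] : forall i, exists b, dbound n (fun x => - pd i f x) b.
  by move=> i; apply: smooth_dbound_ex; apply: smooth_opp; exact: smooth_pd.
have H i := dbound_mul hb (dbound_mul hb (hbp i)).
exists (fun x => `|(f x)^-1| + \sum_i 2 ^+ n * (b x * (2 ^+ n * (b x * bp i x)))); split => //.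
- by move=> x; rewrite lerDl sumr_ge0// => i _; exact: (dbound_ge0 (H i)).
- move=> i; split; first by move=> x; case: (P i x).
  have -> : pd i (fun x => (f x)^-1) = (fun x => (f x)^-1 * ((f x)^-1 * - pd i f x)).
    by apply/funext => x; case: (P i x).
  apply: dbound_le (H i) => x.
  by apply: le_trans (ler_sum_term (F := fun j => 2 ^+ n * (b x * (2 ^+ n * (b x * bp j x)))) i _) _; rewrite /= ?lerDr// => j; exact: (dbound_ge0 (H j)).
Qed.

Lemma dot_line (xi x : V) i (s : R) : dot (s *: ev R i + x) xi = s * xi 0 i + dot x xi.
Proof.
rewrite /dot (bigD1 i)//= [X in _ = _ + X](bigD1 i)//= !mxE !eqxx mulr1 mulrDl -addrA.
congr (_ + (_ + _)); apply: eq_bigr => j ji.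
by rewrite !mxE (negPf ji) andbF mulr0 add0r.
Qed.

Lemma smooth_dot (xi : V) : smooth (fun x => dot x xi).
Proof.
apply: smooth_sum => j; apply: smooth_mul; [exact: smooth_coord|exact: smooth_cst].
Qed.

End SmoothCalculus.

Arguments smooth_derivable {R m f} _ i x.
Arguments smooth_continuous {R m f} _.

(** * Polynomial weights in the sup norm *)

Section Weights.
Variables (R : realType) (m : nat).
Local Notation V := 'rV[R]_m.
Implicit Types (x y z : V) (N : nat).

Lemma coord_le_norm x i : `|x 0 i| <= `|x|.
Proof.
rewrite [leRHS]mx_normrE.
exact: (le_bigmax 0 (fun ij : 'I_1 * 'I_m => `|x ij.1 ij.2|) (0, i)).
Qed.

Lemma norm_le_coord x (B : R) : 0 <= B -> (forall i, `|x 0 i| <= B) -> `|x| <= B.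
Proof.
move=> B0 h; rewrite [leLHS]mx_normrE.
by apply: bigmax_le => // -[i j] _ /=; rewrite ord1.
Qed.

Lemma norm_attained x : `|x| = 0 \/ exists i, `|x| = `|x 0 i|.
Proof.
have [->|x0] := eqVneq (`|x|) 0; [by left|right].
have [[i j] h] := mx_norm_neq0 x0.
by exists j; rewrite {1}/Num.norm/= h /= ord1.
Qed.

Definition wt N x : R := ((1 + `|x|) ^+ N)^-1.

Lemma onen_ge1 x : 1 <= 1 + `|x|. Proof. by rewrite lerDl. Qed.
Lemma onen_gt0 x : 0 < 1 + `|x|. Proof. exact: lt_le_trans ltr01 (onen_ge1 x). Qed.
Lemma onenX_gt0 N x : 0 < (1 + `|x|) ^+ N. Proof. by rewrite exprn_gt0// onen_gt0. Qed.
Lemma onenX_ge1 N x : 1 <= (1 + `|x|) ^+ N. Proof. by rewrite exprn_ege1// onen_ge1. Qed.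
Lemma wt_gt0 N x : 0 < wt N x. Proof. by rewrite invr_gt0 onenX_gt0. Qed.
Lemma wt_ge0 N x : 0 <= wt N x. Proof. exact: ltW (wt_gt0 N x). Qed.
Lemma wtD N N' x : wt (N + N') x = wt N x * wt N' x.
Proof. by rewrite /wt exprD invfM. Qed.
Lemma wt_cancel N x : (1 + `|x|) ^+ N * wt N x = 1.
Proof. by rewrite /wt divff// gt_eqF// onenX_gt0. Qed.

Lemma wt_absorb N N' x : wt (N + N') x * (1 + `|x|) ^+ N' = wt N x.
Proof. by rewrite wtD -mulrA [wt N' x * _]mulrC wt_cancel mulr1. Qed.
Lemma dbound_wt_ge0 n N (f : V -> R) (M : R) : dbound n f (fun x => M * wt N x) -> 0 <= M.
Proof. by move=> /dbound_ge0/(_ 0); rewrite pmulr_lge0// wt_gt0. Qed.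

Lemma onenD x y : 1 + `|x + y| <= (1 + `|x|) * (1 + `|y|).
Proof.
apply: (@le_trans _ _ (1 + (`|x| + `|y|))); first by rewrite lerD2l ler_normD.
rewrite mulrDl !mul1r mulrDr mulr1 !addrA.
rewrite -!addrA lerD2l [leRHS]addrCA lerD2l lerDl mulr_ge0 //.
Qed.

Lemma onenXD N x y : (1 + `|x + y|) ^+ N <= (1 + `|x|) ^+ N * (1 + `|y|) ^+ N.
Proof.
rewrite -exprMn lerXn2r//; last exact: onenD.
  by rewrite nnegrE ltW// onen_gt0.
by rewrite nnegrE mulr_ge0// ltW// onen_gt0. Qed.

(** Peetre's inequality: a translation by [z] costs the factor (1 + |z|)^N, of the same order as the
    weight. *)
Lemma wt_shift N x z : wt N (x + z) <= (1 + `|z|) ^+ N * wt N x.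
Proof.
rewrite /wt -[leRHS]invrK invfM invrK lef_pV2 ?posrE ?onenX_gt0 ?mulr_gt0 ?invr_gt0 ?onenX_gt0//.
rewrite mulrC ler_pdivrMr ?onenX_gt0//.
by rewrite -[X in `|X|](addrK z x) -(normrN z); exact: onenXD.
Qed.

Lemma wt_le N x y : `|y| <= `|x| -> wt N x <= wt N y.
Proof.
move=> h; rewrite /wt lef_pV2 ?posrE ?onenX_gt0// lerXn2r//; last by rewrite lerD2l.
  by rewrite nnegrE ltW// onen_gt0.
by rewrite nnegrE ltW// onen_gt0.
Qed.

End Weights.

Section ComplexModulus.
Variable R : realType.
Implicit Types z : R[i].

Lemma cabsE z : (cabs z)%:C = `|z|. Proof. by rewrite normc_def. Qed.
Lemma cabs_ge0 z : 0 <= cabs z. Proof. exact: sqrtr_ge0. Qed.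
Lemma cabsM z1 z2 : cabs (z1 * z2) = cabs z1 * cabs z2.
Proof. by case: z1 => a b; case: z2 => c d; exact: (Normc.normcM (a +i* b) (c +i* d)). Qed.
Lemma cabsD z1 z2 : cabs (z1 + z2) <= cabs z1 + cabs z2.
Proof. by rewrite -lecR rmorphD/= !cabsE ler_normD. Qed.
Lemma cabsN z : cabs (- z) = cabs z.
Proof. by apply: (fmorph_inj (real_complex R)) => /=; rewrite !cabsE normrN. Qed.
Lemma cabsB z1 z2 : cabs (z1 - z2) <= cabs z1 + cabs z2.
Proof. by rewrite -(cabsN z2) cabsD. Qed.
Lemma cabs0 : cabs (0 : R[i]) = 0.
Proof. by rewrite /cabs /= expr0n addr0 sqrtr0. Qed.
Lemma cabs_sum (I : Type) (r : seq I) (F : I -> R[i]) :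
  cabs (\sum_(j <- r) F j) <= \sum_(j <- r) cabs (F j).
Proof.
elim: r => [|j r IH]; first by rewrite !big_nil cabs0.
by rewrite !big_cons (le_trans (cabsD _ _))// lerD2l.
Qed.
Lemma cabsX z n : cabs (z ^+ n) = cabs z ^+ n.
Proof.
elim: n => [|n IH]; first by rewrite !expr0 /cabs /= expr0n addr0 expr1n sqrtr1.
by rewrite !exprS cabsM IH.
Qed.
Lemma cabsC (a : R) : cabs a%:C = `|a|.
Proof. by rewrite /cabs /= expr0n addr0 sqrtr_sqr. Qed.
Lemma Re_le_cabs z : `|cRe z| <= cabs z.
Proof. by rewrite -sqrtr_sqr ler_sqrt ?lerDl ?addr_ge0 ?sqr_ge0. Qed.
Lemma Im_le_cabs z : `|cIm z| <= cabs z.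
Proof. by rewrite -sqrtr_sqr ler_sqrt ?lerDr ?addr_ge0 ?sqr_ge0. Qed.
Lemma cabs_le_ReIm z : cabs z <= `|cRe z| + `|cIm z|.
Proof.
rewrite -[leRHS]ger0_norm ?addr_ge0// -sqrtr_sqr ler_sqrt ?sqr_ge0//.
by rewrite sqrrD !real_normK ?num_real// addrAC lerDl mulrn_wge0// mulr_ge0.
Qed.
Lemma cabs_expi (t : R) : cabs (expi t) = 1.
Proof. by rewrite /cabs /expi /= cos2Dsin2 sqrtr1. Qed.
Lemma expiD (s t : R) : expi (s + t) = expi s * expi t.
Proof.
rewrite /expi sinD cosD; simpc; rewrite /=.
by congr (_ +i* _); rewrite addrC [sin s * _]mulrC.
Qed.
Lemma cReD z1 z2 : cRe (z1 + z2) = cRe z1 + cRe z2.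
Proof. by case: z1 => a b; case: z2. Qed.
Lemma cImD z1 z2 : cIm (z1 + z2) = cIm z1 + cIm z2.
Proof. by case: z1 => a b; case: z2. Qed.
Lemma cReB z1 z2 : cRe (z1 - z2) = cRe z1 - cRe z2.
Proof. by case: z1 => a b; case: z2. Qed.
Lemma cImB z1 z2 : cIm (z1 - z2) = cIm z1 - cIm z2.
Proof. by case: z1 => a b; case: z2. Qed.
Lemma cReM z1 z2 :
  cRe (z1 * z2) = cRe z1 * cRe z2 - cIm z1 * cIm z2.
Proof. by case: z1 => a b; case: z2. Qed.
Lemma cImM z1 z2 :
  cIm (z1 * z2) = cRe z1 * cIm z2 + cIm z1 * cRe z2.
Proof. by case: z1 => a b; case: z2. Qed.
Lemma cRe_sum (I : Type) (r : seq I) (F : I -> R[i]) :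
  cRe (\sum_(j <- r) F j) = \sum_(j <- r) cRe (F j).
Proof. by apply: (big_morph _ cReD). Qed.
Lemma cIm_sum (I : Type) (r : seq I) (F : I -> R[i]) :
  cIm (\sum_(j <- r) F j) = \sum_(j <- r) cIm (F j).
Proof. by apply: (big_morph _ cImD). Qed.

End ComplexModulus.

Section ComplexDbound.
Variables (R : realType) (m : nat).
Local Notation V := 'rV[R]_m.
Local Notation C := R[i].
Implicit Types (f g : V -> C) (b : V -> R) (x y z : V) (n N : nat).

Definition cdbound n f b :=
  dbound n (fun x => cRe (f x)) b /\ dbound n (fun x => cIm (f x)) b.
Definition csmooth f :=
  smooth (fun x => cRe (f x)) /\ smooth (fun x => cIm (f x)).

Lemma cdbound_le n f b b' : (forall x, b x <= b' x) -> cdbound n f b -> cdbound n f b'.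
Proof. by move=> h [h1 h2]; split; exact: dbound_le h _. Qed.

Lemma cdboundW n n' f b : (n' <= n)%N -> cdbound n f b -> cdbound n' f b.
Proof. by move=> h [h1 h2]; split; exact: dboundW h _. Qed.

Lemma cdbound_wt_ge0 n N f (M : R) : cdbound n f (fun x => M * wt N x) -> 0 <= M.
Proof. by case=> /dbound_wt_ge0. Qed.

Lemma cdbound_cabs n f b : cdbound n f b -> forall x, cabs (f x) <= 2 * b x.
Proof.
move=> [h1 h2] x; apply: le_trans (cabs_le_ReIm _) _.
by rewrite mulr_natl mulr2n lerD// ?(dbound_bound h1) ?(dbound_bound h2).
Qed.

Lemma cdbound_add n f g b1 b2 : cdbound n f b1 -> cdbound n g b2 ->
  cdbound n (fun x => f x + g x) (fun x => b1 x + b2 x).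
Proof.
move=> [h1 h2] [h3 h4]; split.
  by under eq_fun do rewrite cReD; exact: dbound_add.
by under eq_fun do rewrite cImD; exact: dbound_add.
Qed.

Lemma cdbound_mul n f g b1 b2 : cdbound n f b1 -> cdbound n g b2 ->
  cdbound n (fun x => f x * g x) (fun x => 2 ^+ n.+1 * (b1 x * b2 x)).
Proof.
move=> [h1 h2] [h3 h4]; split.
  under eq_fun do rewrite cReM.
  apply: dbound_le (dbound_sub (dbound_mul h1 h3) (dbound_mul h2 h4)) => x.
  by rewrite exprS -mulrA [leRHS]mulr_natl mulr2n.
under eq_fun do rewrite cImM.
apply: dbound_le (dbound_add (dbound_mul h1 h4) (dbound_mul h2 h3)) => x.
by rewrite exprS -mulrA [leRHS]mulr_natl mulr2n.
Qed.

Lemma cdbound_cst n (c : C) b : (forall x, cabs c <= b x) -> cdbound n (fun _ => c) b.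
Proof.
move=> h; split; apply: dbound_cst => x; apply: le_trans (h x).
  exact: Re_le_cabs.
exact: Im_le_cabs.
Qed.

Lemma cdbound_scale n (c : C) f b : cdbound n f b ->
  cdbound n (fun x => c * f x) (fun x => (2 * cabs c) * b x).
Proof.
have hc : `|cRe c| + `|cIm c| <= 2 * cabs c.
  by rewrite mulr_natl mulr2n lerD// ?Re_le_cabs ?Im_le_cabs.
move=> [h1 h2]; have b0 := dbound_ge0 h1; split.
  under eq_fun do rewrite cReM.
  apply: dbound_le (dbound_sub (dbound_scale _ h1) (dbound_scale _ h2)) => x.
  by rewrite -mulrDl ler_wpM2r.
under eq_fun do rewrite cImM.
apply: dbound_le (dbound_add (dbound_scale _ h2) (dbound_scale _ h1)) => x.
by rewrite -mulrDl ler_wpM2r.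
Qed.

Lemma cdbound_sub n f g b1 b2 : cdbound n f b1 -> cdbound n g b2 ->
  cdbound n (fun x => f x - g x) (fun x => b1 x + b2 x).
Proof.
move=> [h1 h2] [h3 h4]; split.
  by under eq_fun do rewrite cReB; exact: dbound_sub.
by under eq_fun do rewrite cImB; exact: dbound_sub.
Qed.

Lemma cdbound_sum n (I : Type) (r : seq I) (F : I -> V -> C) (B : I -> V -> R) :
  (forall j, cdbound n (F j) (B j)) ->
  cdbound n (fun x => \sum_(j <- r) F j x) (fun x => \sum_(j <- r) B j x).
Proof.
move=> h; elim: r => [|j r IH].
  have -> : (fun x => \sum_(j <- [::]) F j x) = (fun=> 0) by apply/funext => x; rewrite big_nil.
  by apply: cdbound_cst => x; rewrite big_nil cabs0.
have -> : (fun x => \sum_(j <- j :: r) F j x) = (fun x => F j x + \sum_(j <- r) F j x).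
  by apply/funext => x; rewrite big_cons.
by apply: cdbound_le (cdbound_add (h j) IH) => x; rewrite big_cons.
Qed.

Lemma cdbound_affine n f b (a : R) (z : V) : cdbound n f b ->
  cdbound n (fun x => f (a *: x + z)) (fun x => (1 + `|a|) ^+ n * b (a *: x + z)).
Proof. by move=> [h1 h2]; split; [exact: dbound_affine h1|exact: dbound_affine h2]. Qed.

Lemma cdbound_trans n f b (z : V) : cdbound n f b ->
  cdbound n (fun x => f (x + z)) (fun x => 2 ^+ n * b (x + z)).
Proof.
move=> /(@cdbound_affine _ _ _ 1 z) /=; rewrite normr1.
have -> : (fun x => f (1 *: x + z)) = (fun x => f (x + z)) by apply/funext => x; rewrite scale1r.
by apply: cdbound_le => x; rewrite scale1r.
Qed.

(** The phase [c] closes the family under differentiation: each derivative adds pi/2 to the phase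
    and a factor [xi 0 i]. The sine is then the cosine with a shifted phase. *)
Lemma dbound_cos n (xi : V) (c : R) :
  dbound n (fun x => cos (dot x xi + c)) (fun _ => (1 + `|xi|) ^+ n).
Proof.
have C0 c' : continuous (fun x => cos (dot x xi + c')).
  apply: (continuous_circ (@continuous_cos R)).
  exact: (smooth_continuous (smooth_add (smooth_dot xi) (smooth_cst c'))).
have P i x c' : derivable (fun x => cos (dot x xi + c')) x (ev R i) /\
    pd i (fun x => cos (dot x xi + c')) x = xi 0 i * cos (dot x xi + (c' + pi / 2)).
  set g := fun x => cos (dot x xi + c').
  have E : (fun s : R => g (s *: ev R i + x)) = cos \o (fun s : R => s * xi 0 i + (dot x xi + c')).
    by apply/funext => s; rewrite /g/= dot_line addrA.
  have A : is_derive (0 : R) (1 : R) (fun s : R => s * xi 0 i + (dot x xi + c')) (xi 0 i).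
    have := @is_deriveD R R R (fun s : R => s * xi 0 i) (cst (dot x xi + c')) 0 1 (xi 0 i) 0.
    rewrite addr0; apply.
    have := @is_deriveM R R (fun s : R => s) (fun _ => xi 0 i) 0 1 1 0 _ _.
    by rewrite scaler0 add0r scaler1; apply.
  have [C1 C2] := @is_derive1_comp R cos _ 0 _ _ (is_derive_cos _) A.
  have D0 : derivable (fun s : R => g (s *: ev R i + x)) 0 1 by rewrite E.
  have [D1 D2] := @derive_slice R m g x (ev R i) D0.
  split => //; rewrite /pd D2 E C2 mul0r add0r addrA cosDpihalf mulrC //.
elim: n c => [|n IH] c; split => //.
- by move=> x; rewrite expr0; exact: cos_max.
- by move=> x; apply: le_trans (cos_max _) _; exact: onenX_ge1.
- move=> i; split; first by move=> x; case: (P i x c).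
  have -> : pd i (fun x => cos (dot x xi + c)) = (fun x => xi 0 i * cos (dot x xi + (c + pi / 2))).
    by apply/funext => x; case: (P i x c).
  apply: dbound_le (dbound_scale (xi 0 i) (IH (c + pi / 2))) => x.
  rewrite exprS ler_wpM2r ?exprn_ge0 ?addr_ge0//.
  by apply: le_trans (coord_le_norm xi i) _; rewrite lerDr.
Qed.

Definition wave (xi x : V) : C := expi (- dot x xi).

Lemma dotDl x y z : dot (x + y) z = dot x z + dot y z.
Proof. by rewrite /dot -big_split/=; apply: eq_bigr => i _; rewrite mxE mulrDl. Qed.
Lemma dotC x y : dot x y = dot y x.
Proof. by apply: eq_bigr => i _; rewrite mulrC. Qed.
Lemma dotDr x y z : dot x (y + z) = dot x y + dot x z.
Proof. by rewrite dotC dotDl !(dotC _ x). Qed.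
Lemma dotZl (a : R) x y : dot (a *: x) y = a * dot x y.
Proof. by rewrite /dot mulr_sumr; apply: eq_bigr => i _; rewrite mxE mulrA. Qed.
Lemma dotNl x y : dot (- x) y = - dot x y.
Proof. by rewrite -scaleN1r dotZl mulN1r. Qed.

Lemma waveD xi x y : wave xi (x + y) = wave xi x * wave xi y.
Proof. by rewrite /wave dotDl opprD expiD. Qed.
Lemma waveDl xi eta x : wave (xi + eta) x = wave xi x * wave eta x.
Proof. by rewrite /wave dotDr opprD expiD. Qed.
Lemma cabs_wave xi x : cabs (wave xi x) = 1. Proof. exact: cabs_expi. Qed.

Lemma cdbound_wave n xi : cdbound n (wave xi) (fun _ => (1 + `|xi|) ^+ n).
Proof.
split.
  have -> : (fun x => cRe (wave xi x)) = (fun x => cos (dot x xi + 0)).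
    by apply/funext => x /=; rewrite cosN addr0.
  exact: dbound_cos.
have -> : (fun x => cIm (wave xi x)) = (fun x => cos (dot x xi + pi / 2)).
  by apply/funext => x /=; rewrite sinN cosDpihalf.
exact: dbound_cos.
Qed.

End ComplexDbound.

(** * Schwartz functions as functions with majorants of every order and every weight *)

Section Schwartz.
Variables (R : realType) (m : nat).
Local Notation V := 'rV[R]_m.
Local Notation C := R[i].

Lemma mono_le (a : 'I_m -> nat) (x : V) : `|mono a x| <= (1 + `|x|) ^+ (\sum_i a i).
Proof.
rewrite /mono normr_prod.
have -> : (1 + `|x|) ^+ (\sum_i a i) = \prod_i (1 + `|x|) ^+ a i.
  by rewrite -(big_morph (fun k => (1 + `|x|) ^+ k) (fun p q => exprD _ p q) (expr0 _)).
apply: ler_prod => i _; rewrite normr_ge0 normrX/= lerXn2r ?nnegrE ?addr_ge0//.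
by apply: le_trans (coord_le_norm x i) _; rewrite lerDr.
Qed.

Lemma onenX_le_sum N (t : R) : 0 <= t -> (1 + t) ^+ N <= 2 ^+ N * (1 + t ^+ N).
Proof.
move=> t0; have [t1|t1] := leP t 1.
  apply: (@le_trans _ _ (2 ^+ N)).
    by rewrite lerXn2r ?nnegrE ?addr_ge0// -[2]/(1 + 1) lerD2l.
  by rewrite ler_peMr ?exprn_ge0// lerDl exprn_ge0.
apply: (@le_trans _ _ ((2 * t) ^+ N)).
  rewrite lerXn2r ?nnegrE ?addr_ge0 ?mulr_ge0// mulr_natl mulr2n lerD2r ltW//.
by rewrite exprMn ler_wpM2l ?exprn_ge0// lerDr.
Qed.

(** The sup norm is attained at a coordinate, so the monomials 1 and x_i^N already control the full
    weight (1 + |x|)^N. *)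
Lemma schwartz_dbound (f : V -> R) n N : schwartz f ->
  exists2 M, 0 <= M & dbound n f (fun x => M * wt N x).
Proof.
move=> [sf hf]; apply: smooth_dbound_weight => //; first by move=> x; exact: wt_ge0.
move=> s; have [M0 h0] := hf (fun _ => 0%N) s.
have /choice[Mi hi] : forall i, exists M, forall x : V, `|x 0 i| ^+ N * `|dseq s f x| <= M.
  move=> i; have [M hM] := hf (fun j => if j == i then N else 0%N) s.
  exists M => x; apply: le_trans (hM x); rewrite normrM /mono (bigD1 i)//= eqxx big1 => [|j /negPf ->].
    by rewrite mulr1 normrX.
  by rewrite expr0.
have hz x : `|dseq s f x| <= M0.
  by apply: le_trans (h0 x); rewrite /mono big1 ?mul1r// => i _; rewrite expr0.
have Mi0 i : 0 <= Mi i by apply: le_trans (hi i 0); rewrite mulr_ge0// exprn_ge0.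
exists (2 ^+ N * (`|M0| + `|M0| + \sum_i Mi i)) => x.
have -> : `|dseq s f x| = (1 + `|x|) ^+ N * `|dseq s f x| * wt N x.
  by rewrite mulrAC wt_cancel mul1r.
rewrite ler_wpM2r ?wt_ge0//.
apply: (@le_trans _ _ (2 ^+ N * (1 + `|x| ^+ N) * `|dseq s f x|)).
  by rewrite ler_wpM2r// onenX_le_sum.
rewrite -mulrA ler_wpM2l ?exprn_ge0// mulrDl mul1r -addrA lerD//.
  by rewrite (le_trans (hz x))// ler_norm.
have S0 : 0 <= \sum_i Mi i by rewrite sumr_ge0.
have [->|[i ->]] := norm_attained x.
  apply: (@le_trans _ _ `|M0|); last by rewrite lerDl.
  rewrite expr0n; case: (N == 0%N); rewrite ?mul0r// mul1r.
  by rewrite (le_trans (hz x))// ler_norm.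
apply: le_trans (hi i x) _.
by apply: le_trans (ler_sum_term i Mi0) _; rewrite lerDr.
Qed.

Lemma dbound_schwartz (f : V -> R) :
  (forall n N, exists M, dbound n f (fun x => M * wt N x)) -> schwartz f.
Proof.
move=> h; split.
  by apply: dbound_smooth => n; have [M hM] := h n 0%N; eexists; exact: hM.
move=> a s; have [M hM] := h (size s) (\sum_i a i)%N.
exists M => x; rewrite -{1}[size s]addn0 in hM.
rewrite normrM.
apply: le_trans (ler_pM _ _ (mono_le a x) (dbound_bound (dbound_dseq hM) x)) _ => //.
by rewrite mulrCA wt_cancel mulr1.
Qed.

Lemma cschwartzP (f : V -> C) : cschwartz f <->
  forall n N, exists M, cdbound n f (fun x => M * wt N x).
Proof.
split.
  move=> [h1 h2] n N.
  have [M1 M10 b1] := schwartz_dbound n N h1; have [M2 M20 b2] := schwartz_dbound n N h2.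
  exists (M1 + M2); split; [apply: dbound_le b1|apply: dbound_le b2] => x;
    by rewrite ler_wpM2r ?wt_ge0// (lerDl, lerDr).
by move=> h; split; apply: dbound_schwartz => n N; have [M [b1 b2]] := h n N; exists M.
Qed.

Lemma cschwartz_bound (f : V -> C) n N : cschwartz f ->
  exists2 M, 0 <= M & cdbound n f (fun x => M * wt N x).
Proof.
move=> /cschwartzP/(_ n N)[M hM]; exists `|M| => //.
by apply: cdbound_le hM => x; rewrite ler_wpM2r ?wt_ge0 ?ler_norm.
Qed.

Lemma cschwartz_add (f g : V -> C) : cschwartz f -> cschwartz g -> cschwartz (fun x => f x + g x).
Proof.
move=> /cschwartzP hf /cschwartzP hg; apply/cschwartzP => n N.
have [M1 h1] := hf n N; have [M2 h2] := hg n N; exists (M1 + M2).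
by apply: cdbound_le (cdbound_add h1 h2) => x; rewrite mulrDl.
Qed.

Lemma cschwartz_scale (c : C) (f : V -> C) : cschwartz f -> cschwartz (fun x => c * f x).
Proof.
move=> /cschwartzP hf; apply/cschwartzP => n N.
have [M1 h1] := hf n N; exists (2 * cabs c * M1).
by apply: cdbound_le (cdbound_scale c h1) => x; rewrite mulrA.
Qed.

Lemma cschwartz_sub (f g : V -> C) : cschwartz f -> cschwartz g -> cschwartz (fun x => f x - g x).
Proof.
move=> sf /(cschwartz_scale (-1)) sg; have := cschwartz_add sf sg.
by under eq_fun do rewrite mulN1r.
Qed.

Lemma cschwartz0 : cschwartz (fun _ : V => 0 : C).
Proof.
apply/cschwartzP => n N; exists 0.
by apply: cdbound_cst => x; rewrite mul0r cabs0.
Qed.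

Lemma cschwartz_sum (I : Type) (r : seq I) (F : I -> V -> C) :
  (forall j, cschwartz (F j)) -> cschwartz (fun x => \sum_(j <- r) F j x).
Proof.
move=> h; elim: r => [|j r IH].
  have -> : (fun x => \sum_(j <- [::]) F j x) = (fun=> 0) by apply/funext => x; rewrite big_nil.
  exact: cschwartz0.
have -> : (fun x => \sum_(j <- j :: r) F j x) = (fun x => F j x + \sum_(j <- r) F j x).
  by apply/funext => x; rewrite big_cons.
exact: cschwartz_add.
Qed.

Lemma cschwartz_affine (f : V -> C) (a : R) (z : V) : a != 0 -> cschwartz f ->
  cschwartz (fun x => f (a *: x + z)).
Proof.
move=> a0 /cschwartzP h; apply/cschwartzP => n N; have [M hM] := h n N.
have [K K0 hK] : exists2 K, 0 <= K & forall x, wt N (a *: x + z) <= K * wt N x.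
  have c0 : 0 <= 1 + `|a|^-1 by rewrite addr_ge0// invr_ge0.
  have z0 := ltW (onen_gt0 z).
  exists (((1 + `|a|^-1) * (1 + `|z|)) ^+ N); first by rewrite exprn_ge0// mulr_ge0.
  move=> x; rewrite /wt ler_pdivlMr ?onenX_gt0// mulrC ler_pdivrMr ?onenX_gt0//.
  rewrite -exprMn lerXn2r ?nnegrE ?mulr_ge0 ?addr_ge0//.
  have {1}-> : x = a^-1 *: ((a *: x + z) + - z) by rewrite addrK scalerA mulVf// scale1r.
  rewrite normrZ normrV ?unitfE//.
  apply: (@le_trans _ _ ((1 + `|a|^-1) * (1 + `|a *: x + z - z|))).
    have a1 : 0 <= `|a|^-1 by rewrite invr_ge0.
    have b1 : 0 <= `|a *: x + z - z| by [].
    by move: a1 b1; move: (`|a|^-1) (`|a *: x + z - z|) => p q p0 q0; nra.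
  rewrite -mulrA ler_wpM2l// mulrC.
  by apply: le_trans (onenD _ _) _; rewrite normrN.
exists (`|M| * K * (1 + `|a|) ^+ n).
apply: cdbound_le (cdbound_affine a z hM) => x.
have p0 : 0 <= (1 + `|a|) ^+ n by rewrite exprn_ge0// addr_ge0.
rewrite mulrC [leRHS]mulrAC ler_wpM2r//.
apply: (@le_trans _ _ (`|M| * wt N (a *: x + z))); first by rewrite ler_wpM2r ?wt_ge0// ler_norm.
by rewrite -mulrA ler_wpM2l.
Qed.

Lemma cschwartz_trans (f : V -> C) z : cschwartz f -> cschwartz (fun y => f (y + z)).
Proof.
move=> sf; have := cschwartz_affine z (oner_neq0 _) sf.
by under eq_fun do rewrite scale1r.
Qed.

End Schwartz.

Section TestFunctions.
Variables (R : realType) (m : nat).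
Local Notation V := 'rV[R]_m.
Local Notation C := R[i].
Implicit Types (f g : V -> R) (x y : V) (n N : nat).

Lemma continuous_bounded f (r : R) : continuous f ->
  exists2 M, 0 <= M & forall x, `|x| <= r -> `|f x| <= M.
Proof.
move=> cf; pose A := [set v : V | forall i : 'I_m, `[- r, r]%classic (v ord0 i)].
have cA : compact A by apply: (@rV_compact R m (fun _ => `[- r, r]%classic)) => i; exact: segment_compact.
have cfA : {within A, continuous f} by exact: continuous_subspaceT.
have [M [_ hM]] := compact_bounded (continuous_compact cfA cA).
exists (`|M| + 1); first by rewrite addr_ge0.
move=> x xr; apply: (hM (`|M| + 1)); first by rewrite (le_lt_trans (ler_norm M))// ltrDl.
exists x => // i; rewrite /= in_itv/= -ler_norml.
exact: le_trans (coord_le_norm x i) xr.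
Qed.

Lemma pd_eq0_outside i f (r : R) : (forall x, r < `|x| -> f x = 0) ->
  forall x, r < `|x| -> pd i f x = 0.
Proof.
move=> h x rx; rewrite /pd (@near_eq_derive _ _ _ f (cst 0)) ?derive_cst//.
have : \forall y \near x, r < `|y| by exact: (cvgr_gt _ (@norm_continuous R _ x) r rx).
by apply: filterS => y; exact: h.
Qed.

Lemma test_schwartz f : test f -> schwartz f.
Proof.
move=> [sf [r hr]]; apply: dbound_schwartz => n N.
have [|M _ hM] := @smooth_dbound_weight R m (wt N) n f (wt_ge0 N) sf.
  move=> s.
  have h0 : forall x, r < `|x| -> dseq s f x = 0.
    elim/last_ind: s f sf hr => [//|s i IH] f sf hr; rewrite dseq_rcons.
    by apply: IH; [exact: smooth_pd|exact: pd_eq0_outside].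
  have cs : continuous (fun x => (1 + `|x|) ^+ N * dseq s f x).
    apply: continuous_mul; last by case: (sf s).
    elim: N => [|N IH]; first by move=> x; under eq_fun do rewrite expr0; exact: cst_continuous.
    under eq_fun do rewrite exprS.
    apply: continuous_mul => //; apply: continuous_add; last exact: norm_continuous.
    by move=> x; exact: cst_continuous.
  have [M M0 hM] := continuous_bounded r cs.
  exists M => x; have [xr|xr] := leP `|x| r; last by rewrite h0// normr0 mulr_ge0// wt_ge0.
  rewrite /wt ler_pdivlMr ?onenX_gt0// mulrC.
  by apply: le_trans (hM x xr); rewrite normrM [leRHS]mulrC mulrC ler_wpM2l// ler_norm.
by exists M.
Qed.

Lemma ctest_schwartz (f : V -> C) : ctest f -> cschwartz f.
Proof. by move=> [h1 h2]; split; exact: test_schwartz. Qed.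

Lemma csmooth_cdbound (f : V -> C) n : csmooth f -> exists b, cdbound n f b.
Proof.
move=> [/(smooth_dbound_ex n)[b1 h1] /(smooth_dbound_ex n)[b2 h2]].
exists (fun x => b1 x + b2 x); split; [apply: dbound_le h1|apply: dbound_le h2] => x;
  by rewrite (lerDl, lerDr) ?(dbound_ge0 h1) ?(dbound_ge0 h2).
Qed.

Lemma cdbound_csmooth (f : V -> C) : (forall n, exists b, cdbound n f b) -> csmooth f.
Proof. by move=> h; split; apply: dbound_smooth => n; have [b []] := h n; exists b. Qed.

Lemma csmooth_wave (xi : V) : csmooth (wave xi).
Proof. by apply: cdbound_csmooth => n; eexists; exact: cdbound_wave. Qed.

Lemma csmooth_mul (f g : V -> C) : csmooth f -> csmooth g -> csmooth (fun x => f x * g x).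
Proof.
move=> hf hg; apply: cdbound_csmooth => n.
have [b1 h1] := csmooth_cdbound n hf; have [b2 h2] := csmooth_cdbound n hg.
by eexists; exact: cdbound_mul h1 h2.
Qed.

Lemma ctestP (f : V -> C) : ctest f <-> csmooth f /\ exists r : R, forall x, r < `|x| -> f x = 0.
Proof.
split=> [[[s1 [r1 h1]] [s2 [r2 h2]]]|[[s1 s2] [r hr]]].
  split => //; exists (Num.max r1 r2) => x; rewrite gt_max => /andP[x1 x2].
  by have := h1 x x1; have := h2 x x2; case: (f x) => a b /= -> ->.
by split; split => //; exists r => x rx; rewrite hr.
Qed.

Lemma ctest_mul (f g : V -> C) : csmooth g -> ctest f -> ctest (fun x => f x * g x).
Proof.
move=> sg /ctestP[sf [r hr]]; apply/ctestP; split; first exact: csmooth_mul.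
by exists r => x rx; rewrite hr// mul0r.
Qed.

Lemma ctest_wave (f : V -> C) (xi : V) : ctest f -> ctest (fun x => f x * wave xi x).
Proof. by apply: ctest_mul; exact: csmooth_wave. Qed.

Lemma ctest_trans (f : V -> C) (z : V) : ctest f -> ctest (fun x => f (x + z)).
Proof.
move=> /ctestP[sf [r hr]]; apply/ctestP; split.
  apply: cdbound_csmooth => n; have [b h] := csmooth_cdbound n sf.
  by eexists; exact: cdbound_trans h.
exists (r + `|z|) => x rx; apply: hr; rewrite -(ltrD2r `|z|); apply: (lt_le_trans rx).
by rewrite -[X in `|X| <= _](addrK z x) -(normrN z) ler_normD.
Qed.

End TestFunctions.

(** * Landau's inequality and its consequence for bounded sequences *)

Section Interpolation.
Variables (R : realType) (m : nat).
Local Notation V := 'rV[R]_m.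

(** Landau's inequality: a small function with bounded second derivatives has small first
    derivatives. The factor 2 counts the two endpoints of the step [t]. *)
Lemma landau_pd i (f : V -> R) (x : V) (M eta t : R) : dbound 2 f (fun _ => M) ->
  0 < t -> `|f x| <= eta -> `|f (t *: ev R i + x)| <= eta ->
  `|pd i f x| <= 2 * eta / t + t * M.
Proof.
move=> hf t0 h1 h2.
have df := dbound_derivable hf i.
have hi := dbound_pd hf i; have dpi := dbound_derivable hi i.
pose c := pd i f x.
(* Subtracting the linear part makes the derivative vanish at [x]; by the mean value theorem it is
   at most [|th| * M] along the line, and a second use bounds the increment of [g]. *)
pose g := fun y : V => f y - c * y 0 i.
have dg y : derivable g y (ev R i) /\ 'D_(ev R i) g y = pd i f y - c.
  have [d1 d2] := derivable_coord i i y; rewrite eqxx in d2.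
  have d3 := derivableM (derivable_cst c y (ev R i)) d1.
  split; first exact: (derivableB (df y) d3).
  transitivity ('D_(ev R i) f y - 'D_(ev R i) (c \*o (fun y : V => y 0 i)) y).
    exact: (deriveB (df y) d3).
  by rewrite (deriveMl c d1) -[X in _ - c * X]/(pd i (fun y : V => y 0 i) y) d2 mulr1.
have t0' := ltW t0.
have := @line_mvt R m g x (ev R i) t (t * M) (fun y => (dg y).1).
have hth th : `|th| <= `|t| -> `|'D_(ev R i) g (th *: ev R i + x)| <= t * M.
  move=> ht; rewrite (dg _).2.
  have M0 : 0 <= M by exact: (dbound_ge0 hf x).
  apply: (@le_trans _ _ (`|th| * M)); last by rewrite ler_wpM2r// -[t in leRHS]ger0_norm.
  apply: (line_mvt dpi) => th' _.
  exact: (dbound_bound (dbound_pd hi i)).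
move=> /(_ hth); rewrite /g !mxE !eqxx mulr1 (ger0_norm t0').
set a := f _; set b := f x => H.
have {}H : `|t * c| <= `|a| + `|b| + t * (t * M).
  have -> : t * c = a - b - (a - c * (t + x 0 i) - (b - c * x 0 i)) by ring.
  apply: le_trans (ler_normB _ _) _; rewrite lerD//; exact: ler_normB.
rewrite -/c -(ler_pM2l t0).
rewrite normrM (ger0_norm t0') in H; apply: le_trans H _.
have -> : t * (2 * eta / t + t * M) = eta + eta + t * (t * M) by field; rewrite gt_eqF.
by rewrite lerD2r lerD.
Qed.

Definition eventually (P : nat -> Prop) := exists k0 : nat, forall k, (k0 <= k)%N -> P k.

Lemma eventually_and (P Q : nat -> Prop) : eventually P -> eventually Q ->
  eventually (fun k => P k /\ Q k).
Proof.
move=> [k1 h1] [k2 h2]; exists (maxn k1 k2) => k; rewrite geq_max => /andP[a b].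
by split; [exact: h1|exact: h2].
Qed.

Lemma eventuallyS (P Q : nat -> Prop) : (forall k, P k -> Q k) -> eventually P -> eventually Q.
Proof. by move=> PQ [k0 h]; exists k0 => k hk; apply: PQ; exact: h. Qed.

Lemma eventually_fin (I : finType) (P : I -> nat -> Prop) : (forall i, eventually (P i)) ->
  eventually (fun k => forall i, P i k).
Proof.
move=> /choice[k0 h]; exists (\max_i k0 i) => k hk i; apply: h.
exact: leq_trans (leq_bigmax i) hk.
Qed.

Definition locunif0 (f : nat -> V -> R) := forall Y e : R, 0 < e ->
  eventually (fun k => forall x, `|x| <= Y -> `|f k x| <= e).

(** One spare power of the weight makes the tail |x| > |M|/e small uniformly in [k]; on the
    remaining ball local uniform convergence is enough. *)
Lemma locunif0_bound N (f : nat -> V -> R) (e M : R) :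
  (forall k x, `|f k x| <= M * wt N.+1 x) -> locunif0 f -> 0 < e ->
  eventually (fun k => forall x, `|f k x| <= e * wt N x).
Proof.
move=> hM h0 e0.
pose Y := `|M| / e.
have Y0 : 0 <= Y by rewrite divr_ge0// ltW.
have Y1 : 0 < 1 + Y by rewrite ltr_pwDl.
have e' : 0 < e / (1 + Y) ^+ N by rewrite divr_gt0// exprn_gt0.
apply: eventuallyS (h0 Y _ e') => k hk x; have [xY|xY] := leP `|x| Y.
  apply: le_trans (hk x xY) _; rewrite ler_wpM2l ?(ltW e0)//.
  rewrite /wt lef_pV2 ?posrE ?exprn_gt0 ?onen_gt0// lerXn2r ?nnegrE ?addr_ge0// lerD2l//.
apply: le_trans (hM k x) _.
rewrite -addn1 wtD mulrCA mulrC ler_wpM2r ?wt_ge0//.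
rewrite /wt expr1 ler_pdivrMr ?onen_gt0//.
apply: le_trans (ler_norm _) _.
have -> : `|M| = e * Y by rewrite /Y mulrC divfK// gt_eqF.
by rewrite ler_wpM2l ?(ltW e0)// ltW// (lt_le_trans xY)// lerDr.
Qed.

(** The hypotheses pass from [f] to its partial derivatives: the uniform bounds do so trivially, the
    local uniform convergence by Landau's inequality. Hence an induction on [n]. *)
Lemma locunif0_dbound n N (f : nat -> V -> R) (e : R) :
  (forall n' N', exists M, forall k, dbound n' (f k) (fun x => M * wt N' x)) ->
  locunif0 f -> 0 < e ->
  eventually (fun k => dbound n (f k) (fun x => e * wt N x)).
Proof.
elim: n f => [|n IH] f hf h0 e0; have [M hM] := hf 0%N N.+1.
all: have base := locunif0_bound (fun k => dbound_bound (hM k)) h0 e0.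
  by apply: eventuallyS base => k hk; split => //; exact: (dbound_cont (hM k)).
have step : eventually (fun k => forall i, dbound n (pd i (f k)) (fun x => e * wt N x)).
  apply: eventually_fin => i; apply: IH => //.
    move=> n' N'; have {hM}[{}M hM] := hf n'.+1 N'.
    by exists M => k; exact: (dbound_pd (hM k)).
  move=> Y e1 e10; have {hM}[{}M hM] := hf 2%N 0%N.
  have hM2 k : dbound 2 (f k) (fun _ => `|M| + 1).
    apply: dbound_le (hM k) => x; rewrite /wt expr0 invr1 mulr1.
    by rewrite (le_trans (ler_norm M))// lerDl.
  have M1 : 0 < `|M| + 1 by rewrite ltr_wpDl.
  (* The step makes the second-derivative term at most e1/2; asking for |f| <= t e1/4 then makes the
     other term equal to e1/2. Since t <= 1, the shifted point stays in the ball of radius Y + 1. *)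
  pose t := Num.min 1 (e1 / (2 * (`|M| + 1))).
  have t0 : 0 < t by rewrite lt_min ltr01 divr_gt0// mulr_gt0.
  have t1 : t <= 1 by rewrite ge_min lexx.
  have te : t * (`|M| + 1) <= e1 / 2.
    apply: (@le_trans _ _ (e1 / (2 * (`|M| + 1)) * (`|M| + 1))).
      by rewrite ler_wpM2r ?(ltW M1)// ge_min lexx orbT.
    by rewrite invfM mulrA divfK// gt_eqF.
  have eta0 : 0 < t * e1 / 4 by rewrite divr_gt0// mulr_gt0.
  apply: eventuallyS (h0 (Y + 1) _ eta0) => k hk x xY.
  have a1 : `|x| <= Y + 1 by rewrite (le_trans xY)// lerDl.
  have a2 : `|t *: ev R i + x| <= Y + 1.
    apply: le_trans (ler_normD _ _) _; rewrite addrC lerD//.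
    rewrite normrZ (ger0_norm (ltW t0)) (@le_trans _ _ (t * 1))//; last by rewrite mulr1.
    rewrite ler_wpM2l ?(ltW t0)//; apply: norm_le_coord => // j; rewrite !mxE.
    by case: (_ && _); rewrite /= ?normr1 ?normr0.
  have L := landau_pd (hM2 k) t0 (hk x a1) (hk _ a2).
  apply: (le_trans L).
  have -> : 2 * (t * e1 / 4) / t = e1 / 2 by field; rewrite gt_eqF.
  by rewrite [leRHS](splitr e1) lerD2l.
apply: eventuallyS (eventually_and base step) => k [b s].
have [M' hM'] := hf n.+1 0%N.
split => //; first exact: (dbound_cont (hM k)).
by move=> i; split; [exact: (dbound_derivable (hM' k))|exact: s].
Qed.

End Interpolation.

(** * Tempered distributions *)

Section Tempered.
Variables (R : realType) (m : nat).
Local Notation V := 'rV[R]_m.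
Local Notation C := R[i].
Variable w : (V -> C) -> C.
Hypothesis hw : tempered w.

Lemma tempered_bound : exists K : R, exists N : nat, 0 <= K /\
  forall (f : V -> C) (M : R), cschwartz f -> cdbound N f (fun x => M * wt N x) ->
    cabs (w f) <= K * M.
Proof.
have [_ [K [N h]]] := hw; exists (2 * `|K|); exists N; split; first by rewrite mulr_ge0.
move=> f M sf hf.
have M0 : 0 <= M.
  exact: cdbound_wt_ge0 hf.
apply: (@le_trans _ _ (K * (2 * M))); last first.
  by rewrite mulrA [2 * _]mulrC ler_wpM2r// ler_wpM2r// ler_norm.
apply: h => // a s x aN sN.
have b1 : cabs (cdseq s f x) <= 2 * (M * wt N x).
  have [h1 h2] := hf.
  have e : (size s + (N - size s))%N = N by rewrite subnKC.
  rewrite -{1}e in h1; rewrite -{1}e in h2.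
  apply: le_trans (cabs_le_ReIm _) _; rewrite mulr_natl mulr2n lerD//=.
    exact: (dbound_bound (dbound_dseq h1)).
  exact: (dbound_bound (dbound_dseq h2)).
apply: le_trans (ler_pM _ (cabs_ge0 _) (mono_le a x) b1) _ => //.
rewrite mulrCA ler_wpM2l// mulrCA -[leRHS]mulr1 ler_wpM2l//.
rewrite -[leRHS](wt_cancel N x) ler_wpM2r ?wt_ge0//.
by rewrite ler_weXn2l// onen_ge1.
Qed.

Lemma tempered0 : w (fun _ => 0) = 0.
Proof.
have [h _] := hw; have := h (-1) _ _ (cschwartz0 R m) (cschwartz0 R m).
by rewrite mulr0 addr0 mulN1r addNr.
Qed.

Lemma tempered_add f g : cschwartz f -> cschwartz g ->
  w (fun x => f x + g x) = w f + w g.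
Proof.
move=> hf hg; have [h _] := hw; have := h 1 _ _ hf hg.
by rewrite mul1r => <-; congr w; apply/funext => x; rewrite mul1r.
Qed.

Lemma tempered_scale c f : cschwartz f -> w (fun x => c * f x) = c * w f.
Proof.
move=> hf; have [h _] := hw; have := h c _ _ hf (cschwartz0 R m).
by rewrite tempered0 addr0 => <-; congr w; apply/funext => x; rewrite addr0.
Qed.

Lemma tempered_sub f g : cschwartz f -> cschwartz g ->
  w (fun x => f x - g x) = w f - w g.
Proof.
move=> hf hg; rewrite -mulN1r -(tempered_scale _ hg) -tempered_add//.
  by congr w; apply/funext => x; rewrite mulN1r.
exact: cschwartz_scale.
Qed.

Lemma tempered_sum (I : Type) (r : seq I) (c : I -> C) (F : I -> V -> C) :
  (forall j, cschwartz (F j)) ->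
  w (fun x => \sum_(j <- r) c j * F j x) = \sum_(j <- r) c j * w (F j).
Proof.
move=> h; elim: r => [|j r IH].
  rewrite big_nil -[RHS]tempered0.
  by congr w; apply/funext => x; rewrite big_nil.
rewrite big_cons -IH -tempered_scale// -tempered_add.
- by congr w; apply/funext => x; rewrite big_cons.
- exact: cschwartz_scale.
- by apply: cschwartz_sum => i; exact: cschwartz_scale.
Qed.

(** This form of continuity needs smallness of the values only, never of the derivatives. It serves
    both for the two lattice sums of the regularization and for the interpolation error. *)
Lemma tempered_cvg0 (f : nat -> V -> C) (e : R) :
  (forall n N, exists M, forall k, cdbound n (f k) (fun x => M * wt N x)) ->
  (forall Y e', 0 < e' -> eventually (fun k => forall x, `|x| <= Y -> cabs (f k x) <= e')) ->
  0 < e -> eventually (fun k => cabs (w (f k)) <= e).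
Proof.
move=> hf h0 e0; have [K [N [K0 hK]]] := tempered_bound.
have K1 : 0 < K + 1 by rewrite ltr_wpDl.
have e1 : 0 < e / (K + 1) by rewrite divr_gt0.
have hr : eventually (fun k => dbound N (fun x => cRe (f k x))
    (fun x => e / (K + 1) * wt N x)).
  apply: (@locunif0_dbound _ _ N N (fun k x => cRe (f k x))) => //.
    by move=> n' N'; have [M hM] := hf n' N'; exists M => k; case: (hM k).
  move=> Y e' /(h0 Y); apply: eventuallyS => k hk x /hk; apply: le_trans; exact: Re_le_cabs.
have hi : eventually (fun k => dbound N (fun x => cIm (f k x))
    (fun x => e / (K + 1) * wt N x)).
  apply: (@locunif0_dbound _ _ N N (fun k x => cIm (f k x))) => //.
    by move=> n' N'; have [M hM] := hf n' N'; exists M => k; case: (hM k).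
  move=> Y e' /(h0 Y); apply: eventuallyS => k hk x /hk; apply: le_trans; exact: Im_le_cabs.
apply: eventuallyS (eventually_and hr hi) => k [r i].
have sf : cschwartz (f k).
  by apply/cschwartzP => n N'; have [M hM] := hf n N'; exists M.
apply: le_trans (hK _ _ sf (conj r i)) _.
by rewrite mulrCA ler_piMr ?(ltW e0)// ler_pdivrMr// mul1r lerDl.
Qed.

End Tempered.

(** * Finite lattices and uniform bounds on weighted lattice sums *)

Section Lattice.
Variable R : realType.

(* The index j : 'I_(2 * nu + 1) stands for the integer j - nu in [- nu, nu]. *)
Definition gpt (nu : nat) (h : R) (j : nat) : R := h * (j%:R - nu%:R).
Definition grid (m nu : nat) (h : R) (J : 'rV['I_(nu.*2.+1)]_m) : 'rV[R]_m :=
  map_mx (fun j : 'I_(nu.*2.+1) => gpt nu h j) J.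

(** The Cauchy density up to a constant. Its product over the coordinates factorizes, so sums and
    integrals of the weight in dimension [m] reduce to dimension one. *)
Definition omega (t : R) : R := (1 + t ^+ 2)^-1.
Definition Omega (m : nat) (x : 'rV[R]_m) : R := \prod_i omega (x 0 i).

Lemma omega_den_ge1 t : 1 <= 1 + t ^+ 2 :> R. Proof. by rewrite lerDl sqr_ge0. Qed.
Lemma omega_gt0 t : 0 < omega t.
Proof. by rewrite invr_gt0 (lt_le_trans ltr01)// omega_den_ge1. Qed.
Lemma omega_le1 t : omega t <= 1.
Proof. by rewrite invf_le1 ?omega_den_ge1// (lt_le_trans ltr01)// omega_den_ge1. Qed.

(** A telescoping majorant: with a = h n, the next term h/(1 + (a + h)^2) is at most the increment
    2h/((1 + a)(1 + a + h)) of the right-hand side, because 2(1 + (a + h)^2) - (1 + a)(1 + a + h) is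
    a square plus a nonnegative term. *)
Lemma sum_omega_half (h : R) n : 0 < h -> \sum_(j < n) h * omega (h * j.+1%:R) <= 2 - 2 / (1 + h * n%:R).
Proof.
move=> h0; elim: n => [|n IH].
  by rewrite big_ord0 mulr0 addr0 divr1 subrr.
rewrite big_ord_recr/=; apply: le_trans (lerD IH (lexx _)) _.
set a := h * n%:R; have a0 : 0 <= a by rewrite mulr_ge0// ltW.
have -> : h * n.+1%:R = a + h by rewrite -natr1 mulrDr mulr1.
rewrite /omega -subr_ge0.
have d1 : 0 < 1 + a by rewrite ltr_wpDr.
have d2 : 0 < 1 + (a + h) by rewrite ltr_wpDr// addr_ge0// ltW.
have d3 : 0 < 1 + (a + h) ^+ 2 by rewrite ltr_wpDr// sqr_ge0.
have -> : 2 - 2 / (1 + (a + h)) - (2 - 2 / (1 + a) + h * (1 + (a + h) ^+ 2)^-1) =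
  h * (2 * (1 + (a + h) ^+ 2) - (1 + a) * (1 + (a + h))) /
   ((1 + a) * (1 + (a + h)) * (1 + (a + h) ^+ 2)).
  by field; rewrite !gt_eqF.
rewrite divr_ge0 ?mulr_ge0 ?(ltW h0) ?(ltW d1) ?(ltW d2) ?(ltW d3)//.
have -> : 2 * (1 + (a + h) ^+ 2) - (1 + a) * (1 + (a + h)) = (1 - (a + h)) ^+ 2 + h * (1 + (a + h)) by ring.
by rewrite addr_ge0 ?sqr_ge0// mulr_ge0// ltW.
Qed.

Lemma sum_omega nu (h : R) : 0 < h -> h <= 1 ->
  \sum_(j < nu.*2.+1) h * omega (gpt nu h j) <= 5.
Proof.
move=> h0 h1.
have H n : \sum_(j < n) h * omega (h * j.+1%:R) <= 2.
  apply: le_trans (sum_omega_half n h0) _; rewrite lerBlDr lerDl divr_ge0//.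
  by rewrite addr_ge0// mulr_ge0// ltW.
rewrite -(big_mkord xpredT (fun j => h * omega (gpt nu h j))).
rewrite (@big_cat_nat _ _ _ nu)//=; last by rewrite -addnn -addnS leq_addr.
rewrite [X in _ + X]big_ltn; last by rewrite -addnn ltnS leq_addr.
have e1 : \sum_(0 <= j < nu) h * omega (gpt nu h j) <= 2.
  apply: le_trans (H nu); rewrite big_nat_rev big_mkord/= add0n.
  apply: ler_sum => j _; rewrite /omega /gpt natrB ?ltn_ord//.
  by rewrite addrAC subrr sub0r mulrN sqrrN.
have e2 : \sum_(nu.+1 <= j < nu.*2.+1) h * omega (gpt nu h j) <= 2.
  apply: le_trans (H nu); rewrite -[nu.+1]add0n big_addn -addnn subSS addnK big_mkord.
  by apply: ler_sum => j _; rewrite /gpt addnS -addSn natrD addrK.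
(* The two half-lines contribute at most 2 each, and the centre at most h <= 1. *)
have -> : 5 = 2 + (1 + 2) :> R by ring.
rewrite lerD// lerD//.
by apply: le_trans h1; rewrite ler_piMr ?(ltW h0)// omega_le1.
Qed.

Lemma sum_prod_rV (S : comPzSemiRingType) (n m : nat) (a : 'I_m -> 'I_n -> S) :
  \sum_(J : 'rV['I_n]_m) \prod_i a i (J 0 i) = \prod_i \sum_j a i j.
Proof.
transitivity (\sum_(f : {ffun 'I_m -> 'I_n}) \prod_i a i (f i)).
  rewrite (reindex (fun f : {ffun 'I_m -> 'I_n} => \row_i f i))/=.
    by apply: eq_bigr => f _; apply: eq_bigr => i _; rewrite mxE.
  exists (fun J : 'rV['I_n]_m => [ffun i => J 0 i]) => [f _|J _].
    by apply/ffunP => i; rewrite ffunE mxE.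
  by apply/rowP => i; rewrite mxE ffunE.
by rewrite bigA_distr_bigA.
Qed.

Lemma sum_Omega m nu (h : R) : 0 < h -> h <= 1 ->
  h ^+ m * \sum_J Omega (@grid m nu h J) <= 5 ^+ m.
Proof.
move=> h0 h1.
have -> : h ^+ m * \sum_J Omega (@grid m nu h J) =
    (\sum_(j < nu.*2.+1) h * omega (gpt nu h j)) ^+ m.
  have := sum_prod_rV (fun (_ : 'I_m) (j : 'I_nu.*2.+1) => h * omega (gpt nu h j)).
  rewrite prodr_const card_ord => <-; rewrite mulr_sumr.
  apply: eq_bigr => J _.
  rewrite /Omega -{1}(card_ord m) -prodr_const -big_split/=.
  by apply: eq_bigr => i _; rewrite mxE.
rewrite lerXn2r ?nnegrE// ?sum_omega// sumr_ge0// => j _.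
by rewrite mulr_ge0 ?(ltW h0)// ltW// omega_gt0.
Qed.

(** Each factor 1 + x_i^2 is at most (1 + |x|)^2. This is the origin of the order [m.*2], the order
    of decay that is summable over lattices uniformly in the mesh. *)
Lemma wt_le_Omega m (x : 'rV[R]_m) : wt m.*2 x <= Omega x.
Proof.
rewrite /Omega /omega prodfV /wt lef_pV2 ?posrE ?onenX_gt0 ?prodr_gt0//; last first.
  by move=> i _; rewrite (lt_le_trans ltr01)// omega_den_ge1.
rewrite -mul2n exprM.
have -> : (1 + `|x|) ^+ 2 ^+ m = \prod_(i < m) ((1 + `|x|) ^+ 2) by rewrite prodr_const card_ord.
apply: ler_prod => i _; rewrite addr_ge0 ?sqr_ge0//=.
have := coord_le_norm x i; rewrite -[(x 0 i) ^+ 2]real_normK ?num_real//.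
have := normr_ge0 (x 0 i); nra.
Qed.

Lemma sum_wt m nu (h : R) : 0 < h -> h <= 1 ->
  h ^+ m * \sum_J wt m.*2 (@grid m nu h J) <= 5 ^+ m.
Proof.
move=> h0 h1; apply: le_trans (sum_Omega m nu h0 h1).
by rewrite ler_wpM2l ?exprn_ge0 ?(ltW h0)// ler_sum// => J _; exact: wt_le_Omega.
Qed.

End Lattice.

(** * Riemann sums *)

Section Integral1.
Variable R : realType.
Local Notation mu := (@lebesgue_measure R).

Lemma integrable_omega : mu.-integrable setT (EFin \o (@omega R)).
Proof.
have mo : measurable_fun setT (@omega R).
  by apply: continuous_measurable_fun; exact: (@continuous_oneDsqrV R).
apply/integrableP; split; first exact/measurable_EFinP.
under eq_integral do rewrite /= ger0_norm ?(ltW (omega_gt0 _))//.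
rewrite ge0_symfun_integralT//.
- have -> : (\int[mu]_(x in [set x | (0 <= x)%R]) (omega x)%:E = (pi / 2)%:E)%E.
    by rewrite -set_itvcy; exact: (@integral0y_oneDsqr R).
  by rewrite -EFinM ltry.
- by move=> x; rewrite ltW// omega_gt0.
- exact: (@continuous_oneDsqrV R).
- by move=> x /=; rewrite /omega sqrrN.
Qed.

Lemma int1_dct (s : nat -> R -> R) (g : R -> R) (M : R) :
  (forall k, measurable_fun setT (s k)) -> (forall t, s k t @[k --> \oo] --> g t) ->
  (forall k t, `|s k t| <= M * omega t) -> int1 (s k) @[k --> \oo] --> int1 g.
Proof.
move=> ms sg hM.
have mg : measurable_fun setT g.
  exact: (measurable_fun_cvg ms (fun x _ => sg x)).
have iM : mu.-integrable setT (EFin \o (fun t => M * omega t)).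
  have -> : EFin \o (fun t => M * omega t) = (fun t => (M%:E * (EFin \o (@omega R)) t)%E) by [].
  by apply: integrableZl => //; exact: integrable_omega.
have cE t : (s k t)%:E @[k --> \oo] --> (g t)%:E.
  apply/fine_cvgP; split; [by apply: nearW|exact: sg].
have [|||||ig _ cv] := @dominated_convergence _ _ R mu setT measurableT
  (fun k t => (s k t)%:E) (fun t => (g t)%:E) (fun t => (M * omega t)%:E).
- by move=> k; apply/measurable_EFinP; exact: ms.
- by apply/measurable_EFinP; exact: mg.
- by apply: aeW => x _; exact: cE.
- exact: iM.
- by apply: aeW => x k _; rewrite lee_fin; exact: hM.
have fi : (\int[mu]_(x in setT) (g x)%:E)%E \is a fin_num by exact: integrable_fin_num.
rewrite -(fineK fi) in cv.
exact: (fine_cvg cv).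
Qed.

Lemma int1_step (n : nat) (c a : 'I_n -> R) (h : R) : 0 < h ->
  int1 (fun t => \sum_j c j * \1_(`[a j, a j + h[%classic) t) = \sum_j h * c j.
Proof.
move=> h0; rewrite /int1 /Rintegral.
under eq_integral do rewrite -sumEFin.
have ii j : mu.-integrable setT (fun t => (c j * \1_(`[a j, a j + h[%classic) t)%:E).
  have -> : (fun t => (c j * \1_(`[a j, a j + h[%classic) t)%:E) =
     (fun t => ((c j)%:E * (EFin \o \1_(`[a j, (a j + h)%R[%classic)) t)%E) by [].
  by apply: integrableZl => //; exact: integrable_indic_itv.
rewrite integral_sum//; rewrite -sum_fine; last by move=> j _; exact: integrable_fin_num.
apply: eq_bigr => j _.
have -> : (fun t => (c j * \1_(`[a j, a j + h[%classic) t)%:E) =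
     (fun t => ((c j)%:E * (EFin \o \1_(`[a j, (a j + h)%R[%classic)) t)%E) by [].
rewrite integralZl//; last exact: integrable_indic_itv.
have Hm : (mu (`[a j, (a j + h)%R[%classic : set R) = h%:E)%E.
  by rewrite lebesgue_measure_itv/= lte_fin ltrDl h0 -EFinB [a j + h]addrC addrK.
have -> : (\int[mu]_x (EFin \o \1_(`[a j, (a j + h)%R[%classic)) x)%E = h%:E.
  by rewrite -Hm -[in RHS](setIT (`[a j, (a j + h)%R[%classic : set R)); exact: integral_indic.
by rewrite -EFinM/= mulrC.
Qed.

Lemma measurable_step (n : nat) (c a : 'I_n -> R) (h : R) :
  measurable_fun setT (fun t => \sum_j c j * \1_(`[a j, a j + h[%classic) t).
Proof.
by apply: measurable_sum => j; apply: measurable_funM.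
Qed.

End Integral1.

Section RiemannSums.
Variable R : realType.

Lemma cvg_eventually (u : nat -> R) (l : R) :
  u k @[k --> \oo] --> l <-> forall e, 0 < e -> eventually (fun k => `|u k - l| <= e).
Proof.
split.
  move=> /cvgrPdist_le h e /h [N _ hN]; exists N => k Nk.
  by rewrite distrC; exact: hN.
move=> h; apply/cvgrPdist_le => e /h [N hN]; exists N => // k Nk.
by rewrite /= distrC; exact: hN.
Qed.

Definition rsum (m nu : nat) (h : R) (f : 'rV[R]_m -> R) : R :=
  h ^+ m * \sum_J f (@grid R m nu h J).

Definition slice (m : nat) (f : 'rV[R]_m.+1 -> R) (t : R) : 'rV[R]_m -> R :=
  fun y => f (row_mx (const_mx t : 'rV[R]_1) y : 'rV[R]_(1 + m)).

Lemma rsumS m nu h (f : 'rV[R]_m.+1 -> R) :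
  rsum nu h f = \sum_(j < nu.*2.+1) h * rsum nu h (slice f (gpt nu h j)).
Proof.
rewrite /rsum -mulr_sumr -mulr_sumr exprS -mulrA; congr (_ * (_ * _)).
rewrite pair_big/=.
pose F (p : 'I_(nu.*2.+1) * 'rV['I_(nu.*2.+1)]_m) : 'rV['I_(nu.*2.+1)]_m.+1 :=
  row_mx (const_mx p.1 : 'rV_1) p.2 : 'rV_(1 + m).
rewrite (reindex F)/=.
  apply: eq_bigr => -[j J] _; rewrite /slice /F /= /grid; congr f.
  by rewrite (@map_row_mx _ _ _ 1 1 m) map_const_mx.
exists (fun J : 'rV['I_(nu.*2.+1)]_(1 + m) => (lsubmx J 0 0, rsubmx J)) => [[j J] _|J _].
  by rewrite /F/= row_mxKl row_mxKr mxE.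
move: J; change 'rV['I_(nu.*2.+1)]_m.+1 with 'rV['I_(nu.*2.+1)]_(1 + m) => J.
rewrite /F/=; have -> : const_mx (lsubmx J 0 0) = lsubmx J :> 'rV_1.
  by apply/matrixP => a b; rewrite !mxE !ord1.
exact: hsubmxK.
Qed.

Lemma Omega_row m (t : R) (y : 'rV[R]_m) :
  Omega (row_mx (const_mx t : 'rV[R]_1) y : 'rV[R]_(1 + m)) = omega t * Omega y.
Proof.
rewrite /Omega big_split_ord/= big_ord1 row_mxEl mxE; congr (_ * _).
by apply: eq_bigr => i _; rewrite row_mxEr.
Qed.

(** A class of integrands stable under freezing the first variable: the factor [omega t] then moves
    into the constant. The Lipschitz condition is asked along the axes only and decays like the
    function. *)
Definition riem m (f : 'rV[R]_m -> R) (M : R) :=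
  (forall x, `|f x| <= M * Omega x) /\
  (forall i (t : R) x, `|t| <= 1 -> `|f (t *: ev R i + x) - f x| <= M * `|t| * Omega x).

Lemma row_line0 m (s t : R) (y : 'rV[R]_m) :
  (row_mx (const_mx (s + t) : 'rV[R]_1) y : 'rV[R]_(1 + m)) =
  s *: ev R (lshift m (0 : 'I_1)) + row_mx (const_mx t : 'rV[R]_1) y.
Proof.
apply/rowP => k; rewrite [RHS]mxE [X in _ = X + _]mxE [X in _ = _ * X + _]mxE eqxx/=.
case: (@split_ordP 1 m k) => j ->.
  by rewrite !row_mxEl !mxE ord1 eqxx mulr1.
by rewrite !row_mxEr eq_rlshift mulr0 add0r.
Qed.

Lemma row_lineS m (s t : R) (y : 'rV[R]_m) i :
  (row_mx (const_mx t : 'rV[R]_1) (s *: ev R i + y) : 'rV[R]_(1 + m)) =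
  s *: ev R (rshift 1 i) + row_mx (const_mx t : 'rV[R]_1) y.
Proof.
apply/rowP => k; rewrite [RHS]mxE [X in _ = X + _]mxE [X in _ = _ * X + _]mxE eqxx/=.
case: (@split_ordP 1 m k) => j ->.
  by rewrite !row_mxEl eq_lrshift mulr0 add0r.
by rewrite !row_mxEr !mxE eqxx eq_rshift.
Qed.

Lemma riem_slice m (f : 'rV[R]_m.+1 -> R) (M t : R) :
  riem f M -> riem (slice f t) (M * omega t).
Proof.
move=> [h1 h2]; split.
  by move=> y; apply: le_trans (h1 _) _; rewrite Omega_row mulrA.
move=> i s y s1; rewrite /slice row_lineS.
by apply: le_trans (h2 _ _ _ s1) _; rewrite Omega_row mulrA [M * `|s| * _]mulrAC.
Qed.

Lemma rsum_bound m nu h (f : 'rV[R]_m -> R) (M : R) : 0 < h -> h <= 1 -> 0 <= M ->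
  (forall x, `|f x| <= M * Omega x) -> `|rsum nu h f| <= 5 ^+ m * M.
Proof.
move=> h0 h1 M0 hf; rewrite /rsum normrM ger0_norm ?exprn_ge0 ?(ltW h0)//.
apply: (@le_trans _ _ (h ^+ m * \sum_J M * Omega (@grid R m nu h J))).
  rewrite ler_wpM2l ?exprn_ge0 ?(ltW h0)//.
  by apply: le_trans (ler_norm_sum _ _ _) _; apply: ler_sum => J _.
by rewrite -mulr_sumr mulrCA [leRHS]mulrC ler_wpM2l// sum_Omega.
Qed.

Lemma rsumB m nu h (f g : 'rV[R]_m -> R) :
  rsum nu h f - rsum nu h g = rsum nu h (fun x => f x - g x).
Proof. by rewrite /rsum -mulrBr sumrB. Qed.

Lemma riem_ge0 m (f : 'rV[R]_m -> R) M : riem f M -> 0 <= M.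
Proof.
move=> [/(_ 0) h _]; have : 0 <= M * Omega (0 : 'rV[R]_m) by apply: le_trans h.
have -> : Omega (0 : 'rV[R]_m) = 1.
  by rewrite /Omega big1// => i _; rewrite mxE /omega expr0n addr0 invr1.
by rewrite mulr1.
Qed.

Lemma rsum_slice_lip m nu h (f : 'rV[R]_m.+1 -> R) (M s t : R) : 0 < h -> h <= 1 ->
  riem f M -> `|s| <= 1 ->
  `|rsum nu h (slice f (s + t)) - rsum nu h (slice f t)| <= 5 ^+ m * (M * `|s| * omega t).
Proof.
move=> h0 h1 hf s1; have M0 := riem_ge0 hf.
rewrite rsumB; apply: rsum_bound => //.
  by rewrite !mulr_ge0// ltW// omega_gt0.
move=> y; rewrite /slice row_line0; apply: le_trans (hf.2 _ _ _ s1) _.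
by rewrite Omega_row mulrA.
Qed.

(** The difference 3(1 + (s + t)^2) - (1 + t^2) equals (2t + 3s)^2/2 + 2 - 3s^2/2, which is positive
    for |s| <= 1. *)
Lemma omega_shift (s t : R) : `|s| <= 1 -> omega (s + t) <= 3 * omega t.
Proof.
move=> s1; rewrite /omega ler_pdivlMr ?(lt_le_trans ltr01 (omega_den_ge1 _))//.
rewrite mulrC ler_pdivrMr ?(lt_le_trans ltr01 (omega_den_ge1 _))//.
have s2 : s ^+ 2 <= 1 by rewrite -real_normK ?num_real// expr_le1.
have := sqr_ge0 (t + 2 * s); have := sqr_ge0 (2 * t + 3 * s); nra.
Qed.

Section Step.
Variables (nu : nat) (h : R) (c : 'I_(nu.*2.+1) -> R).
Hypothesis h0 : 0 < h.
Definition step (t : R) := \sum_j c j * \1_(`[gpt nu h j, gpt nu h j + h[%classic) t.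

Lemma gpt_inj_cell (t : R) (j j' : nat) :
  gpt nu h j <= t < gpt nu h j + h -> gpt nu h j' <= t < gpt nu h j' + h -> j = j'.
Proof.
rewrite /gpt => /andP[a b] /andP[a' b'].
have e1 : h * (j%:R - nu%:R) < h * (j'%:R - nu%:R + 1) by rewrite [ltRHS]mulrDr mulr1 (le_lt_trans a b').
have e2 : h * (j'%:R - nu%:R) < h * (j%:R - nu%:R + 1) by rewrite [ltRHS]mulrDr mulr1 (le_lt_trans a' b).
rewrite ltr_pM2l// in e1; rewrite ltr_pM2l// in e2.
apply/eqP; rewrite eqn_leq; apply/andP; split.
  by rewrite -ltnS -(ltr_nat R) -natr1; lra.
by rewrite -ltnS -(ltr_nat R) -natr1; lra.
Qed.

Lemma step_cell t (j : 'I_(nu.*2.+1)) : gpt nu h j <= t < gpt nu h j + h -> step t = c j.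
Proof.
move=> tj; rewrite /step (bigD1 j)//= big1 ?addr0.
  by rewrite indicE mem_set/= ?in_itv//= mulr1.
move=> i ij; rewrite indicE memNset/= ?mulr0// in_itv/= => ti.
by case/eqP: ij; apply: val_inj; exact: gpt_inj_cell ti tj.
Qed.

Lemma step_cases t : step t = 0 \/
  exists2 j : 'I_(nu.*2.+1), gpt nu h j <= t < gpt nu h j + h & step t = c j.
Proof.
have [[j hj]|n] := pselect (exists j : 'I_(nu.*2.+1), gpt nu h j <= t < gpt nu h j + h).
  by right; exists j => //; exact: step_cell.
left; rewrite /step big1// => j _; rewrite indicE memNset/= ?mulr0// in_itv/= => hj.
by apply: n; exists j.
Qed.

Lemma cell_exists t : `|t| <= h * nu%:R ->
  exists j : 'I_(nu.*2.+1), gpt nu h j <= t < gpt nu h j + h.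
Proof.
rewrite ler_norml => /andP[t1 t2].
pose x := t / h + nu%:R.
have x0 : 0 <= x by rewrite -lerBlDr sub0r ler_pdivlMr// mulrC mulrN.
have x1 : x <= nu.*2%:R by rewrite -addnn natrD lerD2r ler_pdivrMr// mulrC.
have /andP[n1 n2] := truncn_itv x0.
have jn : (Num.truncn x < nu.*2.+1)%N.
  by rewrite ltnS -(ler_nat R) (le_trans n1).
exists (Ordinal jn); rewrite /gpt /=.
have te : t = h * (x - nu%:R) by rewrite /x addrK mulrC divfK ?gt_eqF.
rewrite {1 2}te ler_pM2l// lerD2r n1/= -[X in _ < _ + X]mulr1 -mulrDr ltr_pM2l// [ltRHS]addrAC ltrD2r.
by rewrite natr1.
Qed.

End Step.

(** Induction on the dimension. The lattice sum is the integral of a step function of the first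
    variable whose values are lattice sums of slices; these converge pointwise to the inner
    integral, and dominated convergence concludes. The inner integral is measurable as a pointwise
    limit of step functions, so neither its continuity nor Fubini's theorem enters. *)
Lemma rsum_cvg m (f : 'rV[R]_m -> R) (M : R) (nu : nat -> nat) (h : nat -> R) :
  (forall k, 0 < h k) -> (forall k, h k <= 1) ->
  (forall e, 0 < e -> eventually (fun k => h k <= e)) ->
  (forall T : R, eventually (fun k => T <= h k * (nu k)%:R)) ->
  riem f M -> rsum (nu k) (h k) f @[k --> \oo] --> iint f.
Proof.
move=> h0 h1 hh hnu; elim: m f M => [|m IH] f M hf.
  have -> : (fun k => rsum (nu k) (h k) f) = (fun _ => iint f).
    apply/funext => k; rewrite /rsum expr0 mul1r /=.
    rewrite (eq_bigr (fun _ => f 0)); last first.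
      by move=> J _; congr f; apply/rowP => -[].
    by rewrite sumr_const card_mx muln0 expn0 mulr1n.
  exact: cvg_cst.
have M0 := riem_ge0 hf.
pose c k (j : 'I_((nu k).*2.+1)) := rsum (nu k) (h k) (slice f (gpt (nu k) (h k) j)).
pose g t := iint (slice f t).
have -> : (fun k => rsum (nu k) (h k) f) = (fun k => int1 (step (h k) (c k))).
  by apply/funext => k; rewrite rsumS int1_step.
change (int1 (step (h k) (c k)) @[k --> \oo] --> int1 g).
have near_c k t j : gpt (nu k) (h k) j <= t < gpt (nu k) (h k) j + h k ->
    exists2 s, `|s| <= h k & gpt (nu k) (h k) j = s + t.
  move=> /andP[a b]; exists (gpt (nu k) (h k) j - t); last by rewrite subrK.
  by rewrite distrC ger0_norm ?subr_ge0// lerBlDr addrC ltW.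
(* The factor 5^m bounds the lattice sum of a slice; the factor 3 replaces the node of a cell by the
   point [t] of that cell inside [omega]. *)
apply: (@int1_dct R _ _ (5 ^+ m * (M * 3))).
- by move=> k; exact: measurable_step.
- move=> t; apply/cvg_eventually => e e0.
  have := IH (slice f t) _ (riem_slice t hf); move=> /cvg_eventually/(_ (e / 2) _) c1.
  have e2 : 0 < e / 2 by rewrite divr_gt0.
  have {}c1 := c1 e2.
  pose K := 5 ^+ m * M + 1.
  have K0 : 0 < K by rewrite ltr_wpDl// mulr_ge0// exprn_ge0.
  have e3 : 0 < e / (2 * K) by rewrite divr_gt0// mulr_gt0.
  have c2 := hh _ e3.
  apply: eventuallyS (eventually_and (hnu `|t|) (eventually_and c1 c2)) => k [tk [k1 k2]].
  have [j tj] := cell_exists (h0 k) tk.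
  rewrite (step_cell _ (h0 k) tj) /c.
  have [s sk ->] := near_c _ _ _ tj.
  rewrite [leRHS](splitr e).
  have -> : rsum (nu k) (h k) (slice f (s + t)) - g t =
    (rsum (nu k) (h k) (slice f (s + t)) - rsum (nu k) (h k) (slice f t)) +
     (rsum (nu k) (h k) (slice f t) - g t) by rewrite addrA subrK.
  apply: le_trans (ler_normD _ _) _; rewrite lerD//.
  apply: le_trans (rsum_slice_lip _ _ (h0 k) (h1 k) hf (le_trans sk (h1 k))) _.
  apply: (@le_trans _ _ (K * h k)).
    apply: (@le_trans _ _ (5 ^+ m * M * `|s|)).
      by rewrite -[leRHS]mulrA ler_wpM2l ?exprn_ge0// ler_piMr ?mulr_ge0// omega_le1.
    apply: ler_pM => //; first by rewrite mulr_ge0// exprn_ge0.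
    by rewrite /K lerDl.
  have -> : e / 2 = K * (e / (2 * K)) by field; rewrite gt_eqF.
  by rewrite ler_wpM2l// ltW.
- move=> k t; have [->|[j tj ->]] := step_cases (c k) (h0 k) t.
    by rewrite normr0 !mulr_ge0 ?exprn_ge0// ltW// omega_gt0.
  have [s sk e] := near_c _ _ _ tj.
  rewrite /c e; apply: le_trans (rsum_bound _ (h0 k) (h1 k) _ (riem_slice (s + t) hf).1) _.
    by rewrite mulr_ge0// ltW// omega_gt0.
  rewrite -!mulrA ler_wpM2l ?exprn_ge0// ler_wpM2l//.
  exact: omega_shift (le_trans sk (h1 k)).
Qed.

End RiemannSums.

(** * Summation by parts on lattices *)

Section SineBound.
Variable R : realType.

Lemma sin_le_id (t : R) : 0 <= t -> sin t <= t.
Proof.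
move=> t0.
have [c _] := @MVT_segment R sin cos 0 t t0 (fun x _ => is_derive_sin x)
  (continuous_subspaceT (@continuous_sin R)).
rewrite sin0 !subr0 => ->; rewrite ler_piMl// (le_trans (ler_norm _))// cos_max//.
Qed.

Lemma cos_ge_quad (t : R) : 0 <= t -> 1 - t ^+ 2 <= cos t.
Proof.
move=> t0.
have [c /[!in_itv]/= /andP[c0 ct]] := @MVT_segment R cos (fun x => - sin x) 0 t t0
  (fun x _ => is_derive_cos x) (continuous_subspaceT (@continuous_cos R)).
rewrite cos0 subr0 => /eqP; rewrite subr_eq => /eqP ->.
rewrite addrC lerD2r mulNr lerN2 expr2 ler_wpM2r//.
exact: le_trans (sin_le_id c0) ct.
Qed.

(** Up to 1/2 the cosine is at least 1/2, so sin t >= t/2. Beyond, sin t >= sin(1/2) >= 1/4, and t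
    <= pi/2 <= 2 gives t/8. *)
Lemma sin_ge_quarter (t : R) : 0 <= t <= pi / 2 -> t / 8 <= sin t.
Proof.
move=> /andP[t0 t2].
have small (s : R) : 0 <= s <= 1 / 2 -> s / 2 <= sin s.
  move=> /andP[s0 s1].
  have [c /[!in_itv]/= /andP[c0 cs]] := @MVT_segment R sin cos 0 s s0
    (fun x _ => is_derive_sin x) (continuous_subspaceT (@continuous_sin R)).
  rewrite sin0 !subr0 => ->; rewrite mulrC ler_wpM2r//.
  apply: le_trans (cos_ge_quad c0); nra.
have [t1|t1] := leP t (1 / 2).
  apply: le_trans (small t _); last by rewrite t0.
  lra.
have s12 : (1 / 2 : R) / 2 <= sin (1 / 2) by apply: small; apply/andP; split; lra.
have p2 : pi / 2 <= 2 :> R by case: (pihalf_02_cos_pihalf R) => /andP[].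
have : sin (1 / 2) <= sin t.
  have [c /[!in_itv]/= /andP[c0 ct] E] := @MVT_segment R sin cos (1 / 2) t (ltW t1)
    (fun x _ => is_derive_sin x) (continuous_subspaceT (@continuous_sin R)).
  rewrite -subr_ge0 E mulr_ge0//; last by rewrite subr_ge0 ltW.
  apply: cos_ge0_pihalf; apply/andP; split; lra.
lra.
Qed.

(** The half-angle identity gives |exp(i th) - 1| = 2 |sin(th/2)|. The bound turns the phase factors
    of summation by parts into powers of a frequency, and later separates distinct roots of
    unity. *)
Lemma cabs_expi_sub1 (th : R) : `|th| <= pi -> `|th| / 8 <= cabs (expi th - 1).
Proof.
move=> h.
have E : cabs (expi th - 1) = 2 * `|sin (th / 2)|.
  have -> : th = th / 2 + th / 2 by rewrite -splitr.
  rewrite /cabs /expi/= cosD sinD.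
  have e : 2 * `|sin ((th / 2 + th / 2) / 2)| = `|2 * sin (th / 2)|.
    by rewrite -splitr normrM ger0_norm.
  rewrite e -sqrtr_sqr; congr Num.sqrt.
  have := cos2Dsin2 (th / 2); set c := cos _; set s := sin _ => cs.
  have -> : c ^+ 2 = 1 - s ^+ 2 -> (c * c - s * s - 1) ^+ 2 + (s * c + c * s - 0) ^+ 2 =
     (2 * s) ^+ 2.
    move=> c2; have -> : (s * c + c * s - 0) ^+ 2 = 4 * s ^+ 2 * c ^+ 2 by ring.
    have -> : c * c = c ^+ 2 by rewrite expr2.
    by rewrite c2; ring.
  by [].
  by rewrite -cs addrK.
have S : `|th| / 2 / 8 <= `|sin (th / 2)|.
  have sN : `|sin (th / 2)| = `|sin (`|th| / 2)|.
    have [t0|t0] := leP 0 th; first by rewrite (ger0_norm t0).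
    by rewrite (ltr0_norm t0) mulNr sinN normrN.
  rewrite sN; apply: le_trans (ler_norm _); apply: sin_ge_quarter.
  by rewrite divr_ge0//= ler_pM2r.
rewrite E; lra.
Qed.

End SineBound.

Section FiniteDifferences.
Variables (R : realType) (m : nat).
Local Notation V := 'rV[R]_m.
Local Notation C := R[i].

Definition dif (W : zmodType) (i : 'I_m) (h : R) (F : V -> W) : V -> W :=
  fun x => F (h *: ev R i + x) - F x.

Lemma pd_dif i h (f : V -> R) : (forall x, derivable f x (ev R i)) ->
  (forall x, derivable (dif i h f) x (ev R i)) /\ pd i (dif i h f) = dif i h (pd i f).
Proof.
move=> df.
have P x := @pd_affine R m i f 1 (h *: ev R i) x df.
have E : (fun y : V => f (1 *: y + h *: ev R i)) = (fun y => f (h *: ev R i + y)).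
  by apply/funext => y; rewrite scale1r addrC.
rewrite E in P.
split=> [x|]; first by apply: derivableB => //; case: (P x).
apply/funext => x; case: (P x) => P1 P2.
transitivity ('D_(ev R i) (fun y => f (h *: ev R i + y)) x - 'D_(ev R i) f x).
  exact: (deriveB P1 (df x)).
by rewrite /dif -/(pd i _ _) P2 mul1r scale1r [x + _]addrC.
Qed.

Lemma pd_difn q i h (f : V -> R) : (forall x, derivable f x (ev R i)) ->
  (forall x, derivable (iter q (dif i h) f) x (ev R i)) /\
  pd i (iter q (dif i h) f) = iter q (dif i h) (pd i f).
Proof.
move=> df; elim: q => [//|q [IH1 IH2]].
by have [h1 h2] := pd_dif h IH1; split => //; rewrite /= h2 IH2.
Qed.

Lemma difn_bound q i h (f : V -> R) (b : V -> R) x (B : R) : 0 <= h ->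
  dbound q f b -> (forall t, `|t| <= q%:R * h -> b (t *: ev R i + x) <= B) ->
  `|iter q (dif i h) f x| <= h ^+ q * B.
Proof.
move=> h0; elim: q f x => [|q IH] f x hf hB.
  rewrite expr0 mul1r /=; apply: le_trans (dbound_bound hf x) _.
  by have := hB 0; rewrite normr0 mul0r scale0r add0r; apply.
have [d1 d2] := pd_difn q h (dbound_derivable hf i).
rewrite /= exprS -mulrA {1}/dif -[X in _ <= X * _](ger0_norm h0).
apply: (line_mvt d1) => th hth; rewrite -/(pd i _ _) d2.
apply: IH; first exact: (dbound_pd hf).
move=> t ht; rewrite addrA -scalerDl; apply: hB.
rewrite -natr1 mulrDl mul1r (le_trans (ler_normD _ _))// lerD//.
by rewrite (ger0_norm h0) in hth.
Qed.

Lemma Re_difn q i h (F : V -> C) x :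
  cRe (iter q (dif i h) F x) = iter q (dif i h) (fun x => cRe (F x)) x.
Proof. by elim: q x => [//|q IH] x; rewrite /= /dif -!IH; case: (iter _ _ _ _) => ? ?; case: (iter _ _ _ _). Qed.

Lemma Im_difn q i h (F : V -> C) x :
  cIm (iter q (dif i h) F x) = iter q (dif i h) (fun x => cIm (F x)) x.
Proof. by elim: q x => [//|q IH] x; rewrite /= /dif -!IH; case: (iter _ _ _ _) => ? ?; case: (iter _ _ _ _). Qed.

Definition csum nu (h : R) (F : V -> C) : C := (h ^+ m)%:C * \sum_J F (@grid R m nu h J).

(** The shift is cyclic, hence a bijection of the finite index set; the wrapped nodes lie outside
    the support of the summand. *)
Definition shift_index nu (i : 'I_m) (J : 'rV['I_(nu.*2.+1)]_m) : 'rV['I_(nu.*2.+1)]_m :=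
  \row_j (if j == i then ordS (J 0 j) else J 0 j).
Definition unshift_index nu (i : 'I_m) (J : 'rV['I_(nu.*2.+1)]_m) : 'rV['I_(nu.*2.+1)]_m :=
  \row_j (if j == i then ord_pred (J 0 j) else J 0 j).

Lemma sum_grid_shift nu (h rho : R) i (Q : V -> C) : 0 < h ->
  (forall x : V, rho < `|x 0 i| -> Q x = 0) -> rho < h * nu%:R ->
  \sum_J Q (h *: ev R i + @grid R m nu h J) = \sum_J Q (@grid R m nu h J).
Proof.
move=> h0 Q0 hrho; rewrite [RHS](reindex (@shift_index nu i))/=; last first.
  exists (@unshift_index nu i) => J _; apply/rowP => j; rewrite !mxE.
    by case: eqP => // _; rewrite ordSK.
  by case: eqP => // _; rewrite ord_predK.
apply: eq_bigr => J _.
have [jl|jl] := ltnP (J 0 i) (nu.*2).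
  congr Q; apply/rowP => j; rewrite !mxE eqxx/=.
  case: eqP => [->|_]; last by rewrite mulr0 add0r.
  rewrite mulr1 /gpt /= modn_small; last by rewrite ltnS.
  by rewrite -natr1; ring.
(* At the last index the translated node has i-th coordinate h (nu + 1), whereas the cyclic one has
   -h nu. Both exceed [rho] in modulus, so both terms vanish. *)
have je : nat_of_ord (J 0 i) = nu.*2.
  by apply/eqP; rewrite eqn_leq jl andbT -ltnS ltn_ord.
rewrite !Q0//.
  rewrite !mxE eqxx /gpt/= je modnn sub0r mulrN normrN ger0_norm// mulr_ge0//.
  exact: ltW.
rewrite !mxE !eqxx/= mulr1 /gpt je -addnn natrD addrK.
by rewrite ger0_norm ?addr_ge0 ?mulr_ge0 ?(ltW h0)// (lt_le_trans hrho)// lerDr ltW.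
Qed.

(** Moving the translation from [F] to the wave multiplies the latter by the constant phase exp(i h
    xi_i). *)
Lemma csum_dif nu (h rho : R) i (F : V -> C) (xi : V) : 0 < h ->
  (forall x : V, rho < `|x 0 i| -> F x = 0) -> rho < h * nu%:R ->
  csum nu h (fun x => dif i h F x * wave xi x) =
  (expi (h * xi 0 i) - 1) * csum nu h (fun x => F x * wave xi x).
Proof.
move=> h0 F0 hrho; rewrite /csum mulrCA; congr (_ * _).
have E x : dif i h F x * wave xi x =
  expi (h * xi 0 i) * (F (h *: ev R i + x) * wave xi (h *: ev R i + x)) - F x * wave xi x.
  rewrite /dif mulrBl; congr (_ - _); rewrite mulrCA; congr (_ * _).
  by rewrite /wave -expiD dot_line; congr expi; ring.
rewrite (eq_bigr _ (fun J _ => E _)) sumrB -mulr_sumr.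
rewrite (@sum_grid_shift nu h rho i (fun x => F x * wave xi x))//.
  by rewrite mulrBl mul1r.
by move=> x hx; rewrite F0// mul0r.
Qed.

Lemma dif_supp i (h rho : R) (F : V -> C) : 0 < h ->
  (forall x : V, rho < `|x 0 i| -> F x = 0) -> (forall x : V, rho + h < `|x 0 i| -> dif i h F x = 0).
Proof.
move=> h0 F0 x hx; rewrite /dif !F0 ?subr0//.
  by rewrite (le_lt_trans _ hx)// lerDl ltW.
rewrite !mxE !eqxx/= mulr1 -(ltrD2r h); apply: (lt_le_trans hx).
rewrite -{1}(addKr h (x 0 i)); apply: le_trans (ler_normD _ _) _.
by rewrite normrN (ger0_norm (ltW h0)) [leRHS]addrC.
Qed.

(** Each difference enlarges the support by [h]; the margin q h keeps the support inside the box
    throughout. *)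
Lemma csum_difn q nu (h rho : R) i (F : V -> C) (xi : V) : 0 < h ->
  (forall x : V, rho < `|x 0 i| -> F x = 0) -> rho + q%:R * h < h * nu%:R ->
  csum nu h (fun x => iter q (dif i h) F x * wave xi x) =
  (expi (h * xi 0 i) - 1) ^+ q * csum nu h (fun x => F x * wave xi x).
Proof.
move=> h0; elim: q rho F => [|q IH] rho F F0 hrho; first by rewrite expr0 mul1r.
rewrite -natr1 mulrDl mul1r addrCA addrA [_ + rho]addrC in hrho.
under [in LHS]eq_fun do rewrite iterSr.
rewrite (IH _ _ (dif_supp h0 F0)); last by rewrite addrAC.
rewrite (@csum_dif nu h rho)// ?mulrA -?exprSr//.
by apply: le_lt_trans hrho; rewrite -addrA lerDl addr_ge0// ?mulr_ge0 ?(ltW h0).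
Qed.

Lemma cabs_csum nu (h : R) (F : V -> C) (B : R) : 0 < h -> h <= 1 -> 0 <= B ->
  (forall x, cabs (F x) <= B * wt m.*2 x) -> cabs (csum nu h F) <= 5 ^+ m * B.
Proof.
move=> h0 h1 B0 hF; rewrite /csum cabsM cabsC ger0_norm ?exprn_ge0 ?(ltW h0)//.
apply: (@le_trans _ _ (h ^+ m * \sum_J B * wt m.*2 (@grid R m nu h J))).
  rewrite ler_wpM2l ?exprn_ge0 ?(ltW h0)//.
  by apply: le_trans (cabs_sum _ _) _; apply: ler_sum => J _.
by rewrite -mulr_sumr mulrCA [leRHS]mulrC ler_wpM2l// sum_wt.
Qed.

(* Discrete analogue of integrating by parts q times in the i-th variable. *)
Lemma csum_wave_decay q nu (h rho B : R) i (F : V -> C) (xi : V) : 0 < h -> h <= 1 ->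
  (forall x : V, rho < `|x 0 i| -> F x = 0) -> rho + q%:R * h < h * nu%:R ->
  h * `|xi 0 i| <= pi ->
  (forall x, cabs (iter q (dif i h) F x) <= h ^+ q * B * wt m.*2 x) ->
  `|xi 0 i| ^+ q * cabs (csum nu h (fun x => F x * wave xi x)) <= 8 ^+ q * 5 ^+ m * B.
Proof.
move=> h0 h1 F0 hrho hxi hB.
have hq : 0 < h ^+ q by rewrite exprn_gt0.
have B0 : 0 <= B.
  have := le_trans (cabs_ge0 _) (hB 0).
  by rewrite -mulrA pmulr_rge0// pmulr_lge0// wt_gt0.
(* Since h |xi_i| <= pi, each phase factor has modulus at least h |xi_i|/8. The resulting h^q
   cancels the one gained from the differences, so the estimate does not depend on the mesh. *)
have L : (h * `|xi 0 i| / 8) ^+ q * cabs (csum nu h (fun x => F x * wave xi x)) <= 5 ^+ m * (h ^+ q * B).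
  apply: (@le_trans _ _ (cabs (csum nu h (fun x => iter q (dif i h) F x * wave xi x)))).
    rewrite (csum_difn _ h0 F0 hrho) cabsM cabsX ler_wpM2r ?cabs_ge0//.
    have e : h * `|xi 0 i| = `|h * xi 0 i| by rewrite normrM (ger0_norm (ltW h0)).
    rewrite lerXn2r ?nnegrE ?cabs_ge0 ?divr_ge0 ?mulr_ge0 ?(ltW h0)//.
    by rewrite e; apply: cabs_expi_sub1; rewrite -e.
  apply: cabs_csum => //; first by rewrite mulr_ge0// ltW.
  by move=> x; rewrite cabsM cabs_wave mulr1.
rewrite -(ler_pM2l hq).
have e8 : (8 : R) ^+ q != 0 by rewrite expf_neq0.
have := ler_wpM2l (exprn_ge0 q (ler0n R 8)) L.
rewrite !exprMn exprVn; congr (_ <= _); first by field.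
by ring.
Qed.

End FiniteDifferences.

(** * Translations performed one coordinate at a time *)

Section Translations.
Variables (R : realType) (m : nat).
Local Notation V := 'rV[R]_m.
Local Notation C := R[i].

(** The path from 0 to [z] along the axes. Only partial derivatives are controlled, so a translation
    by [z] is split into [m] axis-parallel moves between consecutive truncations. *)
Definition trunc_row (k : nat) (z : V) : V := \row_i (if (i < k)%N then z 0 i else 0).

Lemma trunc_row0 z : trunc_row 0 z = 0.
Proof. by apply/rowP => i; rewrite !mxE. Qed.

Lemma trunc_row_full z : trunc_row m z = z.
Proof. by apply/rowP => i; rewrite !mxE ltn_ord. Qed.

Lemma trunc_rowS (i : 'I_m) z : trunc_row i.+1 z = z 0 i *: ev R i + trunc_row i z.
Proof.
apply/rowP => j; rewrite !mxE eqxx/= ltnS leq_eqVlt -val_eqE/=.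
case: eqP => [e|_] /=; last by rewrite mulr0 add0r.
have -> : j = i by exact: val_inj.
by rewrite ltnn mulr1 addr0.
Qed.

Lemma norm_trunc_row k z : `|trunc_row k z| <= `|z|.
Proof.
apply: norm_le_coord => // i; rewrite mxE; case: ifP => _; last by rewrite normr0.
exact: coord_le_norm.
Qed.

Lemma line_trunc_row (t : R) i (z : V) :
  t *: ev R i + trunc_row i z = trunc_row i.+1 (\row_j if j == i then t else z 0 j).
Proof.
rewrite trunc_rowS mxE eqxx; congr (_ + _); apply/rowP => j; rewrite !mxE.
case: ltnP => // ji; case: eqP => // e; by rewrite e ltnn in ji.
Qed.

Lemma trans_diff_bound N (f : V -> R) (M : R) (z x : V) : dbound 1 f (fun x => M * wt N x) ->
  `|f (x + z) - f x| <= (m%:R * `|z| * (1 + `|z|) ^+ N * M) * wt N x.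
Proof.
move=> hf.
have M0 := dbound_wt_ge0 hf.
suff H k : (k <= m)%N -> `|f (x + trunc_row k z) - f x| <=
    k%:R * (`|z| * ((1 + `|z|) ^+ N * M * wt N x)).
  by have := H m (leqnn m); rewrite trunc_row_full !mulrA.
elim: k => [|k IHk] km; first by rewrite trunc_row0 addr0 subrr normr0 mul0r.
rewrite (trunc_rowS (Ordinal km)) -natr1 mulrDl mul1r; set i := Ordinal km.
have -> : f (x + (z 0 i *: ev R i + trunc_row i z)) - f x =
    (f (x + trunc_row i z) - f x) +
    (f (z 0 i *: ev R i + (x + trunc_row i z)) - f (x + trunc_row i z)).
  by rewrite [in LHS]addrCA; ring.
apply: le_trans (ler_normD _ _) _; apply: lerD; first exact: IHk (ltnW km).
apply: (@le_trans _ _ (`|z 0 i| * ((1 + `|z|) ^+ N * M * wt N x))); last first.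
  by rewrite ler_wpM2r ?coord_le_norm// !mulr_ge0 ?wt_ge0// exprn_ge0// addr_ge0.
apply: (line_mvt (dbound_derivable hf i)) => th hth.
apply: le_trans (dbound_bound (dbound_pd hf i) _) _.
(* A point of an axis-parallel segment is again a truncation of a vector of norm at most |z|, so one
   factor (1 + |z|)^N covers the whole path. *)
rewrite addrCA line_trunc_row [X in _ <= X * _]mulrC -mulrA ler_wpM2l//.
apply: le_trans (wt_shift _ _ _) _; rewrite ler_wpM2r ?wt_ge0//.
rewrite lerXn2r ?nnegrE ?addr_ge0// lerD2l; apply: norm_le_coord => // j; rewrite !mxE.
case: ifP => _; last by rewrite normr0.
case: eqP => [_|_]; last exact: coord_le_norm.
exact: le_trans hth (coord_le_norm _ _).
Qed.

Lemma dbound_trans_diff n N (f : V -> R) (M : R) (z : V) : dbound n.+1 f (fun x => M * wt N x) ->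
  dbound n (fun x => f (x + z) - f x)
    (fun x => (m%:R * `|z| * (1 + `|z|) ^+ N * M) * wt N x).
Proof.
have ft g : (fun x : V => g (x + z)) = (fun x => g (1 *: x + z)) :> (V -> R).
  by apply/funext => x; rewrite scale1r.
elim: n f => [|n IH] f hf.
  split => //; first by move=> x; apply: trans_diff_bound.
  have := dbound_cont (dbound_sub (dbound_affine 1 z hf) hf).
  by under eq_fun do rewrite scale1r.
split.
- by move=> x; apply: trans_diff_bound; exact: dboundW hf.
- have := dbound_cont (dbound_sub (dbound_affine 1 z hf) hf).
  by under eq_fun do rewrite scale1r.
move=> i.
have P x := @pd_affine R m i f 1 z x (dbound_derivable hf i).
have E : pd i (fun x => f (x + z) - f x) = (fun x => pd i f (x + z) - pd i f x).
  apply/funext => x; case: (P x); rewrite -ft => P1 P2.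
  transitivity ('D_(ev R i) (fun x => f (x + z)) x - 'D_(ev R i) f x).
    exact: (deriveB P1 (dbound_derivable hf i x)).
  by rewrite -[X in X - _]/(pd i (fun x => f (x + z)) x) P2 mul1r scale1r.
split; last by rewrite E; apply: IH; exact: (dbound_pd hf).
move=> x; case: (P x); rewrite -ft => P1 P2.
exact: (derivableB P1 (dbound_derivable hf i x)).
Qed.

Lemma cdbound_trans_diff n N (f : V -> C) (M : R) (z : V) :
  cdbound n.+1 f (fun x => M * wt N x) ->
  cdbound n (fun x => f (x + z) - f x)
    (fun x => (m%:R * `|z| * (1 + `|z|) ^+ N * M) * wt N x).
Proof.
move=> [h1 h2]; split.
  by under eq_fun do rewrite cReB; exact: (dbound_trans_diff z h1).
by under eq_fun do rewrite cImB; exact: (dbound_trans_diff z h2).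
Qed.

Lemma cdbound_trans_wt n N (f : V -> C) (M : R) (z : V) :
  cdbound n f (fun x => M * wt N x) ->
  cdbound n (fun x => f (x + z)) (fun x => (2 ^+ n * (1 + `|z|) ^+ N * M) * wt N x).
Proof.
move=> hf.
have M0 := cdbound_wt_ge0 hf.
apply: cdbound_le (cdbound_trans z hf) => x.
rewrite -!mulrA ler_wpM2l ?exprn_ge0// [leRHS]mulrCA ler_wpM2l//.
exact: wt_shift.
Qed.

Lemma sum_grid_shiftN nu (h rho : R) i (Q : V -> C) (n : nat) : 0 < h ->
  (forall x : V, rho < `|x 0 i| -> Q x = 0) -> rho + n%:R * h < h * nu%:R ->
  \sum_J Q (n%:R * h *: ev R i + @grid R m nu h J) = \sum_J Q (@grid R m nu h J) /\
  \sum_J Q (- (n%:R * h) *: ev R i + @grid R m nu h J) = \sum_J Q (@grid R m nu h J).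
Proof.
move=> h0; elim: n rho Q => [|n IH] rho Q Q0 hrho.
  by split; apply: eq_bigr => J _; rewrite mul0r ?oppr0 scale0r add0r.
have n0 : 0 <= n%:R * h by rewrite mulr_ge0// ltW.
have r1 : rho + n%:R * h < h * nu%:R.
  by apply: le_lt_trans hrho; rewrite -natr1 mulrDl mul1r lerD2l lerDl ltW.
have r2 : rho + h + n%:R * h < h * nu%:R.
  by rewrite -addrA [h + _]addrC -{2}[h]mul1r -mulrDl natr1.
have r3 : rho + h < h * nu%:R by apply: le_lt_trans r2; rewrite lerDl.
have supp (t : R) : `|t| = h -> forall x : V, rho + h < `|x 0 i| -> Q (t *: ev R i + x) = 0.
  move=> t1 x hx; apply: Q0; rewrite !mxE !eqxx/= mulr1 -(ltrD2r h); apply: (lt_le_trans hx).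
  rewrite -{1}(addKr t (x 0 i)); apply: le_trans (ler_normD _ _) _.
  by rewrite normrN t1 [leRHS]addrC.
have hh := ger0_norm (ltW h0).
split.
  have [S _] := IH _ (fun x => Q (h *: ev R i + x)) (supp h hh) r2.
  have := sum_grid_shift h0 Q0 (le_lt_trans _ r1); rewrite lerDl => /(_ n0) <-.
  rewrite -S; apply: eq_bigr => J _; rewrite addrA -scalerDl; congr (Q (_ *: _ + _)).
  by rewrite -natr1; ring.
have hN : `|- h| = h by rewrite normrN.
have [_ S] := IH _ (fun x => Q (- h *: ev R i + x)) (supp (- h) hN) r2.
have := sum_grid_shift h0 (supp (- h) hN) r3.
under eq_bigr do rewrite addrA -scalerDl addNr scale0r add0r.
move=> ->; rewrite -S; apply: eq_bigr => J _; rewrite addrA -scalerDl; congr (Q (_ *: _ + _)).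
by rewrite -natr1; ring.
Qed.

(** Invariance under translation by a lattice vector. In the margin, one |y| accounts for the
    support displaced by the moves already made, the other for the current move. *)
Lemma sum_grid_trans nu (h r : R) (Q : V -> C) (a : 'I_m -> int) : 0 < h ->
  (forall x : V, r < `|x| -> Q x = 0) ->
  r + `|\row_i (h * (a i)%:~R)| + `|\row_i (h * (a i)%:~R)| < h * nu%:R ->
  \sum_J Q (\row_i (h * (a i)%:~R) + @grid R m nu h J) = \sum_J Q (@grid R m nu h J).
Proof.
set y := \row_i _ => h0 Q0 hr.
suff H k : (k <= m)%N ->
    \sum_J Q (trunc_row k y + @grid R m nu h J) = \sum_J Q (@grid R m nu h J).
  by rewrite -(H m (leqnn m)) trunc_row_full.
elim: k => [|k IH] km; first by apply: eq_bigr => J _; rewrite trunc_row0 add0r.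
rewrite (trunc_rowS (Ordinal km)) -(IH (ltnW km)).
pose Qk x := Q (trunc_row k y + x).
have Qk0 (x : V) : r + `|y| < `|x 0 (Ordinal km)| -> Qk x = 0.
  move=> hx; apply: Q0; rewrite -(ltrD2r `|y|); apply: (lt_le_trans hx).
  apply: le_trans (coord_le_norm _ _) _.
  rewrite -{1}(addKr (trunc_row k y) x); apply: le_trans (ler_normD _ _) _.
  by rewrite normrN [leRHS]addrC lerD2r norm_trunc_row.
have [n hn] : exists n : nat, (a (Ordinal km) = n \/ a (Ordinal km) = - n%:Z) /\ n%:R * h <= `|y|.
  exists `|a (Ordinal km)|%N; split.
    by case: (intP (a (Ordinal km))) => [|n|n]; [left|left|right]; rewrite ?abszN ?absz_nat.
  have := coord_le_norm y (Ordinal km); rewrite mxE normrM (ger0_norm (ltW h0)) mulrC.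
  by rewrite -intr_norm -abszE.
have hr' : r + `|y| + n%:R * h < h * nu%:R.
  by apply: le_lt_trans hr; rewrite lerD2l; case: hn.
have [S1 S2] := @sum_grid_shiftN nu h (r + `|y|) (Ordinal km) Qk n h0 Qk0 hr'.
transitivity (\sum_J Qk (y 0 (Ordinal km) *: ev R (Ordinal km) + @grid R m nu h J)).
  by apply: eq_bigr => J _; rewrite /Qk addrCA addrA.
case: hn => [[e|e] _].
  have -> : y 0 (Ordinal km) = n%:R * h by rewrite mxE e mulrC.
  exact: S1.
have -> : y 0 (Ordinal km) = - (n%:R * h) by rewrite mxE e mulrNz mulrN mulrC.
exact: S2.
Qed.

End Translations.

(** * Convergence of complex lattice sums *)

Section LatticeSums.
Variables (R : realType) (m : nat).
Local Notation V := 'rV[R]_m.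
Local Notation C := R[i].

(** The half-width of the box is [hs k * nus k], that is k + 1: the mesh tends to 0 while the box
    exhausts the space, also after division of the mesh by a fixed scale. *)
Definition hs (k : nat) : R := (k.+1%:R)^-1.
Definition nus (k : nat) : nat := (k.+1 * k.+1)%N.

Lemma hs_gt0 k : 0 < hs k. Proof. by rewrite invr_gt0. Qed.
Lemma hs_le1 k : hs k <= 1. Proof. by rewrite invf_le1// ler1n. Qed.

Lemma eventually_ge (T : R) : eventually (fun k => T <= k.+1%:R).
Proof.
exists (Num.truncn `|T|) => k hk.
apply: le_trans (ler_norm T) _; apply: ltW.
have /andP[_ h] := truncn_itv (normr_ge0 T).
by apply: lt_le_trans h _; rewrite ler_nat ltnS.
Qed.

Lemma hs_small (g e : R) : 1 <= g -> 0 < e -> eventually (fun k => hs k / g <= e).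
Proof.
move=> g1 e0; apply: eventuallyS (eventually_ge e^-1) => k hk.
apply: (@le_trans _ _ (hs k)).
  by rewrite ler_piMr ?(ltW (hs_gt0 k))// invf_le1// (lt_le_trans ltr01).
by rewrite /hs -[leRHS]invrK lef_pV2 ?posrE ?invr_gt0.
Qed.

Lemma hs_nus (g T : R) : 1 <= g -> eventually (fun k => T <= hs k / g * (nus k)%:R).
Proof.
move=> g1; have g0 : 0 < g by rewrite (lt_le_trans ltr01).
apply: eventuallyS (eventually_ge (T * g)) => k hk.
rewrite mulrAC /hs /nus natrM mulrA mulVf ?mul1r; last by rewrite pnatr_eq0.
by rewrite ler_pdivlMr.
Qed.

Lemma csum_cvg (F : V -> C) (M g e : R) : 1 <= g ->
  riem (fun x => cRe (F x)) M -> riem (fun x => cIm (F x)) M -> 0 < e ->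
  eventually (fun k => cabs (csum (nus k) (hs k / g) F - cint F) <= e).
Proof.
move=> g1 h1 h2 e0; have g0 : 0 < g by rewrite (lt_le_trans ltr01).
have s0 k : 0 < hs k / g by rewrite divr_gt0// hs_gt0.
have s1 k : hs k / g <= 1.
  apply: le_trans (hs_le1 k); rewrite ler_piMr ?(ltW (hs_gt0 k))// invf_le1//.
have sh e' : 0 < e' -> eventually (fun k => hs k / g <= e') by exact: hs_small.
have sn T : eventually (fun k => T <= hs k / g * (nus k)%:R) by exact: hs_nus.
have e2 : 0 < e / 2 by rewrite divr_gt0.
have /cvg_eventually/(_ _ e2) c1 := rsum_cvg s0 s1 sh sn h1.
have /cvg_eventually/(_ _ e2) c2 := rsum_cvg s0 s1 sh sn h2.
apply: eventuallyS (eventually_and c1 c2) => k [k1 k2].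
apply: le_trans (cabs_le_ReIm _) _; rewrite [leRHS](splitr e).
have -> : cRe (csum (nus k) (hs k / g) F - cint F) =
  rsum (nus k) (hs k / g) (fun x => cRe (F x)) - iint (fun x => cRe (F x)).
  by rewrite /csum /rsum -cRe_sum; case: (\sum_J _) => a b /=; rewrite mul0r subr0.
have -> : cIm (csum (nus k) (hs k / g) F - cint F) =
  rsum (nus k) (hs k / g) (fun x => cIm (F x)) - iint (fun x => cIm (F x)).
  by rewrite /csum /rsum -cIm_sum; case: (\sum_J _) => a b /=; rewrite mul0r addr0.
by rewrite lerD.
Qed.

Definition criem (F : V -> C) (B : R) :=
  (forall x, cabs (F x) <= B * wt m.*2 x) /\
  (forall i (t : R) x, `|t| <= 1 -> cabs (F (t *: ev R i + x) - F x) <= B * `|t| * wt m.*2 x).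

Lemma criem_riem F B : 0 <= B -> criem F B ->
  riem (fun x => cRe (F x)) B /\ riem (fun x => cIm (F x)) B.
Proof.
move=> B0 [h1 h2]; split; split.
- move=> x; apply: le_trans (Re_le_cabs _) _; apply: le_trans (h1 x) _.
  by rewrite ler_wpM2l// wt_le_Omega.
- move=> i t x t1; rewrite -cReB; apply: le_trans (Re_le_cabs _) _; apply: le_trans (h2 i t x t1) _.
  by rewrite ler_wpM2l// ?mulr_ge0// wt_le_Omega.
- move=> x; apply: le_trans (Im_le_cabs _) _; apply: le_trans (h1 x) _.
  by rewrite ler_wpM2l// wt_le_Omega.
- move=> i t x t1; rewrite -cImB; apply: le_trans (Im_le_cabs _) _; apply: le_trans (h2 i t x t1) _.
  by rewrite ler_wpM2l// ?mulr_ge0// wt_le_Omega.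
Qed.

Lemma norm_ev_le (t : R) i : `|t *: ev R i : V| <= `|t|.
Proof.
apply: norm_le_coord => // j; rewrite !mxE normrM ler_piMr//.
by case: (_ && _); rewrite /= ?normr1 ?normr0.
Qed.

Lemma cdbound_line_diff N (F : V -> C) M i (t : R) x : cdbound 1 F (fun x => M * wt N x) ->
  `|t| <= 1 -> cabs (F (t *: ev R i + x) - F x) <= (2 * m%:R * 2 ^+ N * M) * `|t| * wt N x.
Proof.
move=> hF t1; have M0 := cdbound_wt_ge0 hF.
rewrite [t *: _ + x]addrC.
apply: le_trans (cdbound_cabs (cdbound_trans_diff (t *: ev R i) hF) x) _.
have te := norm_ev_le t i.
have q : `|t *: ev R i : V| * (1 + `|t *: ev R i : V|) ^+ N <= `|t| * 2 ^+ N.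
  rewrite ler_pM ?exprn_ge0 ?addr_ge0// lerXn2r ?nnegrE ?addr_ge0//.
  by rewrite -[2]/(1 + 1) lerD2l (le_trans te).
have -> : 2 * m%:R * 2 ^+ N * M * `|t| * wt N x = 2 * (m%:R * (`|t| * 2 ^+ N) * M * wt N x) by ring.
rewrite ler_wpM2l// ler_wpM2r ?wt_ge0// ler_wpM2r// -mulrA ler_wpM2l//.
Qed.

Lemma cdbound_criem (F : V -> C) M : cdbound 1 F (fun x => M * wt m.*2 x) ->
  exists2 B, 0 <= B & criem F B.
Proof.
move=> hF; have M0 := cdbound_wt_ge0 hF.
have b0 : 0 <= 2 * m%:R * 2 ^+ m.*2 * M by rewrite !mulr_ge0// exprn_ge0.
exists (2 * M + 2 * m%:R * 2 ^+ m.*2 * M); first by rewrite addr_ge0// mulr_ge0.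
split.
  move=> x; apply: le_trans (cdbound_cabs hF x) _.
  by rewrite mulrA ler_wpM2r ?wt_ge0// lerDl.
move=> i t x t1; apply: le_trans (cdbound_line_diff i x hF t1) _.
by rewrite ler_wpM2r ?wt_ge0// ler_wpM2r// lerDr mulr_ge0.
Qed.

Lemma cschwartz_csum_cvg (F : V -> C) (e : R) : cschwartz F -> 0 < e ->
  eventually (fun k => cabs (csum (nus k) (hs k) F - cint F) <= e).
Proof.
move=> sF e0; have [M _ hM] := cschwartz_bound 1 m.*2 sF.
have [B B0 hB] := cdbound_criem hM; have [h1 h2] := criem_riem B0 hB.
by apply: eventuallyS (csum_cvg (lexx 1) h1 h2 e0) => k; rewrite divr1.
Qed.

(** The majorant depends on neither the mesh nor the box, which makes sequences of lattice sums
    bounded in every seminorm. *)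
Lemma cdbound_csum n N nu (h B : R) (F : V -> V -> C) : 0 < h -> h <= 1 -> 0 <= B ->
  (forall x, cdbound n (F x) (fun y => B * wt m.*2 x * wt N y)) ->
  cdbound n (fun y => csum nu h (fun x => F x y)) (fun y => (2 * 5 ^+ m * B) * wt N y).
Proof.
move=> h0 h1 B0 hF; rewrite /csum.
have hS := cdbound_scale ((h ^+ m)%:C) (@cdbound_sum R m n _ (index_enum _) (fun J => F (@grid R m nu h J)) _ (fun J => hF _)).
apply: cdbound_le hS => y.
rewrite cabsC ger0_norm ?exprn_ge0 ?(ltW h0)// -mulr_suml mulrA ler_wpM2r ?wt_ge0//.
rewrite -!mulrA ler_wpM2l// -mulr_sumr mulrCA [leRHS]mulrC ler_wpM2l//.
exact: sum_wt.
Qed.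

End LatticeSums.

(** * Lattice sums and translates under a tempered distribution *)

Section Exchange.
Variables (R : realType) (m : nat).
Local Notation V := 'rV[R]_m.
Local Notation C := R[i].
Variable w : (V -> C) -> C.
Hypothesis hw : tempered w.

Lemma tempered_csum nu h (F : V -> V -> C) : (forall x, cschwartz (F x)) ->
  w (fun y => csum nu h (fun x => F x y)) = csum nu h (fun x => w (F x)).
Proof.
move=> sF; rewrite /csum mulr_sumr -(tempered_sum hw)//.
by congr w; apply/funext => y; rewrite mulr_sumr.
Qed.

(** Polynomial growth and a local Lipschitz bound for a convolution. Multiplied by a test function,
    it becomes an integrand to which the convergence of Riemann sums applies. *)
Lemma tempered_trans (f : V -> C) : cschwartz f -> exists A : R, exists N : nat, 0 <= A /\
  (forall z, cabs (w (fun y => f (y + z))) <= A * (1 + `|z|) ^+ N) /\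
  (forall z d, `|d| <= 1 ->
    cabs (w (fun y => f (y + (z + d))) - w (fun y => f (y + z))) <= A * `|d| * (1 + `|z|) ^+ N).
Proof.
have [K [N [K0 hK]]] := tempered_bound hw.
move=> sf; have [M M0 hM] := cschwartz_bound N.+1 N sf.
have st z := cschwartz_trans z sf.
exists (K * (2 ^+ N * M) + K * (2 ^+ N * (m%:R * 2 ^+ N * M))); exists N.
have p1 : 0 <= K * (2 ^+ N * M) by rewrite !mulr_ge0// exprn_ge0.
have p2 : 0 <= K * (2 ^+ N * (m%:R * 2 ^+ N * M)) by rewrite !mulr_ge0// exprn_ge0.
split; first exact: addr_ge0.
split=> [z|z d d1].
  apply: le_trans (hK _ _ (st z) (cdbound_trans_wt z (cdboundW (leqnSn N) hM))) _.
  have -> : K * (2 ^+ N * (1 + `|z|) ^+ N * M) = K * (2 ^+ N * M) * (1 + `|z|) ^+ N by ring.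
  by rewrite ler_wpM2r ?exprn_ge0 ?addr_ge0// lerDl.
rewrite -(tempered_sub hw)//.
have E : (fun x => f (x + (z + d)) - f (x + z)) = (fun x => (fun x => f (x + d) - f x) (x + z)).
  by apply/funext => x; rewrite addrA.
have sd : cschwartz (fun x => f (x + (z + d)) - f (x + z)).
  exact: cschwartz_sub.
rewrite E in sd *.
apply: le_trans (hK _ _ sd (cdbound_trans_wt z (cdbound_trans_diff d hM))) _.
apply: (@le_trans _ _ (K * (2 ^+ N * (m%:R * 2 ^+ N * M)) * `|d| * (1 + `|z|) ^+ N)); last first.
  by rewrite ler_wpM2r ?exprn_ge0 ?addr_ge0// ler_wpM2r// lerDr.
have -> : K * (2 ^+ N * (m%:R * 2 ^+ N * M)) * `|d| * (1 + `|z|) ^+ N =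
  K * (2 ^+ N * (1 + `|z|) ^+ N * (m%:R * `|d| * 2 ^+ N * M)) by ring.
rewrite ler_wpM2l// ler_wpM2l ?mulr_ge0 ?exprn_ge0 ?addr_ge0//.
rewrite ler_wpM2r// ler_wpM2l ?mulr_ge0// lerXn2r ?nnegrE ?addr_ge0//.
by rewrite -[2]/(1 + 1) lerD2l.
Qed.

End Exchange.

(** * Regularization of tempered distributions *)

Section Regularization.
Variables (R : realType) (m : nat).
Local Notation V := 'rV[R]_m.
Local Notation C := R[i].
Variables (w : (V -> C) -> C) (chi : V -> C).
Hypotheses (hw : tempered w) (hchi : cschwartz chi) (chi1 : cint chi = 1).

Definition mollify (g : R) (x : V) : C := w (fun y => (g ^+ m)%:C * chi (g *: (x - y))).

Section FixedScale.
Variable g : R.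
Hypothesis g1 : 1 <= g.
Let g0 : 0 < g := lt_le_trans ltr01 g1.

(** The reflected dilate turns chi(g (x - y)), as a function of [y], into a translate of one fixed
    function. *)
Definition chir (y : V) : C := chi (- g *: y).

Lemma chir_schwartz : cschwartz chir.
Proof.
have g' : - g != 0 by rewrite oppr_eq0 gt_eqF.
have := cschwartz_affine (0 : V) g' hchi.
by under eq_fun do rewrite addr0.
Qed.

Lemma chi_reflect x y : chi (g *: (x - y)) = chir (y + - x).
Proof. by rewrite /chir scaleNr -scalerN opprD opprK addrC. Qed.

Lemma mollifyE x : mollify g x = (g ^+ m)%:C * w (fun y => chir (y + - x)).
Proof.
rewrite /mollify -(tempered_scale hw); last exact: cschwartz_trans chir_schwartz.
by congr w; apply/funext => y; rewrite chi_reflect.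
Qed.

Variable G : V -> C.
Hypothesis tG : ctest G.
Let sG : cschwartz G := ctest_schwartz tG.

Lemma mollify_criem : exists2 B, 0 <= B & criem (fun x => G x * mollify g x) B.
Proof.
have [A [N [A0 [h1 h2]]]] := tempered_trans hw chir_schwartz.
(* The [N] extra orders absorb the polynomial growth of the regularization; [m.*2] orders remain for
   summability. *)
have [M M0 hM] := cschwartz_bound 1 (m.*2 + N)%N sG.
pose M1 := 2 * M; pose M2 := 2 * m%:R * 2 ^+ (m.*2 + N) * M.
have M20 : 0 <= M2 by rewrite !mulr_ge0// exprn_ge0.
have gm : 0 <= g ^+ m by rewrite exprn_ge0// ltW.
have w1 x : cabs (mollify g x) <= g ^+ m * A * (1 + `|x|) ^+ N.
  rewrite mollifyE cabsM cabsC ger0_norm// -mulrA ler_wpM2l//.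
  by apply: le_trans (h1 _) _; rewrite normrN.
have w2 i (t : R) x : `|t| <= 1 ->
    cabs (mollify g (t *: ev R i + x) - mollify g x) <= g ^+ m * A * `|t| * (1 + `|x|) ^+ N.
  move=> t1; rewrite !mollifyE -mulrBr cabsM cabsC ger0_norm// -!mulrA ler_wpM2l// mulrA.
  have te := norm_ev_le (t : R) i.
  have te1 : `|- (t *: ev R i) : V| <= 1 by rewrite normrN (le_trans te).
  have := h2 (- x) (- (t *: ev R i)) te1.
  rewrite -opprD [x + _]addrC normrN => h; apply: le_trans h _; rewrite normrN.
  by rewrite ler_wpM2r ?exprn_ge0 ?addr_ge0// ler_wpM2l.
pose B1 := M1 * (g ^+ m * A); pose B2 := M2 * (g ^+ m * A * 2 ^+ N).
have gA : 0 <= g ^+ m * A by rewrite mulr_ge0.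
have B10 : 0 <= B1 by rewrite !mulr_ge0.
have B20 : 0 <= B2 by rewrite !mulr_ge0// exprn_ge0.
have wc x : wt (m.*2 + N) x * (1 + `|x|) ^+ N = wt m.*2 x.
  exact: wt_absorb.
exists (B1 + B2); first exact: addr_ge0.
split.
  move=> x; rewrite cabsM.
  apply: le_trans (ler_pM (cabs_ge0 _) (cabs_ge0 _) (cdbound_cabs hM x) (w1 x)) _.
  have -> : 2 * (M * wt (m.*2 + N) x) * (g ^+ m * A * (1 + `|x|) ^+ N) =
    B1 * (wt (m.*2 + N) x * (1 + `|x|) ^+ N) by rewrite /B1 /M1; ring.
  by rewrite wc ler_wpM2r ?wt_ge0// lerDl.
move=> i t x t1.
have -> : G (t *: ev R i + x) * mollify g (t *: ev R i + x) - G x * mollify g x =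
  (G (t *: ev R i + x) - G x) * mollify g (t *: ev R i + x) +
  G x * (mollify g (t *: ev R i + x) - mollify g x) by ring.
apply: le_trans (cabsD _ _) _; rewrite !cabsM.
have -> : (B1 + B2) * `|t| * wt m.*2 x = B2 * `|t| * wt m.*2 x + B1 * `|t| * wt m.*2 x by ring.
apply: lerD.
  apply: le_trans (ler_pM (cabs_ge0 _) (cabs_ge0 _) (cdbound_line_diff i x hM t1) (w1 _)) _.
  apply: (@le_trans _ _ (M2 * `|t| * wt (m.*2 + N) x * (g ^+ m * A * (2 ^+ N * (1 + `|x|) ^+ N)))).
    rewrite ler_wpM2l//; first by rewrite !mulr_ge0// wt_ge0.
    rewrite ler_wpM2l//; apply: le_trans (onenXD _ _ _) _.
    rewrite ler_wpM2r ?exprn_ge0 ?addr_ge0// lerXn2r ?nnegrE ?addr_ge0//.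
    by rewrite -[2]/(1 + 1) lerD2l (le_trans (norm_ev_le t i)).
  have -> : M2 * `|t| * wt (m.*2 + N) x * (g ^+ m * A * (2 ^+ N * (1 + `|x|) ^+ N)) =
    B2 * `|t| * (wt (m.*2 + N) x * (1 + `|x|) ^+ N) by rewrite /B2; ring.
  by rewrite wc.
apply: le_trans (ler_pM (cabs_ge0 _) (cabs_ge0 _) (cdbound_cabs hM x) (w2 i t x t1)) _.
have -> : 2 * (M * wt (m.*2 + N) x) * (g ^+ m * A * `|t| * (1 + `|x|) ^+ N) =
  B1 * `|t| * (wt (m.*2 + N) x * (1 + `|x|) ^+ N) by rewrite /B1 /M1; ring.
by rewrite wc.
Qed.

Lemma csum_mollify_cvg (e : R) : 0 < e -> eventually (fun k =>
  cabs (csum (nus k) (hs R k / g) (fun x => G x * mollify g x) - cint (fun x => G x * mollify g x)) <= e).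
Proof.
have [B B0 hB] := mollify_criem; have [h1 h2] := criem_riem B0 hB.
exact: (@csum_cvg R m (fun x => G x * mollify g x) B g e g1 h1 h2).
Qed.

(** [FA] and [FB] are the integrands of one integral before and after the substitution x = y + z/g.
    Pairing the first with [w] in [y] gives [G x * mollify g x]; pairing the second moves the
    translation onto the test function. *)
Let FA (x y : V) : C := G x * (g ^+ m)%:C * chir (y + - x).
Let FB (z y : V) : C := chi z * G (y + g^-1 *: z).

Lemma FA_bound n N : exists2 B, 0 <= B &
  forall x, cdbound n (FA x) (fun y => B * wt m.*2 x * wt N y).
Proof.
have [M1 M10 h1] := cschwartz_bound n N chir_schwartz.
have [M2 M20 h2] := cschwartz_bound 0 (m.*2 + N)%N sG.
have gm : 0 <= g ^+ m by rewrite exprn_ge0// ltW.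
exists (2 * (2 * M2 * g ^+ m) * (2 ^+ n * M1)); first by rewrite !mulr_ge0// exprn_ge0.
move=> x; apply: cdbound_le (cdbound_scale (G x * (g ^+ m)%:C) (cdbound_trans_wt (- x) h1)) => y.
rewrite [leLHS]mulrA ler_wpM2r ?wt_ge0// cabsM cabsC (ger0_norm gm) normrN.
have wc : wt (m.*2 + N) x * (1 + `|x|) ^+ N = wt m.*2 x.
  exact: wt_absorb.
rewrite -wc.
have -> : 2 * (2 * M2 * g ^+ m) * (2 ^+ n * M1) * (wt (m.*2 + N) x * (1 + `|x|) ^+ N) =
  2 * (2 * (M2 * wt (m.*2 + N) x) * g ^+ m) * (2 ^+ n * (1 + `|x|) ^+ N * M1) by ring.
rewrite ler_wpM2r ?mulr_ge0 ?exprn_ge0 ?addr_ge0// ler_wpM2l// ler_wpM2r//.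
exact: (cdbound_cabs h2).
Qed.

Lemma FB_bound n N : exists2 B, 0 <= B &
  forall z, cdbound n (FB z) (fun y => B * wt m.*2 z * wt N y).
Proof.
have [M1 M10 h1] := cschwartz_bound n N sG.
have [M2 M20 h2] := cschwartz_bound 0 (m.*2 + N)%N hchi.
exists (2 * (2 * M2) * (2 ^+ n * M1)); first by rewrite !mulr_ge0// exprn_ge0.
move=> z; apply: cdbound_le (cdbound_scale (chi z) (cdbound_trans_wt (g^-1 *: z) h1)) => y.
rewrite [leLHS]mulrA ler_wpM2r ?wt_ge0//.
have wc : wt (m.*2 + N) z * (1 + `|z|) ^+ N = wt m.*2 z.
  exact: wt_absorb.
rewrite -wc.
have -> : 2 * (2 * M2) * (2 ^+ n * M1) * (wt (m.*2 + N) z * (1 + `|z|) ^+ N) =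
  2 * (2 * (M2 * wt (m.*2 + N) z)) * (2 ^+ n * (1 + `|z|) ^+ N * M1) by ring.
rewrite ler_pM ?mulr_ge0 ?cabs_ge0 ?exprn_ge0 ?addr_ge0//.
  by rewrite ler_wpM2l// (cdbound_cabs h2).
rewrite ler_wpM2r// ler_wpM2l ?exprn_ge0// lerXn2r ?nnegrE ?addr_ge0// lerD2l.
rewrite normrZ ler_piMl// ger0_norm ?invr_ge0 ?(ltW g0)// invf_le1//.
Qed.

Let D k (y : V) : C := csum (nus k) (hs R k / g) (fun x => FA x y) - csum (nus k) (hs R k) (fun z => FB z y).

Lemma hsg_gt0 k : 0 < hs R k / g. Proof. by rewrite divr_gt0// hs_gt0. Qed.
Lemma hsg_le1 k : hs R k / g <= 1.
Proof. by apply: le_trans (hs_le1 R k); rewrite ler_piMr ?(ltW (hs_gt0 R k))// invf_le1. Qed.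

Lemma D_bound n N : exists M, forall k, cdbound n (D k) (fun y => M * wt N y).
Proof.
have [B1 B10 h1] := FA_bound n N; have [B2 B20 h2] := FB_bound n N.
exists (2 * 5 ^+ m * B1 + 2 * 5 ^+ m * B2) => k.
have b1 := cdbound_csum (nus k) (hsg_gt0 k) (hsg_le1 k) B10 h1.
have b2 := cdbound_csum (nus k) (hs_gt0 R k) (hs_le1 R k) B20 h2.
by apply: cdbound_le (cdbound_sub b1 b2) => y; rewrite [leRHS]mulrDl lexx.
Qed.

(* The two lattice sums agree exactly at lattice points, by translation invariance. *)
Lemma D_lattice (r : R) k (a : 'I_m -> int) (y := \row_i (hs R k / g * (a i)%:~R) : V) :
  (forall x, r < `|x| -> G x = 0) -> r + `|y| + `|y| < hs R k / g * (nus k)%:R -> D k y = 0.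
Proof.
move=> Gr hr; rewrite /D /csum; apply/eqP; rewrite subr_eq0; apply/eqP.
pose Q (x : V) := G x * chi (g *: (x - y)).
have Q0 (x : V) : r < `|x| -> Q x = 0 by move=> hx; rewrite /Q Gr// mul0r.
have S := sum_grid_trans (hsg_gt0 k) Q0 hr.
transitivity ((hs R k ^+ m)%:C * \sum_J Q (@grid R m (nus k) (hs R k / g) J)).
  rewrite mulr_sumr mulr_sumr; apply: eq_bigr => J _.
  rewrite /FA -chi_reflect /Q [G _ * _]mulrC -!mulrA [LHS]mulrA -rmorphM/=.
  by rewrite -exprMn divfK ?gt_eqF.
rewrite -S; congr (_ * _); apply: eq_bigr => J _; rewrite /Q /FB mulrC.
have -> : @grid R m (nus k) (hs R k / g) J = g^-1 *: @grid R m (nus k) (hs R k) J.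
  by apply/rowP => i; rewrite !mxE /gpt; ring.
by rewrite -/y addrAC subrr add0r scalerA divff ?gt_eqF// scale1r.
Qed.

(** The difference vanishes at lattice points and has a Lipschitz constant independent of [k], so at
    any point of a fixed ball it is at most a constant times the mesh. *)
Lemma D_locunif (Y e : R) : 0 < e ->
  eventually (fun k => forall y, `|y| <= Y -> cabs (D k y) <= e).
Proof.
move=> e0; have /ctestP[_ [r hr]] := tG.
have [M hM] := D_bound 1 0.
have M1 k : cdbound 1 (D k) (fun y => `|M| * wt 0 y).
  by apply: cdbound_le (hM k) => y; rewrite ler_wpM2r ?wt_ge0// ler_norm.
pose K := 2 * (m%:R * `|M|) + 1.
have K0 : 0 < K by rewrite ltr_wpDl// !mulr_ge0.
have eK : 0 < e / K by rewrite divr_gt0.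
apply: eventuallyS (eventually_and (hs_small g1 eK) (hs_nus (r + (`|Y| + 1) + (`|Y| + 1) + 1) g1)) => k [k1 k2] y yY.
have s0 := hsg_gt0 k; have s1 := hsg_le1 k; set s := hs R k / g in s0 s1 k1 k2 *.
(* Rounding each coordinate down gives a lattice point within one mesh width, hence of norm at most
   |Y| + 1; the box was taken large enough for translations of that size. *)
pose a i := Num.floor (y 0 i / s).
pose y0 : V := \row_i (s * (a i)%:~R).
have yy0 : `|y - y0| <= s.
  apply: norm_le_coord; first exact: ltW.
  move=> i; rewrite !mxE /a.
  have /andP[f1 f2] := floor_itv (y 0 i / s).
  have e1 : y 0 i = s * (y 0 i / s) by rewrite mulrC divfK// gt_eqF.
  rewrite {1}e1 -mulrBr normrM (ger0_norm (ltW s0)) ler_piMr ?(ltW s0)//.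
  rewrite ger0_norm ?subr_ge0// lerBlDl ltW//.
  by rewrite -[X in _ + X]/(1%:~R) -intrD.
have hy0 : `|y0| <= `|Y| + 1.
  have -> : y0 = y - (y - y0) by rewrite subKr.
  apply: le_trans (ler_normB _ _) _; rewrite lerD//; first by rewrite (le_trans yY)// ler_norm.
  exact: le_trans s1.
have D0 : D k y0 = 0.
  apply: (D_lattice hr); apply: lt_le_trans k2.
  by rewrite -/s -/y0 (le_lt_trans (lerD (lerD (lexx r) hy0) hy0))// ltrDl.
have -> : D k y = D k (y0 + (y - y0)) - D k y0 by rewrite D0 subr0 addrC subrK.
apply: le_trans (cdbound_cabs (cdbound_trans_diff (y - y0) (M1 k)) y0) _.
rewrite expr0 /wt expr0 invr1 !mulr1.
apply: (@le_trans _ _ (K * s)).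
  have -> : 2 * (m%:R * `|y - y0| * `|M|) = 2 * (m%:R * `|M|) * `|y - y0| by ring.
  by rewrite ler_pM// ?mulr_ge0// /K lerDl.
have -> : e = K * (e / K) by rewrite mulrC divfK// gt_eqF.
by rewrite ler_wpM2l// ltW.
Qed.

Lemma FA_schwartz x : cschwartz (FA x).
Proof. exact: cschwartz_scale (cschwartz_trans _ chir_schwartz). Qed.
Lemma FB_schwartz x : cschwartz (FB x).
Proof. exact: cschwartz_scale (cschwartz_trans _ sG). Qed.

(** Under [w] the first lattice sum becomes a Riemann sum of the integral and the second becomes the
    sum stated here; they differ by [w (D k)], which tends to 0. *)
Lemma mollify_translate_cvg (e : R) : 0 < e -> eventually (fun k =>
  cabs (csum (nus k) (hs R k) (fun z => chi z * w (fun y => G (y + g^-1 *: z)))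
        - cint (fun x => G x * mollify g x)) <= e).
Proof.
move=> e0; have e2 : 0 < e / 2 by rewrite divr_gt0.
have c1 := csum_mollify_cvg e2.
have c2 := tempered_cvg0 hw D_bound D_locunif e2.
apply: eventuallyS (eventually_and c1 c2) => k [k1 k2].
have sA : cschwartz (fun y => csum (nus k) (hs R k / g) (fun x => FA x y)).
  by apply: cschwartz_scale; apply: cschwartz_sum => J; exact: FA_schwartz.
have sB : cschwartz (fun y => csum (nus k) (hs R k) (fun z => FB z y)).
  by apply: cschwartz_scale; apply: cschwartz_sum => J; exact: FB_schwartz.
have EA : w (fun y => csum (nus k) (hs R k / g) (fun x => FA x y)) =
    csum (nus k) (hs R k / g) (fun x => G x * mollify g x).
  rewrite (tempered_csum hw)//; last exact: FA_schwartz.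
  congr csum; apply/funext => x; rewrite /FA (tempered_scale hw) ?mollifyE ?mulrA//.
  exact: cschwartz_trans chir_schwartz.
have EB : w (fun y => csum (nus k) (hs R k) (fun z => FB z y)) =
    csum (nus k) (hs R k) (fun z => chi z * w (fun y => G (y + g^-1 *: z))).
  rewrite (tempered_csum hw)//; last exact: FB_schwartz.
  congr csum; apply/funext => z; rewrite /FB (tempered_scale hw)//.
  exact: cschwartz_trans sG.
rewrite -EB; rewrite -EA in k1.
rewrite /D (tempered_sub hw sA sB) in k2.
set A := w _ in k1 k2 *; set B := w _ in k2 *; set T := cint _ in k1 *.
have -> : B - T = (A - T) - (A - B) by ring.
by apply: le_trans (cabsB _ _) _; rewrite [leRHS](splitr e) lerD.
Qed.

(** As chi has integral 1, its lattice sums times [c] tend to [c]. What remains is a lattice sum of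
    the pointwise differences, bounded termwise. *)
Lemma mollify_pairing_close (c : C) (B : R) : 0 <= B ->
  (forall z, cabs (chi z) * cabs (w (fun y => G (y + g^-1 *: z)) - c) <= B * wt m.*2 z) ->
  cabs (cint (fun x => G x * mollify g x) - c) <= 5 ^+ m * B.
Proof.
move=> B0 hB; apply/ler_addgt0Pr => e e0.
pose e' := e / (1 + (1 + cabs c)).
have c0 : 0 < 1 + (1 + cabs c) by rewrite ltr_pwDl// addr_ge0// cabs_ge0.
have e'0 : 0 < e' by rewrite divr_gt0.
have [k0 h] := eventually_and (mollify_translate_cvg e'0) (cschwartz_csum_cvg hchi e'0).
have [h1 h2] := h k0 (leqnn _); rewrite chi1 in h2.
set S1 := csum _ _ _ in h1; set S2 := csum _ _ _ in h2; set T := cint _ in h1 *.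
have S3 : cabs (S1 - S2 * c) <= 5 ^+ m * B.
  have -> : S1 - S2 * c = csum (nus k0) (hs R k0)
      (fun z => chi z * (w (fun y => G (y + g^-1 *: z)) - c)).
    rewrite /S1 /S2 /csum -mulrA mulr_suml -mulrBr -sumrB; congr (_ * _).
    by apply: eq_bigr => J _; rewrite mulrBr.
  apply: cabs_csum => //; [exact: hs_gt0|exact: hs_le1|].
  by move=> z; rewrite cabsM.
have -> : T - c = (S1 - S2 * c) + (- (S1 - T) + (S2 - 1) * c) by ring.
apply: le_trans (cabsD _ _) _; rewrite lerD//.
apply: le_trans (cabsD _ _) _; rewrite cabsN cabsM.
apply: (@le_trans _ _ (e' * (1 + cabs c))).
  by rewrite mulrDr mulr1 lerD// ler_wpM2r// cabs_ge0.
rewrite /e' mulrAC ler_pdivrMr// ler_wpM2l ?(ltW e0)//.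
by rewrite lerDr.
Qed.

End FixedScale.
End Regularization.

(** * The regularized Fourier transform at large scales, and differences of convolutions *)

Section RegularizedTransform.
Variables (R : realType) (m : nat).
Local Notation V := 'rV[R]_m.
Local Notation C := R[i].

Lemma test_wave_bound (psi : V -> C) n N : ctest psi -> exists2 A, 0 <= A &
  forall xi, cdbound n (fun x => psi x * wave xi x) (fun x => (A * (1 + `|xi|) ^+ n) * wt N x).
Proof.
move=> /ctest_schwartz/(cschwartz_bound n N)[M M0 hM].
exists (2 ^+ n.+1 * M); first by rewrite mulr_ge0// exprn_ge0.
move=> xi; apply: cdbound_le (cdbound_mul hM (cdbound_wave n xi)) => x.
by apply: le_of_eq; ring.
Qed.

Lemma cFT_mollify (w : (V -> C) -> C) chi (g : R) (psi : V -> C) xi :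
  cFT (fun x => psi x * mollify w chi g x) xi =
  cint (fun x => psi x * wave xi x * mollify w chi g x).
Proof. by rewrite /cFT; congr cint; apply/funext => x; rewrite mulrAC. Qed.

Section Estimates.
Variables (w : (V -> C) -> C) (chi psi : V -> C).
Hypotheses (hw : tempered w) (hchi : cschwartz chi) (chi1 : cint chi = 1) (tpsi : ctest psi).

Lemma distFT_bound : exists K, exists p : nat, 0 <= K /\
  forall xi, cabs (distFT w psi xi) <= K * (1 + `|xi|) ^+ p.
Proof.
have [K [N [K0 hK]]] := tempered_bound hw.
have [A A0 hA] := test_wave_bound N N tpsi.
exists (K * A); exists N; split; first exact: mulr_ge0.
move=> xi; rewrite -mulrA; apply: hK (hA xi).
exact: ctest_schwartz (ctest_wave xi tpsi).
Qed.

(** A translation by z/g changes the pairing with [w] by a multiple of |z|/g, at the price of one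
    derivative beyond the order [N] of [w]. Derivatives of the wave account for (1 + |xi|)^(N+1);
    the decay of chi absorbs the powers of |z|. *)
Lemma mollify_FT_close : exists K, exists p : nat, 0 <= K /\
  forall g xi, 1 <= g ->
  cabs (cFT (fun x => psi x * mollify w chi g x) xi - distFT w psi xi) <= K * (1 + `|xi|) ^+ p / g.
Proof.
have [K [N [K0 hK]]] := tempered_bound hw.
have [A A0 hA] := test_wave_bound N.+1 N tpsi.
have [M M0 hM] := cschwartz_bound 0 (m.*2 + N.+1)%N hchi.
exists (5 ^+ m * (2 * M * (K * (m%:R * A)))); exists N.+1; split.
  by rewrite !mulr_ge0// exprn_ge0.
move=> g xi g1; have g0 : 0 < g by rewrite (lt_le_trans ltr01).
have tG := ctest_wave xi tpsi; have sG := ctest_schwartz tG.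
pose B := 2 * M * (K * (m%:R * A)) * (1 + `|xi|) ^+ N.+1 / g.
have B0 : 0 <= B by rewrite !mulr_ge0 ?exprn_ge0 ?addr_ge0// invr_ge0 ltW.
have -> : 5 ^+ m * (2 * M * (K * (m%:R * A))) * (1 + `|xi|) ^+ N.+1 / g = 5 ^+ m * B.
  by rewrite /B !mulrA.
rewrite cFT_mollify; apply: (mollify_pairing_close hw hchi chi1 g1 tG B0) => z.
have sd : cschwartz (fun y => psi (y + g^-1 *: z) * wave xi (y + g^-1 *: z) - psi y * wave xi y).
  exact: cschwartz_sub (cschwartz_trans (g^-1 *: z) sG) sG.
have st := cschwartz_trans (g^-1 *: z) sG.
rewrite -[distFT w psi xi]/(w (fun x => psi x * wave xi x)) -(tempered_sub hw st sG).
have h1 := hK _ _ sd (cdbound_trans_diff (g^-1 *: z) (hA xi)).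
apply: le_trans (ler_pM (cabs_ge0 _) (cabs_ge0 _) (cdbound_cabs hM z) h1) _.
have zg : `|g^-1 *: z| = `|z| / g by rewrite normrZ ger0_norm ?invr_ge0 ?(ltW g0)// mulrC.
have zg1 : `|g^-1 *: z| <= `|z| by rewrite zg ler_piMr// invf_le1.
have wc : wt (m.*2 + N.+1) z * (1 + `|z|) ^+ N.+1 = wt m.*2 z.
  exact: wt_absorb.
have q : `|g^-1 *: z| * (1 + `|g^-1 *: z|) ^+ N <= (1 + `|z|) ^+ N.+1 / g.
  rewrite {1}zg mulrAC ler_wpM2r ?invr_ge0 ?(ltW g0)// exprS.
  rewrite ler_pM ?exprn_ge0 ?addr_ge0// ?lerDr//.
  by rewrite lerXn2r ?nnegrE ?addr_ge0// lerD2l.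
rewrite -wc /B.
have -> : 2 * M * (K * (m%:R * A)) * (1 + `|xi|) ^+ N.+1 / g * (wt (m.*2 + N.+1) z * (1 + `|z|) ^+ N.+1)
  = (2 * (M * wt (m.*2 + N.+1) z)) * (K * (m%:R * ((1 + `|z|) ^+ N.+1 / g) * (A * (1 + `|xi|) ^+ N.+1))).
  by ring.
rewrite ler_wpM2l//; first by rewrite !mulr_ge0// wt_ge0.
rewrite ler_wpM2l// ler_wpM2r//; first by rewrite mulr_ge0// exprn_ge0// addr_ge0.
by rewrite -mulrA ler_wpM2l.
Qed.

End Estimates.

Lemma difn_sub (W : zmodType) q i (h : R) (F G : V -> W) :
  iter q (dif i h) (fun x => F x - G x) = (fun x => iter q (dif i h) F x - iter q (dif i h) G x).
Proof.
elim: q => [//|q IH]; rewrite /= IH; apply/funext => x; rewrite /dif.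
by rewrite !opprD !opprK addrACA.
Qed.

Lemma difn_param_pd q i j (h : R) (Phi : V -> V -> R) :
  (forall x y, derivable (Phi x) y (ev R j)) -> forall x,
  (forall y, derivable (fun y => iter q (dif i h) (Phi ^~ y) x) y (ev R j)) /\
  pd j (fun y => iter q (dif i h) (Phi ^~ y) x) =
    (fun y => iter q (dif i h) ((fun x => pd j (Phi x)) ^~ y) x).
Proof.
move=> d; elim: q => [|q IH] x /=; first by split => //; exact: d.
have [d1 e1] := IH (h *: ev R i + x); have [d2 e2] := IH x.
split; first by move=> y; apply: derivableB; [exact: d1|exact: d2].
apply/funext => y; rewrite /dif -[X in X - _](congr1 (fun F => F y) e1).
by rewrite -[X in _ - X](congr1 (fun F => F y) e2); exact: (deriveB (d1 y) (d2 y)).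
Qed.

Lemma difn_param_cont q i (h : R) (Phi : V -> V -> R) :
  (forall x, continuous (Phi x)) -> forall x,
  continuous (fun y => iter q (dif i h) (Phi ^~ y) x).
Proof.
move=> c; elim: q => [|q IH] x /=; first exact: c.
rewrite /dif; apply: continuous_add; first exact: IH.
have := continuous_scale (-1) (IH x).
by under eq_fun do rewrite mulN1r.
Qed.

(** The weight of psi is split in two: the part of order [m.*2] stays for summation over [x], and
    the part of order [N] combines with the weight at y - x into a weight at [y], by
    submultiplicativity of 1 + |x|. *)
Lemma dif_conv_bound q i N (psi f : V -> R) (Mp M h : R) x y : 0 < h -> h <= 1 ->
  dbound q psi (fun x => Mp * wt (m.*2 + N) x) -> dbound q f (fun y => M * wt N y) ->
  `|iter q (dif i h) (fun x => psi x * f (y - x)) x| <=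
    (2 ^+ q * (Mp * 2 ^+ q) * (1 + q%:R) ^+ m.*2) * M * h ^+ q * wt m.*2 x * wt N y.
Proof.
move=> h0 h1 hpsi hf.
have Mp0 := dbound_wt_ge0 hpsi.
have M0 := dbound_wt_ge0 hf.
have hp := dbound_mul hpsi (dbound_affine (-1) y hf).
have -> : (fun x => psi x * f (y - x)) = (fun x => psi x * f (-1 *: x + y)).
  by apply/funext => x'; rewrite scaleN1r addrC.
set c := (1 + q%:R) ^+ m.*2.
have -> : 2 ^+ q * (Mp * 2 ^+ q) * c * M * h ^+ q * wt m.*2 x * wt N y =
   h ^+ q * (2 ^+ q * (Mp * 2 ^+ q * M * (c * wt m.*2 x * wt N y))) by ring.
apply: (difn_bound (ltW h0) hp) => t ht.
rewrite normrN normr1 ler_wpM2l ?exprn_ge0//; set x1 := t *: ev R i + x.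
have -> : Mp * wt (m.*2 + N) x1 * ((1 + 1) ^+ q * (M * wt N (-1 *: x1 + y))) =
  Mp * 2 ^+ q * M * (wt m.*2 x1 * (wt N x1 * wt N (-1 *: x1 + y))) by rewrite wtD; ring.
rewrite ler_wpM2l ?mulr_ge0 ?exprn_ge0//.
apply: ler_pM; rewrite ?mulr_ge0 ?wt_ge0//.
  rewrite /x1 addrC; apply: le_trans (wt_shift _ _ _) _; rewrite ler_wpM2r ?wt_ge0//.
  rewrite lerXn2r ?nnegrE ?addr_ge0// lerD2l; apply: le_trans (norm_ev_le _ _) _.
  by apply: le_trans ht _; rewrite ler_piMr.
rewrite /wt -invfM lef_pV2 ?posrE ?mulr_gt0 ?onenX_gt0//.
have {1}-> : y = x1 + (-1 *: x1 + y) by rewrite scaleN1r addrA subrr add0r.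
exact: onenXD.
Qed.

(* Differences in x of [psi x * f (y - x)], estimated as functions of y. *)
Lemma dbound_dif_conv q i N (psi : V -> R) (Mp : R) :
  dbound q psi (fun x => Mp * wt (m.*2 + N) x) ->
  exists2 K, 0 <= K & forall n (f : V -> R) (M h : R) x, 0 < h -> h <= 1 ->
    dbound (n + q) f (fun y => M * wt N y) ->
    dbound n (fun y => iter q (dif i h) (fun x => psi x * f (y - x)) x)
      (fun y => (K * M * h ^+ q * wt m.*2 x) * wt N y).
Proof.
move=> hpsi; have Mp0 := dbound_wt_ge0 hpsi.
exists (2 ^+ q * (Mp * 2 ^+ q) * (1 + q%:R) ^+ m.*2).
  by rewrite !mulr_ge0// exprn_ge0// addr_ge0.
move=> n f M h x h0 h1.
have yx (f' : V -> R) : (fun y => iter q (dif i h) (fun x => psi x * f' (y - x)) x) =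
    (fun y => iter q (dif i h) ((fun x y => psi x * f' (1 *: y + - x)) ^~ y) x).
  apply/funext => y; congr (iter q _ _ _); apply/funext => x'; by rewrite scale1r.
elim: n f => [|n IH] f hf.
  have hx x' := dbound_scale (psi x') (dbound_affine 1 (- x') hf).
  split=> //; first by move=> y; apply: dif_conv_bound.
  by rewrite yx; apply: difn_param_cont => x'; exact: (dbound_cont (hx x')).
have hx x' := dbound_scale (psi x') (dbound_affine 1 (- x') hf).
split.
- by move=> y; apply: dif_conv_bound => //; exact: dboundW (leq_addl _ q) hf.
- by rewrite yx; apply: difn_param_cont => x'; exact: (dbound_cont (hx x')).
move=> j; rewrite yx.
have [D E] := @difn_param_pd q i j h (fun x y => psi x * f (1 *: y + - x))
  (fun x' => dbound_derivable (hx x') j) x.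
split => //; rewrite E.
have := IH _ (dbound_pd hf j); rewrite yx; congr dbound.
apply/funext => y; congr (iter q _ _ _); apply/funext => x'.
have [p1 p2] := @pd_affine R m j f 1 (- x') y (dbound_derivable hf j).
rewrite [RHS]/pd (deriveMl (psi x') p1) -[X in _ = _ * X]/(pd j _ y) p2.
by rewrite mul1r.
Qed.

End RegularizedTransform.

(** * Decay of the regularized Fourier transform, at the cost of powers of the scale *)

Section FourierDecay.
Variables (R : realType) (m : nat).
Local Notation V := 'rV[R]_m.
Local Notation C := R[i].

Lemma cdbound_dif_conv q i N (psi : V -> C) : ctest psi ->
  exists2 K, 0 <= K & forall n (f : V -> C) (M h : R) x, 0 < h -> h <= 1 ->
    cdbound (n + q) f (fun y => M * wt N y) ->
    cdbound n (fun y => iter q (dif i h) (fun x => psi x * f (y - x)) x)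
      (fun y => (K * M * h ^+ q * wt m.*2 x) * wt N y).
Proof.
move=> /ctest_schwartz/(cschwartz_bound q (m.*2 + N)%N)[Mp _ [hr hi]].
have [K1 K10 H1] := dbound_dif_conv i hr; have [K2 K20 H2] := dbound_dif_conv i hi.
exists (K1 + K2); first exact: addr_ge0.
move=> n f M h x h0 h1 [fr fi].
have E y : (K1 + K2) * M * h ^+ q * wt m.*2 x * wt N y =
  K1 * M * h ^+ q * wt m.*2 x * wt N y + K2 * M * h ^+ q * wt m.*2 x * wt N y by ring.
split.
  have -> : (fun y => cRe (iter q (dif i h) (fun x => psi x * f (y - x)) x)) =
    (fun y => iter q (dif i h) (fun x => cRe (psi x) * cRe (f (y - x))) x -
              iter q (dif i h) (fun x => cIm (psi x) * cIm (f (y - x))) x).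
    apply/funext => y; rewrite Re_difn -[RHS](congr1 (fun F => F x) (difn_sub _ _ _ _ _)).
    by congr (iter q _ _ _); apply/funext => x'; rewrite cReM.
  apply: dbound_le (dbound_sub (H1 n _ M h x h0 h1 fr) (H2 n _ M h x h0 h1 fi)) => y.
  by rewrite E.
have -> : (fun y => cIm (iter q (dif i h) (fun x => psi x * f (y - x)) x)) =
    (fun y => iter q (dif i h) (fun x => cRe (psi x) * cIm (f (y - x))) x -
              iter q (dif i h) (fun x => cIm (psi x) * - cRe (f (y - x))) x).
  apply/funext => y; rewrite Im_difn -[RHS](congr1 (fun F => F x) (difn_sub _ _ _ _ _)).
  by congr (iter q _ _ _); apply/funext => x'; rewrite cImM mulrN opprK.
apply: dbound_le (dbound_sub (H1 n _ M h x h0 h1 fi)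
  (H2 n (fun y => - cRe (f y)) M h x h0 h1 (dbound_opp fr))) => y.
by rewrite E.
Qed.

Lemma chir_bound (chi : V -> C) n N : cschwartz chi -> exists2 M, 0 <= M &
  forall g, 1 <= g -> cdbound n (chir chi g) (fun y => (g ^+ n * M) * wt N y).
Proof.
move=> /(cschwartz_bound n N)[M M0 hM]; exists (2 ^+ n * M); first by rewrite mulr_ge0// exprn_ge0.
move=> g g1; have g0 : 0 <= g by rewrite (le_trans ler01).
have := cdbound_affine (- g) (0 : V) hM.
under eq_fun do rewrite addr0.
apply: cdbound_le => y; rewrite addr0 normrN (ger0_norm g0).
have -> : g ^+ n * (2 ^+ n * M) * wt N y = (2 * g) ^+ n * (M * wt N y) by rewrite exprMn; ring.
rewrite ler_pM ?exprn_ge0 ?mulr_ge0 ?addr_ge0 ?wt_ge0//.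
  by rewrite lerXn2r ?nnegrE ?mulr_ge0 ?addr_ge0// mulr_natl mulr2n lerD2r.
rewrite ler_wpM2l//; apply: wt_le; rewrite scaleNr normrN normrZ (ger0_norm g0).
by rewrite ler_peMl.
Qed.

Variables (w : (V -> C) -> C) (chi psi : V -> C).
Hypotheses (hw : tempered w) (hchi : cschwartz chi) (tpsi : ctest psi).

Lemma tempered_difn q i h (Phi : V -> V -> C) : (forall x, cschwartz (Phi x)) -> forall x,
  cschwartz (fun y => iter q (dif i h) (Phi ^~ y) x) /\
  iter q (dif i h) (fun x => w (Phi x)) x = w (fun y => iter q (dif i h) (Phi ^~ y) x).
Proof.
move=> s; elim: q => [|q IH] x /=; first by split.
have [s1 e1] := IH (h *: ev R i + x); have [s2 e2] := IH x.
split; last by rewrite {1}/dif e1 e2 -(tempered_sub hw).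
exact: cschwartz_sub.
Qed.

(** Summation by parts applied to the lattice sums of the integral, with the differences carried
    inside [w]. The exponent of [g] collects [m] from the normalization of the kernel, [N] from the
    order of [w], and [q] from the differences; only the last depends on [q]. *)
Lemma mollify_FT_decay1 : exists N0, forall q i, exists2 K, 0 <= K &
  forall g (xi : V), 1 <= g ->
    `|xi 0 i| ^+ q * cabs (cFT (fun x => psi x * mollify w chi g x) xi) <= K * g ^+ (q + N0).
Proof.
have [Kw [N [Kw0 hKw]]] := tempered_bound hw.
exists (m + N)%N => q i.
have [K1 K10 H] := cdbound_dif_conv q i N tpsi.
have [M M0 hM] := chir_bound (N + q) N hchi.
exists (8 ^+ q * 5 ^+ m * (Kw * (K1 * (2 * M)))); first by rewrite !mulr_ge0// exprn_ge0.
move=> g xi g1; have g0 : 0 < g by rewrite (lt_le_trans ltr01).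
have g0' := ltW g0.
pose f (y : V) : C := (g ^+ m)%:C * chir chi g y.
pose F x : C := w (fun y => psi x * f (y - x)).
have sf x : cschwartz (fun y => psi x * f (y - x)).
  apply: cschwartz_scale; apply: (@cschwartz_trans _ _ f (- x)); apply: cschwartz_scale.
  exact: chir_schwartz.
have FE x : psi x * mollify w chi g x = F x.
  rewrite /F (tempered_scale hw); last first.
    by apply: (@cschwartz_trans _ _ f (- x)); apply: cschwartz_scale; exact: chir_schwartz.
  rewrite mollifyE// (tempered_scale hw)//.
  by apply: cschwartz_trans; exact: chir_schwartz.
have hf : cdbound (N + q) f (fun y => (2 * g ^+ m * (g ^+ (N + q) * M)) * wt N y).
  apply: cdbound_le (cdbound_scale (g ^+ m)%:C (hM g g1)) => y.
  by rewrite cabsC ger0_norm ?exprn_ge0// !mulrA.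
have tG := ctest_wave xi tpsi.
have /ctestP[_ [r hr]] := tpsi.
set T := cFT _ _.
pose B := Kw * (K1 * (2 * g ^+ m * (g ^+ (N + q) * M))).
have -> : 8 ^+ q * 5 ^+ m * (Kw * (K1 * (2 * M))) * g ^+ (q + (m + N)) = 8 ^+ q * 5 ^+ m * B.
  by rewrite /B !exprD; ring.
(* The estimate of the lattice sums is independent of the mesh, so it passes to the integral up to
   an arbitrary [e]. *)
apply/ler_addgt0Pr => e e0.
pose e' := e / (1 + `|xi 0 i| ^+ q).
have x0 : 0 < 1 + `|xi 0 i| ^+ q by rewrite ltr_pwDl// exprn_ge0.
have e'0 : 0 < e' by rewrite divr_gt0.
have c1 := csum_mollify_cvg hw hchi g1 tG e'0.
have c2 := hs_nus (r + q%:R + 1) g1.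
have pi0 : 0 < pi / (1 + `|xi 0 i|) by rewrite divr_gt0 ?pi_gt0// ltr_pwDl.
have c3 := hs_small g1 pi0.
have [k0 h] := eventually_and c1 (eventually_and c2 c3).
have [k1 [k2 k3]] := h k0 (leqnn _).
have s0 := hsg_gt0 g1 k0; have s1 := hsg_le1 g1 k0.
set s := hs R k0 / g in s0 s1 k1 k2 k3.
have supp (x : V) : r < `|x 0 i| -> F x = 0.
  move=> hx; rewrite -FE hr ?mul0r//; exact: lt_le_trans hx (coord_le_norm x i).
have b2 : r + q%:R * s < s * (nus k0)%:R.
  apply: lt_le_trans k2; rewrite -addrA ltrD2l (@le_lt_trans _ _ q%:R)// ?ler_piMr//.
  by rewrite ltrDl.
have b3 : s * `|xi 0 i| <= pi.
  apply: le_trans (ler_wpM2r (normr_ge0 _) k3) _.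
  rewrite mulrAC ler_pdivrMr ?ltr_pwDl// ler_wpM2l ?pi_ge0// lerDr//.
have b4 x : cabs (iter q (dif i s) F x) <= s ^+ q * B * wt m.*2 x.
  have [st ->] := tempered_difn q i s sf x.
  apply: le_trans (hKw _ _ st (H N f _ s x s0 s1 hf)) _.
  by apply: le_of_eq; rewrite /B; ring.
have L := csum_wave_decay s0 s1 supp b2 b3 b4.
have TE : T = cint (fun x => psi x * wave xi x * mollify w chi g x) by exact: cFT_mollify.
have SE : (fun x => F x * wave xi x) = (fun x => psi x * wave xi x * mollify w chi g x).
  by apply/funext => x; rewrite -FE mulrAC.
rewrite SE in L; rewrite -TE in k1; set S := csum _ _ _ in L k1.
have -> : T = S - (S - T) by rewrite subKr.
apply: (@le_trans _ _ (`|xi 0 i| ^+ q * (cabs S + e'))).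
  rewrite ler_wpM2l ?exprn_ge0//; apply: le_trans (cabsB _ _) _; by rewrite lerD2l.
rewrite mulrDr lerD// /e' mulrA ler_pdivrMr// mulrC ler_wpM2l ?(ltW e0)//.
by rewrite lerDr.
Qed.

(** The coordinate estimates combine because the sup norm is attained at a coordinate; [i0] supplies
    a coordinate for the estimate without decay. *)
Lemma mollify_FT_decay (i0 : 'I_m) : exists N0, forall q, exists2 K, 0 <= K &
  forall g (xi : V), 1 <= g ->
    (1 + `|xi|) ^+ q * cabs (cFT (fun x => psi x * mollify w chi g x) xi) <= K * g ^+ (q + N0).
Proof.
have [N0 h] := mollify_FT_decay1; exists N0 => q.
have /choice[K hK] : forall i, exists K, 0 <= K /\ forall g (xi : V), 1 <= g ->
    `|xi 0 i| ^+ q * cabs (cFT (fun x => psi x * mollify w chi g x) xi) <= K * g ^+ (q + N0).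
  by move=> i; have [K K0 hK] := h q i; exists K.
have [K' K'0 hK'] := h 0%N i0.
have S0 : 0 <= \sum_i K i by rewrite sumr_ge0// => i _; case: (hK i).
exists (2 ^+ q * (K' + (K' + \sum_i K i))); first by rewrite mulr_ge0 ?exprn_ge0 ?addr_ge0.
move=> g xi g1; set T := cabs _.
have g0 : 0 <= g by rewrite (le_trans ler01).
have T0 : 0 <= T by exact: cabs_ge0.
have hT : T <= K' * g ^+ (q + N0).
  have := hK' g xi g1; rewrite expr0 mul1r => h1; apply: le_trans h1 _.
  by rewrite ler_wpM2l// ler_weXn2l// leq_add2r.
apply: (@le_trans _ _ (2 ^+ q * (1 + `|xi| ^+ q) * T)).
  by rewrite ler_wpM2r// onenX_le_sum.
rewrite -!mulrA ler_wpM2l ?exprn_ge0// mulrDl mul1r mulrDl lerD//.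
have gq : 0 <= g ^+ (q + N0) by rewrite exprn_ge0.
have [->|[i ->]] := norm_attained xi.
  rewrite expr0n; case: (q == 0%N); rewrite ?mul0r ?mul1r; last by rewrite mulr_ge0// addr_ge0.
  by apply: le_trans hT _; rewrite ler_wpM2r// lerDl.
apply: le_trans ((hK i).2 g xi g1) _; rewrite ler_wpM2r//.
by apply: le_trans (ler_sum_term (F := K) i _) _; rewrite /= ?lerDr// => j; case: (hK j).
Qed.

End FourierDecay.

(** * Trigonometric interpolation *)

Section RootsOfUnity.
Variable R : realType.
Local Notation C := R[i].

Lemma expi0 : expi 0 = 1 :> C. Proof. by rewrite /expi cos0 sin0. Qed.

Lemma expiX (t : R) n : expi (n%:R * t) = expi t ^+ n.
Proof.
elim: n => [|n IH]; first by rewrite mul0r expi0 expr0.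
by rewrite -natr1 mulrDl mul1r expiD IH exprSr.
Qed.

Lemma expi2pi : expi (2 * pi) = 1 :> C.
Proof. by rewrite mulr_natl /expi cos2pi sin2pi. Qed.

Lemma expiN_id (t : R) : expi t = 1 -> expi (- t) = 1 :> C.
Proof. by move=> h; have := expiD t (- t); rewrite subrr expi0 h mul1r. Qed.

Lemma expi_eq1 (t : R) : `|t| < 2 * pi -> expi t = 1 :> C -> t = 0.
Proof.
have p0 := pi_gt0 R.
have small (u : R) : `|u| <= pi -> expi u = 1 :> C -> u = 0.
  move=> h e; have := cabs_expi_sub1 h; rewrite e subrr cabs0.
  by rewrite ler_pdivrMr// mul0r normr_le0 => /eqP.
move=> t2 e; have [t1|t1] := leP `|t| pi; first exact: small.
have [t0|t0] := leP 0 t.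
  rewrite ger0_norm// in t1 t2.
  have : t - 2 * pi = 0.
    apply: small; first by rewrite ler0_norm ?subr_le0 ?(ltW t2)//; lra.
    by rewrite expiD e (expiN_id expi2pi) mulr1.
  move/eqP; rewrite subr_eq0 => /eqP et; by rewrite et ltxx in t2.
rewrite ltr0_norm// in t1 t2.
have : t + 2 * pi = 0.
  apply: small; first by rewrite ger0_norm; lra.
  by rewrite expiD e expi2pi mulr1.
move=> et; lra.
Qed.

(** Discrete orthogonality. Off the diagonal it is a geometric sum, up to a constant phase due to
    the centring at [nu]; its ratio is a root of unity, different from 1 because |a - b| is less
    than the number of nodes. *)
Lemma sum_root_unity nu (a b : 'I_(nu.*2.+1)) :
  \sum_(j < nu.*2.+1) expi (2 * pi / (nu.*2.+1)%:R * (a%:R - b%:R) * (j%:R - nu%:R)) =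
  (if a == b then (nu.*2.+1)%:R else 0) :> C.
Proof.
set L := nu.*2.+1; have L0 : (L%:R : R) != 0 by rewrite pnatr_eq0.
have p0 := pi_gt0 R.
case: eqP => [->|ab].
  under eq_bigr do rewrite subrr mulr0 mul0r expi0.
  by rewrite sumr_const card_ord.
set th := 2 * pi / L%:R * (a%:R - b%:R).
have E j : expi (th * (j%:R - nu%:R)) = expi th ^+ j * expi (- (nu%:R * th)).
  by rewrite -expiX -expiD; congr expi; ring.
under eq_bigr do rewrite E.
rewrite -mulr_suml.
have zL : expi th ^+ L = 1.
  rewrite -expiX /th.
  have -> : L%:R * (2 * pi / L%:R * (a%:R - b%:R)) = a%:R * (2 * pi) + b%:R * (- (2 * pi)) :> R.
    by field.
  by rewrite expiD (expiX (2 * pi) a) (expiX (- (2 * pi)) b) expi2pi (expiN_id expi2pi) !expr1n mulr1.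
have z1 : expi th - 1 != 0.
  rewrite subr_eq0; apply/eqP => e.
  have Lp : (0 : R) < L%:R by rewrite ltr0n.
  have hab : `|a%:R - b%:R| < (L%:R : R).
    have ha : a%:R < (L%:R : R) by rewrite ltr_nat ltn_ord.
    have hb : b%:R < (L%:R : R) by rewrite ltr_nat ltn_ord.
    have a0 : 0 <= (a%:R : R) by []. have b0 : 0 <= (b%:R : R) by [].
    rewrite ltr_norml; apply/andP; split; lra.
  have th0 : th = 0.
    apply: expi_eq1 e; rewrite /th normrM [X in X * _]ger0_norm; last first.
      by rewrite divr_ge0// mulr_ge0// ltW.
    rewrite mulrAC ltr_pdivrMr// ltr_pM2l// mulr_gt0//.
  apply: ab; apply: val_inj; apply/eqP; rewrite -(eqr_nat R) -subr_eq0.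
  move/eqP: th0; rewrite /th mulf_eq0 => /orP[|//].
  by rewrite mulf_eq0 invr_eq0 (negPf L0) orbF mulf_eq0 (gt_eqF p0) pnatr_eq0.
have := subrX1 (expi th : C) L; rewrite zL subrr => /esym/eqP.
by rewrite mulf_eq0 (negPf z1)/= => /eqP ->; rewrite mul0r.
Qed.

Lemma expi_sum (I : Type) (r : seq I) (F : I -> R) :
  expi (\sum_(j <- r) F j) = \prod_(j <- r) expi (F j) :> C.
Proof. exact: (big_morph _ (fun s t => expiD s t) expi0). Qed.

Lemma sum_wave_grid m nu (T : R) (J K : 'rV['I_(nu.*2.+1)]_m) : 0 < T ->
  \sum_N wave (@grid R m nu (2 * pi / T) N)
     (grid (T / (nu.*2.+1)%:R) J - grid (T / (nu.*2.+1)%:R) K) =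
  (if J == K then (nu.*2.+1)%:R ^+ m else 0) :> C.
Proof.
move=> T0; set L := nu.*2.+1; have L0 : (L%:R : R) != 0 by rewrite pnatr_eq0.
have T0' : T != 0 by rewrite gt_eqF.
pose a i (j : 'I_L) : C := expi (2 * pi / L%:R * ((K 0 i)%:R - (J 0 i)%:R) * (j%:R - nu%:R)).
transitivity (\sum_(N : 'rV['I_L]_m) \prod_i a i (N 0 i)).
  apply: eq_bigr => N _; rewrite /wave /dot -sumrN expi_sum; apply: eq_bigr => i _.
  rewrite /a !mxE /gpt; congr expi; field; exact/andP.
rewrite sum_prod_rV.
under eq_bigr do rewrite /a sum_root_unity.
have [<-|/eqP JK] := eqVneq J K.
  under eq_bigr do rewrite eqxx.
  by rewrite prodr_const card_ord.
have [i iJK] : exists i, J 0 i != K 0 i.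
  apply/existsP; rewrite -negb_forall; apply/negP => /forallP h.
  by apply: JK; apply/rowP => i; exact/eqP.
by rewrite (bigD1 i)//= eq_sym (negPf iJK) mul0r.
Qed.

End RootsOfUnity.

(** * Discrete Fourier coefficients and trigonometric interpolants *)

Section Interpolant.
Variables (R : realType) (m : nat).
Local Notation V := 'rV[R]_m.
Local Notation C := R[i].

(** The discrete Fourier transform on 2 nu + 1 nodes per axis over one period [T], normalized as a
    Riemann sum of a Fourier coefficient. Unlike a Fourier series, the interpolant is a finite sum
    and reproduces the function exactly at the nodes. *)
Definition dft_coef nu (T : R) (kappa : V -> C) (N : 'rV['I_(nu.*2.+1)]_m) : C :=
  ((T ^+ m)^-1)%:C *
  csum nu (T / (nu.*2.+1)%:R) (fun x => kappa x * wave (@grid R m nu (2 * pi / T) N) x).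

Definition interpolant nu (T : R) (kappa : V -> C) (x : V) : C :=
  \sum_N dft_coef T kappa N * wave (- @grid R m nu (2 * pi / T) N) x.

Lemma waveNl (xi x : V) : wave (- xi) x = wave xi (- x).
Proof. by rewrite /wave dotNl dotC dotNl dotC. Qed.

Lemma interpolant_grid nu (T : R) (kappa : V -> C) K : 0 < T ->
  interpolant nu T kappa (@grid R m nu (T / (nu.*2.+1)%:R) K) = kappa (@grid R m nu (T / (nu.*2.+1)%:R) K).
Proof.
move=> T0; set L := nu.*2.+1; have L0 : (L%:R : R) != 0 by rewrite pnatr_eq0.
rewrite /interpolant.
transitivity (\sum_N \sum_J ((L%:R ^+ m)^-1)%:C * kappa (@grid R m nu (T / L%:R) J) *
   wave (@grid R m nu (2 * pi / T) N) (@grid R m nu (T / L%:R) J - @grid R m nu (T / L%:R) K)).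
  apply: eq_bigr => N _; rewrite /dft_coef /csum mulrA -rmorphM/=.
  have -> : (T ^+ m)^-1 * (T / L%:R) ^+ m = (L%:R ^+ m)^-1.
    by rewrite exprMn mulrA mulVf ?mul1r ?exprVn// expf_neq0// gt_eqF.
  rewrite waveNl mulr_sumr mulr_suml; apply: eq_bigr => J _.
  by rewrite waveD !mulrA.
rewrite exchange_big/=.
under eq_bigr do rewrite -mulr_sumr sum_wave_grid//.
rewrite (bigD1 K)//= eqxx big1 ?addr0; last by move=> J /negPf ->; rewrite mulr0.
have -> : ((nu.*2.+1)%:R ^+ m : C) = ((nu.*2.+1)%:R ^+ m)%:C by rewrite rmorphXn rmorph_nat.
by rewrite mulrAC -rmorphM/= mulVf ?expf_neq0// rmorph1 mul1r.
Qed.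

(** Summation by parts again. The half period T/2 = 2r + 4 leaves room for the support widened by
    [q] differences once the spacing satisfies s (1 + q) <= 1. The constant depends on neither [nu]
    nor [kappa]. *)
Lemma dft_coef_decay q (r T : R) (i0 : 'I_m) : 0 <= r -> 4 * (r + 2) = T -> exists2 K, 0 <= K &
  eventually (fun nu => forall (kappa : V -> C) (M : R),
    (forall x, r < `|x| -> kappa x = 0) ->
    cdbound 0 kappa (fun x => M * wt m.*2 x) ->
    cdbound q kappa (fun x => M * wt m.*2 x) ->
    forall N : 'rV['I_(nu.*2.+1)]_m,
      (1 + `|@grid R m nu (2 * pi / T) N|) ^+ q * cabs (dft_coef T kappa N) <= K * M).
Proof.
move=> r0 rT; have T0 : 0 < T by rewrite -rT; lra.
pose K1 := (T ^+ m)^-1 * (5 ^+ m * 2 + (\sum_(i < m) 1) * (8 ^+ q * 5 ^+ m * (2 * (1 + q%:R) ^+ m.*2))).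
have Tm : 0 <= (T ^+ m)^-1 by rewrite invr_ge0 exprn_ge0// ltW.
have s10 : 0 <= \sum_(i < m) 1 :> R by rewrite sumr_ge0.
have c0 : 0 <= 8 ^+ q * 5 ^+ m * (2 * (1 + q%:R) ^+ m.*2) :> R.
  by rewrite !mulr_ge0 ?exprn_ge0 ?addr_ge0.
exists (2 ^+ q * (K1 + K1)).
  by rewrite mulr_ge0 ?exprn_ge0// addr_ge0// /K1 mulr_ge0// addr_ge0 ?mulr_ge0 ?exprn_ge0.
apply: eventuallyS (eventually_ge (T * (1 + q%:R))) => nu hnu kappa M kr k0 kq N.
set s := T / (nu.*2.+1)%:R; set z := grid _ N.
have L0 : 0 < (nu.*2.+1)%:R :> R by rewrite ltr0n.
have M0 := cdbound_wt_ge0 k0.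
have s0 : 0 < s by rewrite divr_gt0.
have q1 : 0 < 1 + q%:R :> R by rewrite ltr_pwDl.
have sq : s * (1 + q%:R) <= 1.
  rewrite /s mulrAC ler_pdivrMr// mul1r (le_trans hnu)// ler_nat ltnS -addnn leq_addr//.
have s1 : s <= 1 by apply: le_trans sq; rewrite ler_peMr ?(ltW s0)// lerDl.
have snu : s * nu%:R = T / 2 - s / 2.
  rewrite /s -mulrBl; have -> : (nu.*2.+1)%:R = 2 * nu%:R + 1 :> R.
    by rewrite -addn1 natrD -mul2n natrM.
  field; rewrite gt_eqF//; rewrite ltr_wpDl// mulr_ge0//.
have S q' (hk : cdbound q' kappa (fun x => M * wt m.*2 x)) : (q' <= q)%N -> forall i,
    `|z 0 i| ^+ q' * cabs (csum nu s (fun x => kappa x * wave z x)) <=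
    8 ^+ q' * 5 ^+ m * (2 * (1 + q'%:R) ^+ m.*2 * M).
  move=> q'q i; have q'R : q'%:R <= q%:R :> R by rewrite ler_nat.
  apply: (@csum_wave_decay R m q' nu s r _ i kappa z) => //.
  - by move=> x hx; apply: kr; exact: lt_le_trans hx (coord_le_norm x i).
  - have : q'%:R * s <= q%:R * s by rewrite ler_wpM2r// ltW.
    rewrite snu -rT; lra.
  (* The frequencies stop at the Nyquist bound: |N_i - nu| <= nu is less than half the number of
     nodes, so s |z_i| <= pi. *)
  - rewrite /z !mxE /gpt normrM ger0_norm; last by rewrite divr_ge0 ?mulr_ge0 ?pi_ge0// ltW.
    have -> : s * (2 * pi / T * `|(N 0 i)%:R - nu%:R|) =
       pi * (2 * `|(N 0 i)%:R - nu%:R| / (nu.*2.+1)%:R).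
      by rewrite /s; field; rewrite !gt_eqF.
    rewrite ler_piMr ?pi_ge0// ler_pdivrMr// mul1r.
    have h : (N 0 i)%:R < (nu.*2.+1)%:R :> R by rewrite ltr_nat.
    have e : (nu.*2.+1)%:R = 2 * nu%:R + 1 :> R by rewrite -addn1 natrD -mul2n natrM.
    have h' : (N 0 i)%:R <= 2 * nu%:R :> R.
      by rewrite -natrM ler_nat mul2n -ltnS.
    have n0 : 0 <= (N 0 i)%:R :> R by [].
    have : `|(N 0 i)%:R - nu%:R| <= nu%:R :> R by rewrite ler_norml; apply/andP; split; lra.
    rewrite e; lra.
  - move=> x; apply: le_trans (cabs_le_ReIm _) _.
    have B t : `|t| <= q'%:R * s -> M * wt m.*2 (t *: ev R i + x) <= (1 + q'%:R) ^+ m.*2 * M * wt m.*2 x.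
      move=> ht; rewrite [_ * M]mulrC -mulrA ler_wpM2l// addrC.
      apply: le_trans (wt_shift _ _ _) _; rewrite ler_wpM2r ?wt_ge0//.
      rewrite lerXn2r ?nnegrE ?addr_ge0// lerD2l; apply: le_trans (norm_ev_le _ _) _.
      by apply: le_trans ht _; rewrite ler_piMr.
    rewrite Re_difn Im_difn.
    have -> : s ^+ q' * (2 * (1 + q'%:R) ^+ m.*2 * M) * wt m.*2 x =
      s ^+ q' * ((1 + q'%:R) ^+ m.*2 * M * wt m.*2 x) + s ^+ q' * ((1 + q'%:R) ^+ m.*2 * M * wt m.*2 x).
      by ring.
    case: hk => hk1 hk2; apply: lerD.
      exact: (difn_bound (ltW s0) hk1 B).
    exact: (difn_bound (ltW s0) hk2 B).
set c := cabs (dft_coef T kappa N).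
have cE : c = (T ^+ m)^-1 * cabs (csum nu s (fun x => kappa x * wave z x)).
  by rewrite /c /dft_coef cabsM cabsC ger0_norm.
have cc : 0 <= c by exact: cabs_ge0.
have h0 : c <= K1 * M.
  rewrite cE /K1 -mulrA ler_wpM2l//.
  have := S 0%N k0 (leq0n _) i0; rewrite !expr0 !mul1r => h.
  apply: le_trans h _; rewrite addr0 expr1n mulr1 mulrA ler_wpM2r// lerDl mulr_ge0//.
have hi i : `|z 0 i| ^+ q * c <= K1 * M.
  rewrite cE mulrCA /K1 -mulrA ler_wpM2l//; apply: le_trans (S q kq (leqnn _) i) _.
  rewrite [leLHS]mulrA ler_wpM2r//.
  apply: (@le_trans _ _ ((\sum_(i < m) 1) * (8 ^+ q * 5 ^+ m * (2 * (1 + q%:R) ^+ m.*2)))).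
    rewrite -mulrA ler_peMl// (bigD1 i)//= lerDl sumr_ge0//.
  by rewrite lerDr mulr_ge0// exprn_ge0.
apply: (@le_trans _ _ (2 ^+ q * (1 + `|z| ^+ q) * c)).
  by rewrite ler_wpM2r// onenX_le_sum.
rewrite -!mulrA ler_wpM2l ?exprn_ge0// mulrDl mul1r mulrDl lerD//.
have [->|[i ->]] := norm_attained z; last exact: hi.
by rewrite expr0n; case: (q == 0%N); rewrite ?mul0r ?mul1r// (le_trans cc).
Qed.

End Interpolant.

(** * Products with cutoffs and decay in cones *)

Section ConeDecay.
Variables (R : realType) (m : nat).
Local Notation V := 'rV[R]_m.
Local Notation C := R[i].

(** Decay of order [P + m.*2] leaves a summable weight on the frequency lattice. Its mesh 2 pi/T is
    at most 1, since T >= 8 and pi <= 4, so the uniform lattice bound applies. *)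
Lemma dft_coef_sum P (r T : R) (i0 : 'I_m) : 0 <= r -> 4 * (r + 2) = T -> exists2 K, 0 <= K &
  eventually (fun nu => forall (kappa : V -> C) (M : R),
    (forall x, r < `|x| -> kappa x = 0) ->
    cdbound (P + m.*2) kappa (fun x => M * wt m.*2 x) ->
    \sum_N (1 + `|@grid R m nu (2 * pi / T) N|) ^+ P * cabs (dft_coef T kappa N) <= K * M).
Proof.
move=> r0 rT; have [K K0 hK] := dft_coef_decay (P + m.*2) i0 r0 rT.
have T8 : 8 <= T by rewrite -rT; lra.
have T0 : 0 < T by lra.
have p0 := pi_gt0 R.
have p4 : pi <= 4 :> R by case: (pihalf_02_cos_pihalf R) => /andP[] *; lra.
pose la : R := 2 * pi / T.
have la0 : 0 < la by rewrite divr_gt0// mulr_gt0.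
have la1 : la <= 1 by rewrite ler_pdivrMr// mul1r; lra.
exists ((la ^+ m)^-1 * 5 ^+ m * K).
  by rewrite !mulr_ge0 ?exprn_ge0 ?invr_ge0 ?exprn_ge0 ?(ltW la0).
apply: eventuallyS hK => nu hnu kappa M kr hk.
have M0 := cdbound_wt_ge0 hk.
have D := hnu kappa M kr (cdboundW (leq0n _) hk) hk.
apply: (@le_trans _ _ (\sum_N K * M * wt m.*2 (@grid R m nu la N))).
  apply: ler_sum => N _; have := D N; rewrite -/la; set z := grid _ _ => h.
  rewrite /wt ler_pdivlMr ?onenX_gt0// mulrAC -exprD; exact: h.
rewrite -mulr_sumr.
have -> : (la ^+ m)^-1 * 5 ^+ m * K * M = K * M * ((la ^+ m)^-1 * 5 ^+ m) by ring.
rewrite ler_wpM2l ?mulr_ge0// ler_pdivlMl ?exprn_gt0//.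
exact: sum_wt.
Qed.

Lemma eventually_uniform n N (f : nat -> V -> C) :
  (exists M, eventually (fun k => cdbound n (f k) (fun x => M * wt N x))) ->
  (forall k, cschwartz (f k)) -> exists M, forall k, cdbound n (f k) (fun x => M * wt N x).
Proof.
move=> [M [k0 h]] sf.
have /choice[Mk hMk] : forall k, exists M, 0 <= M /\ cdbound n (f k) (fun x => M * wt N x).
  by move=> k; have [M' M'0 hM'] := cschwartz_bound n N (sf k); exists M'.
have S0 : 0 <= \sum_(k < k0) Mk k by rewrite sumr_ge0// => k _; case: (hMk k).
exists (`|M| + \sum_(k < k0) Mk k) => k; have [kk|kk] := leqP k0 k.
  apply: cdbound_le (h k kk) => x; rewrite ler_wpM2r ?wt_ge0//.
  by rewrite (le_trans (ler_norm M))// lerDl.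
apply: cdbound_le (hMk k).2 => x; rewrite ler_wpM2r ?wt_ge0//.
by apply: le_trans (ler_sum_term (F := fun j : 'I_k0 => Mk j) (Ordinal kk) _) _; rewrite /= ?lerDr// => j; case: (hMk j).
Qed.

Lemma csmooth_sum (I : Type) (r : seq I) (F : I -> V -> C) :
  (forall j, csmooth (F j)) -> csmooth (fun x => \sum_(j <- r) F j x).
Proof.
move=> h; apply: cdbound_csmooth => n.
have /choice[b hb] : forall j, exists b, cdbound n (F j) b by move=> j; exact: csmooth_cdbound.
by eexists; exact: cdbound_sum hb.
Qed.

Lemma csmooth_scale (c : C) (f : V -> C) : csmooth f -> csmooth (fun x => c * f x).
Proof.
move=> h; apply: cdbound_csmooth => n; have [b hb] := csmooth_cdbound n h.
by eexists; exact: cdbound_scale hb.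
Qed.

Lemma csmooth_sub (f g : V -> C) : csmooth f -> csmooth g -> csmooth (fun x => f x - g x).
Proof.
move=> hf hg; apply: cdbound_csmooth => n.
have [b hb] := csmooth_cdbound n hf; have [b' hb'] := csmooth_cdbound n hg.
by eexists; exact: cdbound_sub hb hb'.
Qed.

Lemma nearest_grid nu (s : R) (x : V) : 0 < s -> `|x| <= s * nu%:R ->
  exists J, `|x - @grid R m nu s J| <= s.
Proof.
move=> s0 hx.
have /choice[J hJ] : forall i, exists j : 'I_(nu.*2.+1), gpt nu s j <= x 0 i < gpt nu s j + s.
  by move=> i; apply: cell_exists => //; apply: le_trans hx; exact: coord_le_norm.
exists (\row_i J i); apply: norm_le_coord; first exact: ltW.
move=> i; rewrite !mxE; have /andP[a b] := hJ i.
by rewrite ger0_norm ?subr_ge0// lerBlDl ltW.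
Qed.

Variables (w : (V -> C) -> C).
Hypothesis hw : tempered w.

(** The error [kappa - P nu] vanishes at the nodes and has bounded derivatives because the
    coefficients are summable, so it tends to 0 on the ball of radius [r]. The interpolant is
    periodic and does not decay; multiplication by [G], supported in the same ball, removes the
    other periods. *)
Lemma interpolant_pairing_cvg (i0 : 'I_m) (r T : R) (kappa G : V -> C) (e : R) :
  0 <= r -> 4 * (r + 2) = T -> ctest kappa -> ctest G ->
  (forall x, r < `|x| -> kappa x = 0) -> (forall x, r < `|x| -> G x = 0) -> 0 < e ->
  eventually (fun nu => cabs (w (fun x => kappa x * G x) -
    \sum_N dft_coef T kappa N * w (fun x => wave (- @grid R m nu (2 * pi / T) N) x * G x)) <= e).
Proof.
move=> r0 rT tk tG kr Gr e0; have T0 : 0 < T by rewrite -rT; lra.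
have sG := ctest_schwartz tG; have sk := ctest_schwartz tk.
have kT (f : V -> C) : csmooth f -> ctest (fun x => f x * G x).
  move=> sf; have := ctest_mul sf tG; by under eq_fun do rewrite mulrC.
pose P nu := interpolant nu T kappa.
pose f nu x := kappa x * G x - P nu x * G x.
have sP nu : csmooth (P nu).
  by apply: csmooth_sum => N; apply: csmooth_scale; exact: csmooth_wave.
have [skr _] := (ctestP _).1 tk.
have sf nu : cschwartz (f nu).
  apply: ctest_schwartz; have := kT _ (csmooth_sub skr (sP nu)).
  by under eq_fun do rewrite mulrBl.
have Pb n : exists M, eventually (fun nu => cdbound n (P nu) (fun _ => M)).
  have [K K0 hK] := dft_coef_sum n i0 r0 rT.
  have [M M0 hM] := cschwartz_bound (n + m.*2) m.*2 sk.
  exists (2 * (K * M)); apply: eventuallyS hK => nu hnu.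
  have hw' N := cdbound_scale (dft_coef T kappa N) (cdbound_wave n (- @grid R m nu (2 * pi / T) N)).
  apply: cdbound_le (@cdbound_sum R m n _ (index_enum _) _ _ hw') => x.
  apply: le_trans (ler_wpM2l _ (hnu kappa M kr hM)) => //.
  rewrite mulr_sumr; apply: ler_sum => N _.
  by rewrite normrN -mulrA [cabs _ * _]mulrC.
have fb n N : exists M, forall k, cdbound n (f k) (fun x => M * wt N x).
  apply: eventually_uniform => //.
  have [M1 h1] := Pb n; have [M2 M20 h2] := cschwartz_bound n N sG.
  have [M3 M30 h3] := cschwartz_bound n 0 sk.
  exists (2 ^+ n.+1 * ((M3 + `|M1|) * M2)); apply: eventuallyS h1 => k hk.
  have e1 : f k = (fun x => (kappa x - P k x) * G x).
    by apply/funext => x; rewrite /f mulrBl.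
  rewrite e1; apply: cdbound_le (cdbound_mul (cdbound_sub h3 hk) h2) => x.
  rewrite /wt expr0 invr1 mulr1 -!mulrA ler_wpM2l ?exprn_ge0//.
  rewrite ler_wpM2r ?mulr_ge0 ?wt_ge0// lerD2l ler_norm//.
have lu Y e' : 0 < e' -> eventually (fun k => forall x, `|x| <= Y -> cabs (f k x) <= e').
  move=> e'0.
  have [M1 h1] := Pb 1%N; have [M2 M20 h2] := cschwartz_bound 0 0 sG.
  have [M3 M30 h3] := cschwartz_bound 1 0 sk.
  pose M4 := M3 + `|M1|; have M40 : 0 <= M4 by rewrite addr_ge0.
  pose K := 2 * (m%:R * M4) * (2 * M2) + 1.
  have K0 : 0 < K by rewrite ltr_wpDl// !mulr_ge0.
  apply: eventuallyS (eventually_and h1 (eventually_ge (T * K / e' + T))) => k [k1 k2] x _.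
  rewrite /f -mulrBl cabsM.
  have [xr|xr] := leP `|x| r; last by rewrite (Gr _ xr) cabs0 mulr0 ltW.
  set s := T / (k.*2.+1)%:R.
  have L0 : 0 < (k.*2.+1)%:R :> R by rewrite ltr0n.
  have s0 : 0 < s by rewrite divr_gt0.
  have kL : k.+1%:R <= (k.*2.+1)%:R :> R by rewrite ler_nat ltnS -addnn leq_addr.
  have k3 := le_trans k2 kL.
  have TK : 0 <= T * K / e' by rewrite divr_ge0 ?mulr_ge0 ?(ltW T0) ?(ltW K0) ?(ltW e'0).
  have s1 : s <= 1 by rewrite ler_pdivrMr// mul1r; lra.
  have sK : s * K <= e'.
    rewrite /s mulrAC ler_pdivrMr// [leRHS]mulrC -ler_pdivrMr//.
    by apply: le_trans k3; rewrite lerDl ltW.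
  have snu : s * k%:R = T / 2 - s / 2.
    rewrite /s -mulrBl; have -> : (k.*2.+1)%:R = 2 * k%:R + 1 :> R.
      by rewrite -addn1 natrD -mul2n natrM.
    field; rewrite gt_eqF//; rewrite ltr_wpDl// mulr_ge0//.
  have [|J hJ] := @nearest_grid k s x s0; first by rewrite snu -rT; lra.
  set x0 := grid s J in hJ.
  pose d y := kappa y - P k y.
  have d0 : d x0 = 0 by rewrite /d /P interpolant_grid// subrr.
  have hd : cdbound 1 d (fun y => M4 * wt 0 y).
    apply: cdbound_le (cdbound_sub h3 k1) => y.
    by rewrite /wt expr0 invr1 !mulr1 lerD2l ler_norm.
  have dE : x0 + (x - x0) = x by rewrite addrC subrK.
  have -> : kappa x - P k x = d (x0 + (x - x0)) - d x0 by rewrite d0 subr0 dE.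
  have := cdbound_cabs (cdbound_trans_diff (x - x0) hd) x0.
  have := cdbound_cabs h2 x; rewrite /wt !expr0 invr1 !mulr1 => b1 b2.
  apply: le_trans (ler_pM (cabs_ge0 _) (cabs_ge0 _) b2 b1) _.
  apply: le_trans sK; rewrite mulrC.
  apply: (@le_trans _ _ (2 * M2 * (2 * (m%:R * s * M4)))).
    by rewrite ler_wpM2l ?mulr_ge0// ler_wpM2l// ler_wpM2r// ler_wpM2l.
  have -> : 2 * M2 * (2 * (m%:R * s * M4)) = s * (2 * (m%:R * M4) * (2 * M2)) by ring.
  by rewrite ler_wpM2l ?(ltW s0)// lerDl.
apply: eventuallyS (tempered_cvg0 hw fb lu e0) => nu.
have sF N : cschwartz (fun x => wave (- @grid R m nu (2 * pi / T) N) x * G x).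
  by apply: ctest_schwartz; apply: kT; exact: csmooth_wave.
rewrite /f (tempered_sub hw); first last.
- by apply: ctest_schwartz; exact: kT.
- by apply: ctest_schwartz; exact: kT.
suff -> : w (fun x => P nu x * G x) =
  \sum_N dft_coef T kappa N * w (fun x => wave (- @grid R m nu (2 * pi / T) N) x * G x) by [].
rewrite -(tempered_sum hw)//; congr w; apply/funext => x.
by rewrite /P /interpolant mulr_suml; apply: eq_bigr => N _; rewrite mulrA.
Qed.

Lemma onenX_sub p (xi z : V) : (1 + `|xi - z|) ^+ p <= (1 + `|xi|) ^+ p * (1 + `|z|) ^+ p.
Proof. by apply: le_trans (onenXD _ _ _) _; rewrite normrN. Qed.

Lemma onenX_split p (xi z : V) : (1 + `|xi|) ^+ p <= (1 + `|xi - z|) ^+ p * (1 + `|z|) ^+ p.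
Proof. by rewrite -{1}(subrK z xi); exact: onenXD. Qed.

(* Multiplication by a bounded family of test functions preserves rapid decay,
   in a slightly smaller cone, of the Fourier transform of [psi w]. *)
Lemma cone_decay_mul (i0 : 'I_m) (I : Type) (kappa : I -> V -> C) (psi : V -> C)
    (Gam Gam' : set V) (c r : R) : ctest psi -> (forall z, ctest (kappa z)) ->
  (forall z x, r < `|x| -> kappa z x = 0) ->
  (forall n N, exists M, forall z, cdbound n (kappa z) (fun x => M * wt N x)) ->
  0 < c -> (forall xi ze, Gam' xi -> `|ze| <= c * `|xi| -> Gam (xi - ze)) ->
  (forall k, exists K, forall eta, Gam eta -> (1 + `|eta|) ^+ k * cabs (distFT w psi eta) <= K) ->
  forall k, exists2 K, 0 <= K & forall z xi, Gam' xi ->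
    (1 + `|xi|) ^+ k * cabs (w (fun x => kappa z x * (psi x * wave xi x))) <= K.
Proof.
move=> tpsi tk kr kb c0 cone dec k.
have /ctestP[_ [r1 hr1]] := tpsi.
pose r2 := Num.max 0 (Num.max r r1).
have r20 : 0 <= r2 by rewrite le_max lexx.
have kr2 z x : r2 < `|x| -> kappa z x = 0.
  by move=> hx; apply: kr; apply: le_lt_trans hx; rewrite !le_max lexx orbT.
have pr2 x : r2 < `|x| -> psi x = 0.
  by move=> hx; apply: hr1; apply: le_lt_trans hx; rewrite !le_max lexx !orbT.
have [Ku [p [Ku0 hu]]] := distFT_bound hw tpsi.
have [Kd hd] := dec k.
pose P := (k + p + p)%N.
pose Cu := `|Kd| + Ku * (1 + c^-1) ^+ (k + p).
have ci0 : 0 <= c^-1 by rewrite invr_ge0 ltW.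
have Cu0 : 0 <= Cu by rewrite addr_ge0// mulr_ge0// exprn_ge0// addr_ge0.
have U xi ze : Gam' xi -> (1 + `|xi|) ^+ k * cabs (distFT w psi (xi - ze)) <= Cu * (1 + `|ze|) ^+ P.
  (* If [ze] is small relative to [xi], then xi - ze stays in the cone of decay. Otherwise |xi| is
     dominated by |ze|, so polynomial growth of the transform suffices and the powers are paid by
     the coefficients. *)
  move=> gx; have [h|h] := leP `|ze| (c * `|xi|).
    apply: (@le_trans _ _ ((1 + `|ze|) ^+ k * `|Kd|)).
      apply: (@le_trans _ _ ((1 + `|ze|) ^+ k * ((1 + `|xi - ze|) ^+ k * cabs (distFT w psi (xi - ze))))).
        by rewrite mulrA ler_wpM2r ?cabs_ge0// mulrC onenX_split.
      rewrite ler_wpM2l ?exprn_ge0 ?addr_ge0// (le_trans (hd _ (cone _ _ gx h)))// ler_norm//.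
    rewrite mulrC ler_pM ?exprn_ge0 ?addr_ge0//; first by rewrite lerDl mulr_ge0// exprn_ge0// addr_ge0.
    by rewrite ler_weXn2l ?onen_ge1// /P -addnA leq_addr.
  have hx : 1 + `|xi| <= (1 + c^-1) * (1 + `|ze|).
    have hz : `|xi| <= c^-1 * `|ze| by rewrite ler_pdivlMl// ltW.
    have z0 : 0 <= `|ze| by [].
    rewrite mulrDl mul1r mulrDr mulr1; lra.
  apply: (@le_trans _ _ ((1 + `|xi|) ^+ k * (Ku * ((1 + `|xi|) ^+ p * (1 + `|ze|) ^+ p)))).
    rewrite ler_wpM2l ?exprn_ge0 ?addr_ge0//; apply: le_trans (hu _) _.
    by rewrite ler_wpM2l// onenX_sub.
  have -> : (1 + `|xi|) ^+ k * (Ku * ((1 + `|xi|) ^+ p * (1 + `|ze|) ^+ p)) =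
    Ku * (1 + `|xi|) ^+ (k + p) * (1 + `|ze|) ^+ p by rewrite exprD; ring.
  have -> : Cu * (1 + `|ze|) ^+ P = Cu * (1 + `|ze|) ^+ (k + p) * (1 + `|ze|) ^+ p.
    by rewrite /P exprD mulrA.
  rewrite ler_wpM2r ?exprn_ge0 ?addr_ge0//.
  apply: (@le_trans _ _ (Ku * ((1 + c^-1) ^+ (k + p) * (1 + `|ze|) ^+ (k + p)))).
    by rewrite ler_wpM2l// -exprMn lerXn2r ?nnegrE ?mulr_ge0 ?addr_ge0.
  by rewrite mulrA ler_wpM2r ?exprn_ge0 ?addr_ge0// lerDr.
pose T := 4 * (r2 + 2).
have [K K0 hK] := dft_coef_sum P i0 r20 (erefl T).
have [M hM] := kb (P + m.*2)%N m.*2.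
exists (Cu * (K * `|M|)); first by rewrite !mulr_ge0.
move=> z xi gx; apply/ler_addgt0Pr => e e0.
set G := fun x => psi x * wave xi x.
have tG : ctest G by exact: ctest_wave.
have Gr x : r2 < `|x| -> G x = 0 by move=> hx; rewrite /G pr2// mul0r.
pose X := (1 + `|xi|) ^+ k; have X0 : 0 < X by rewrite exprn_gt0// onen_gt0.
have eX : 0 < e / X by rewrite divr_gt0.
have [nu h] := eventually_and hK (interpolant_pairing_cvg i0 r20 (erefl T) (tk z) tG (kr2 z) Gr eX).
have [h1 h2] := h nu (leqnn _).
set A := w _ in h2 *; set S := \sum_N _ in h2.
have M1 : cdbound (P + m.*2) (kappa z) (fun x => `|M| * wt m.*2 x).
  by apply: cdbound_le (hM z) => x; rewrite ler_wpM2r ?wt_ge0// ler_norm.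
have hS : X * cabs S <= Cu * (K * `|M|).
  apply: (@le_trans _ _ (Cu * \sum_N (1 + `|@grid R m nu (2 * pi / T) N|) ^+ P * cabs (dft_coef T (kappa z) N))).
    apply: (@le_trans _ _ (X * \sum_N cabs (dft_coef T (kappa z) N) * cabs (distFT w psi (xi - @grid R m nu (2 * pi / T) N)))).
      rewrite ler_wpM2l ?(ltW X0)//; apply: le_trans (cabs_sum _ _) _.
      apply: le_of_eq; apply: eq_bigr => N _.
      rewrite cabsM; congr (_ * cabs _); rewrite /distFT; congr w; apply/funext => x.
      by rewrite /G mulrCA mulrC [wave _ _ * _]mulrC -waveDl mulrC.
    rewrite !mulr_sumr; apply: ler_sum => N _.
    rewrite mulrCA mulrC; have := U xi (@grid R m nu (2 * pi / T) N) gx; rewrite -/X => hU.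
    apply: le_trans (ler_wpM2r (cabs_ge0 _) hU) _.
    by rewrite mulrA.
  by rewrite ler_wpM2l// h1//; exact: kr2.
have -> : A = (A - S) + S by rewrite subrK.
apply: (@le_trans _ _ (X * (e / X + cabs S))).
  by rewrite ler_wpM2l ?(ltW X0)//; apply: le_trans (cabsD _ _) _; rewrite lerD2r.
by rewrite mulrDr mulrC divfK ?gt_eqF// addrC lerD2r.
Qed.

End ConeDecay.

(** * Test kernels *)

Section FlatFunction.
Variable R : realType.
Implicit Types (p : {poly R}) (t : R).

(** Including all polynomials in 1/t makes the family exp(-1/t) stable under differentiation, and
    smoothness follows by iterating first derivatives. *)
Definition flat p t : R := if 0 < t then p.[t^-1] * expR (- t^-1) else 0.

Lemma expR_ge_pow k (s : R) : 0 < s -> (0 < k)%N -> (s / k%:R) ^+ k <= expR s.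
Proof.
move=> s0 k0; have kR : 0 < k%:R :> R by rewrite ltr0n.
have -> : expR s = expR (s / k%:R) ^+ k.
  by rewrite -expRM_natl mulrC divfK// gt_eqF.
rewrite lerXn2r ?nnegrE ?expR_ge0 ?divr_ge0 ?(ltW s0)//.
by apply: le_trans (expR_ge1Dx _); rewrite lerDr.
Qed.

Lemma poly_bound p : exists2 A, 0 <= A & forall s : R, 1 <= s -> `|p.[s]| <= A * s ^+ size p.
Proof.
exists (\sum_(i < size p) `|p`_i|); first by rewrite sumr_ge0.
move=> s s1; rewrite horner_coef mulr_suml; apply: le_trans (ler_norm_sum _ _ _) _.
apply: ler_sum => i _; rewrite normrM ler_wpM2l// normrX ger0_norm ?(le_trans ler01)//.
by rewrite ler_weXn2l// ltnW.
Qed.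

Lemma flat_bound p : exists2 A, 0 <= A & forall t, `|t| <= 1 -> `|flat p t| <= A * t ^+ 2.
Proof.
have [A A0 hA] := poly_bound p.
(* With exp(s) >= (s/k)^k at s = 1/t, the polynomial uses up [size p] powers of 1/t; the two spare
   ones give t^2, hence a zero derivative at the origin. *)
set k := (size p).+2.
exists (A * k%:R ^+ k); first by rewrite mulr_ge0 ?exprn_ge0.
move=> t t1; rewrite /flat; case: ifPn => t0; last first.
  by rewrite normr0 mulr_ge0 ?sqr_ge0// mulr_ge0 ?exprn_ge0.
rewrite ger0_norm ?(ltW t0)// in t1.
have s0 : 0 < t^-1 by rewrite invr_gt0.
have s1 : 1 <= t^-1 by rewrite invf_ge1.
rewrite normrM expRN [`|(expR _)^-1|]ger0_norm ?invr_ge0 ?expR_ge0//.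
rewrite ler_pdivrMr ?expR_gt0//.
apply: le_trans (hA _ s1) _.
have := expR_ge_pow s0 (ltn0Sn (size p).+1); rewrite -/k => h.
apply: (@le_trans _ _ (A * k%:R ^+ k * t ^+ 2 * (t^-1 / k%:R) ^+ k)); last first.
  by rewrite ler_wpM2l// mulr_ge0 ?sqr_ge0// mulr_ge0 ?exprn_ge0.
have kn : k%:R != 0 :> R by rewrite pnatr_eq0.
apply: le_of_eq.
rewrite exprMn [k%:R^-1 ^+ k]exprVn.
have -> : t^-1 ^+ k = t^-1 ^+ size p * t^-1 ^+ 2 by rewrite -exprD addn2.
have : k%:R ^+ k != 0 :> R by rewrite expf_neq0.
move: (t^-1 ^+ size p) (k%:R ^+ k) => a b b0; field.
by rewrite b0 gt_eqF.
Qed.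

(** The derivative of p(1/t) exp(-1/t) is t^(-2) (p - p')(1/t) exp(-1/t). *)
Definition flatD p := 'X^2 * (p - p^`()).

Lemma flat_derive p t : is_derive t (1 : R) (flat p) (flat (flatD p) t).
Proof.
have [t0|t0|->] := ltrgt0P t.
- have D : is_derive t (1 : R) (fun s : R => p.[s^-1] * expR (- s^-1)) (flat (flatD p) t).
    have tn : t != 0 by rewrite gt_eqF.
    have dV : is_derive t (1 : R) (fun s : R => s^-1) (- t ^- 2).
      have di : derivable (fun s : R => s) t 1 by exact: derivable_id.
      apply: DeriveDef; first exact: derivableV.
      by rewrite (deriveV tn di) derive_id scaler1.
    have dp : is_derive (t^-1) (1 : R) (horner p) (p^`()).[t^-1] by exact: is_derive_poly.
    have d1 := @is_derive1_comp R (horner p) (fun s : R => s^-1) t _ _ dp dV.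
    have dN : is_derive t (1 : R) (fun s : R => - s^-1) (t ^- 2).
      have := is_deriveN dV; by rewrite opprK.
    have d2 := @is_derive1_comp R expR (fun s : R => - s^-1) t _ _ (is_derive_expR _) dN.
    have d3 := is_deriveM d1 d2.
    apply: is_derive_eq d3 _.
    rewrite /flat t0 /flatD !hornerE /=.
    rewrite /GRing.scale/= exprVn; ring.
  apply: near_eq_is_derive D.
  have : \forall s \near t, 0 < s by exact: (@cvgr_gt R R (nbhs t) _ id t (@cvg_id _ _) 0 t0).
  by apply: filterS => s s0; rewrite /flat s0.
- have -> : flat (flatD p) t = 0 by rewrite /flat ltNge (ltW t0).
  apply: (@near_eq_is_derive _ _ _ (cst 0)).
  have : \forall s \near t, s < 0 by exact: (@cvgr_lt R R (nbhs t) _ id t (@cvg_id _ _) 0 t0).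
  by apply: filterS => s s0; rewrite /flat ltNge (ltW s0).
- have [A A0 hA] := flat_bound p.
  have f0 q : flat q 0 = 0 by rewrite /flat ltxx.
  rewrite f0.
  have H : (h^-1 *: ((flat p \o shift 0) (h *: (1 : R)) - flat p 0)) @[h --> 0^'] --> (0 : R).
    apply/cvgr0Pnorm_le => e e0.
    have : \forall h \near (0 : R)^', `|h| <= Num.min 1 (e / (A + 1)) /\ h != 0.
      have m0 : 0 < Num.min 1 (e / (A + 1)).
        by rewrite lt_min ltr01 divr_gt0// ltr_wpDl.
      near=> h; split; last by near: h; exact: nbhs_dnbhs_neq.
      near: h; apply: dnbhs0_le => //.
    apply: filterS => h [hm hn]; rewrite /= addr0 f0 subr0 /GRing.scale/= mulr1.
    move: hm; rewrite le_min => /andP[h1 h2].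
    rewrite normrM normfV ler_pdivrMl ?normr_gt0//.
    apply: le_trans (hA _ h1) _; rewrite -(real_normK (num_real h)) expr2 mulrCA ler_wpM2l//.
    apply: (@le_trans _ _ ((A + 1) * (e / (A + 1)))); last first.
      by rewrite mulrC divfK// gt_eqF// ltr_wpDl.
    by rewrite ler_pM// lerDl.
  apply: DeriveDef; first by apply: cvgP; exact: H.
  by apply: cvg_lim => //; exact: H.
Unshelve. all: by end_near. Qed.

Lemma derive1n_flat n p : derive1n n (flat p) = flat (iter n flatD p).
Proof.
elim: n => [//|n IH]; rewrite /derive1n /= -/(derive1n n _) IH.
apply/funext => t; rewrite derive1E.
by have [_ ->] := flat_derive (iter n flatD p) t.
Qed.

Lemma flat_smooth1 p : smooth1 (flat p).
Proof.
move=> n; rewrite derive1n_flat; set q := iter _ _ _.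
have d t : derivable (flat q) t 1 by case: (flat_derive q t).
split=> // t; apply: differentiable_continuous; exact/derivable1_diffP.
Qed.

Definition bump t := flat 1 t.

Lemma bump_gt0 t : 0 < t -> 0 < bump t.
Proof. by move=> t0; rewrite /bump /flat t0 hornerC mul1r expR_gt0. Qed.
Lemma bump_eq0 t : t <= 0 -> bump t = 0.
Proof. by move=> t0; rewrite /bump /flat ltNge t0. Qed.
Lemma bump_ge0 t : 0 <= bump t.
Proof. by have [t0|t0] := leP t 0; [rewrite bump_eq0|rewrite ltW// bump_gt0]. Qed.
Lemma bump_smooth1 : smooth1 bump. Proof. exact: flat_smooth1. Qed.

End FlatFunction.

(** * Smooth functions of one variable and their integrals *)

Section OneVariable.
Variable R : realType.
Local Notation mu := (@lebesgue_measure R).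
Implicit Types f g : R -> R.

Lemma smooth1_derivable f : smooth1 f -> forall t, derivable f t 1.
Proof. by move=> h t; case: (h 0%N). Qed.
Lemma derivable_cont f : (forall t, derivable f t 1) -> continuous f.
Proof. by move=> d t; apply: differentiable_continuous; exact/derivable1_diffP. Qed.

(** The bridge through which the closure properties in several variables, and the convergence of
    Riemann sums, are inherited in one variable. *)
Lemma smooth1P f : smooth1 f <-> smooth (fun x : 'rV[R]_1 => f (x 0 0)).
Proof.
split=> [sf|sF n]; first exact: (smooth_comp sf (smooth_coord R 0)).
have line t : (t *: ev R 0 + 0 : 'rV[R]_1) 0 0 = t by rewrite !mxE mulr1 addr0.
have D g t : smooth (fun x : 'rV[R]_1 => g (x 0 0)) ->
    is_derive t (1 : R) g (pd 0 (fun x : 'rV[R]_1 => g (x 0 0)) (t *: ev R 0 + 0)).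
  move=> sg; have := slice_derive (smooth_derivable sg 0 (t *: ev R 0 + 0)).
  by under eq_fun do rewrite line.
elim: n f sF => [|n IH] f sF.
  have d t : derivable f t 1 by case: (D f t sF).
  by split=> //; exact: derivable_cont.
rewrite /derive1n iterSr; apply: IH.
have -> : (fun x : 'rV[R]_1 => derive1 f (x 0 0)) = pd 0 (fun x : 'rV[R]_1 => f (x 0 0)).
  apply/funext => x; have [_] := D f (x 0 0) sF; rewrite -derive1E => ->; congr (pd _ _ _).
  by apply/rowP => i; rewrite !mxE ord1 mulr1 addr0.
exact: smooth_pd.
Qed.

Lemma smooth1_add f g : smooth1 f -> smooth1 g -> smooth1 (fun t => f t + g t).
Proof. by move=> /smooth1P sf /smooth1P sg; apply/smooth1P; exact: smooth_add. Qed.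
Lemma smooth1_mul f g : smooth1 f -> smooth1 g -> smooth1 (fun t => f t * g t).
Proof. by move=> /smooth1P sf /smooth1P sg; apply/smooth1P; exact: smooth_mul. Qed.
Lemma smooth1_cst (c : R) : smooth1 (fun _ : R => c).
Proof. by apply/smooth1P; exact: smooth_cst. Qed.
Lemma smooth1_id : smooth1 (fun t : R => t).
Proof. by apply/smooth1P; exact: smooth_coord. Qed.
Lemma smooth1_affine f (a b : R) : smooth1 f -> smooth1 (fun t => f (a * t + b)).
Proof.
move=> /smooth1P sf; apply/smooth1P; have := smooth_affine a (const_mx b) sf.
by under eq_fun do rewrite !mxE.
Qed.

Lemma smooth1_exp n : smooth1 (fun t : R => t ^+ n).
Proof.
elim: n => [|n IH]; first by under eq_fun do rewrite expr0; exact: smooth1_cst.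
by under eq_fun do rewrite exprS; apply: smooth1_mul => //; exact: smooth1_id.
Qed.

Lemma compact_supp1_mul f g : compact_supp1 f -> compact_supp1 (fun t => g t * f t).
Proof. by move=> [r hr]; exists r => t rt; rewrite hr// mulr0. Qed.

Lemma smooth1_test f : smooth1 f -> compact_supp1 f -> test (fun x : 'rV[R]_1 => f (x 0 0)).
Proof.
move=> sf [r hr]; split; first exact/smooth1P.
exists r => x rx; apply/hr/(lt_le_trans rx)/norm_le_coord => // i.
by rewrite ord1.
Qed.

Lemma smooth1_riem f : smooth1 f -> compact_supp1 f ->
  exists M, riem (fun x : 'rV[R]_1 => f (x 0 0)) M.
Proof.
move=> sf cf; have t := smooth1_test sf cf.
pose F (x : 'rV[R]_1) : R[i] := (f (x 0 0))%:C.
have tF : ctest F.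
  split => //=; split; last by exists 0.
  exact: smooth_cst.
have [M _ hM] := cschwartz_bound 1 2 (ctest_schwartz tF).
have [B B0 hB] := cdbound_criem hM; have [h1 _] := criem_riem B0 hB.
by exists B.
Qed.

Lemma iint1 f : iint (fun x : 'rV[R]_1 => f (x 0 0)) = int1 f.
Proof.
rewrite /=; congr int1; apply/funext => t; congr f.
have E := @row_mxEl R 1 1 0 (const_mx t) (0 : 'rV[R]_0) 0 0.
rewrite [RHS]mxE in E; rewrite -[RHS]E; congr (fun_of_matrix _ _ _); exact: val_inj.
Qed.

(** Riemann sums of the dilated function with mesh h use the same values of [f] as those of [f] with
    mesh h/2; only the factor 2 differs. *)
Lemma int1_scale2 f : smooth1 f -> compact_supp1 f ->
  int1 (fun t => f (2^-1 * t)) = 2 * int1 f.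
Proof.
move=> sf cf; have [M hM] := smooth1_riem sf cf.
have sf2 : smooth1 (fun t => f (2^-1 * t)).
  by have := smooth1_affine 2^-1 0 sf; under eq_fun do rewrite addr0.
have cf2 : compact_supp1 (fun t => f (2^-1 * t)).
  have [r hr] := cf; exists (2 * r) => t rt; apply: hr.
  by rewrite normrM ger0_norm ?invr_ge0// ltr_pdivlMl.
have [M2 hM2] := smooth1_riem sf2 cf2.
have g1 : 1 <= 1 :> R by []. have g2 : 1 <= 2 :> R by rewrite ler1n.
have c1 := rsum_cvg (hsg_gt0 g2) (hsg_le1 g2) (fun e e0 => hs_small g2 e0) (fun T => hs_nus T g2) hM.
have c2 := rsum_cvg (hsg_gt0 g1) (hsg_le1 g1) (fun e e0 => hs_small g1 e0) (fun T => hs_nus T g1) hM2.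
rewrite -(iint1 f) -(iint1 (fun t => f (2^-1 * t))).
have E : (fun k => rsum (nus k) (hs R k / 1) (fun x : 'rV[R]_1 => f (2^-1 * x 0 0))) =
    (fun k => 2 * rsum (nus k) (hs R k / 2) (fun x : 'rV[R]_1 => f (x 0 0))).
  apply/funext => k; rewrite /rsum divr1 !expr1 mulrA [2 * (_ / 2)]mulrC divfK//.
  congr (_ * _); apply: eq_bigr => J _; rewrite !mxE /gpt; congr f; ring.
rewrite E in c2.
have c3 : 2 * rsum (nus k) (hs R k / 2) (fun x : 'rV[R]_1 => f (x 0 0)) @[k --> \oo] -->
    2 * iint (fun x : 'rV[R]_1 => f (x 0 0)) by apply: cvgM => //; exact: cvg_cst.
exact: (cvg_unique _ c2 c3).
Qed.

Lemma cpt_integrable f : smooth1 f -> compact_supp1 f -> mu.-integrable setT (EFin \o f).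
Proof.
move=> sf cf; have [M [h _]] := smooth1_riem sf cf.
have cf' : continuous f by apply: derivable_cont; exact: smooth1_derivable.
have mf : measurable_fun setT f by exact: continuous_measurable_fun.
have iM : mu.-integrable setT (EFin \o (fun t => M * omega t)).
  have -> : EFin \o (fun t => M * omega t) = (fun t => (M%:E * (EFin \o (@omega R)) t)%E) by [].
  by apply: integrableZl => //; exact: integrable_omega.
apply: (le_integrable _ _ _ iM) => //; first exact/measurable_EFinP.
move=> t _ /=; rewrite lee_fin.
have := h (const_mx t); rewrite mxE /Omega big_ord1 mxE => h1.
by apply: le_trans h1 _; exact: ler_norm.
Qed.

End OneVariable.

Arguments smooth1_derivable {R f} _ t.

(** * Supports under scaling and kernels with vanishing moments *)

Section TestKernels.
Variable R : realType.
Implicit Types f phi : R -> R.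

Definition absupp f : set R := [set `|t| | t in [set t | f t != 0]].

Lemma absupp_sup f : compact_supp1 f -> absupp f !=set0 -> has_sup (absupp f).
Proof.
move=> [r hr] ne; split => //; exists r => _ [t /= ft <-].
by rewrite leNgt; apply/negP => rt; move: ft; rewrite hr// eqxx.
Qed.

Lemma absupp_scale (eps : R) f : 0 < eps -> absupp f !=set0 -> absupp (scale1 eps f) !=set0.
Proof.
move=> e0 [_ [t /= ft _]]; exists `|eps * t|; exists (eps * t) => //=.
have -> : scale1 eps f (eps * t) = eps^-1 * f t.
  by rewrite /scale1; congr (_ * f _); rewrite mulrAC divff ?gt_eqF// mul1r.
by rewrite mulf_neq0// invr_neq0// gt_eqF.
Qed.

Lemma lsupp_scale_le (eps : R) f : 0 < eps -> compact_supp1 f -> absupp f !=set0 ->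
  lsupp (scale1 eps f) <= eps * lsupp f.
Proof.
move=> e0 cf ne; have hs := absupp_sup cf ne.
have ne' := absupp_scale e0 ne.
apply: ge_sup => // _ [t /= ft <-].
have -> : `|t| = eps * `|t / eps|.
  by rewrite normrM normfV (ger0_norm (ltW e0)) mulrC divfK// gt_eqF.
rewrite ler_pM2l//; apply: ub_le_sup; first by case: hs.
exists (t / eps) => //=.
by move: ft; rewrite /scale1 mulf_eq0 negb_or => /andP[].
Qed.

Lemma scale1K (eps : R) f : 0 < eps -> scale1 eps^-1 (scale1 eps f) = f.
Proof.
move=> e0; apply/funext => t; rewrite /scale1 invrK mulrA divff ?gt_eqF// mul1r.
by rewrite mulfK// gt_eqF.
Qed.

Lemma lsupp_scale (eps : R) f : 0 < eps -> compact_supp1 f -> absupp f !=set0 ->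
  lsupp (scale1 eps f) = eps * lsupp f.
Proof.
move=> e0 cf ne; apply/eqP; rewrite eq_le lsupp_scale_le//=.
have cf' : compact_supp1 (scale1 eps f).
  have [r hr] := cf; exists (eps * r) => t rt; rewrite /scale1 hr ?mulr0//.
  by rewrite normrM normfV (ger0_norm (ltW e0)) ltr_pdivlMr// mulrC.
have ne' := absupp_scale e0 ne.
have e0' : 0 < eps^-1 by rewrite invr_gt0.
have := lsupp_scale_le e0' cf' ne'; rewrite scale1K//.
by rewrite ler_pdivlMl.
Qed.

Lemma int1_eq0 f : (forall t, f t = 0) -> int1 f = 0.
Proof.
move=> h; have -> : f = cst 0 by apply/funext.
by rewrite /int1 /Rintegral integral0.
Qed.

(** A nonzero integral gives a point where [phi] is nonzero; if it is the origin, continuity gives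
    another. Positivity of the support radius allows eps to be recovered from eps times the
    radius. *)
Lemma kernel_absupp q phi : Aq q phi -> absupp phi !=set0 /\ 0 < lsupp phi.
Proof.
move=> [sphi cphi i1 _].
have [t ft] : exists t, phi t != 0.
  apply: contrapT => h; have z : forall t, phi t = 0.
    by move=> t; apply: contrapT => /eqP ft; apply: h; exists t.
  by move: i1; rewrite int1_eq0// => /eqP; rewrite eq_sym oner_eq0.
have ne : absupp phi !=set0 by exists `|t|; exists t.
split => //.
have [s s0 fs] : exists2 s, s != 0 & phi s != 0.
  have [t0|t0] := eqVneq t 0; last by exists t.
  rewrite t0 in ft; have [c0 _] := sphi 0%N; have c := c0 (0 : R).
  have ft' : 0 < `|phi 0| by rewrite normr_gt0.
  have /cvgrPdist_lt/(_ _ ft')[e /= e0 he] : phi s @[s --> 0] --> phi 0 by exact: c.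
  exists (e / 2); first by rewrite gt_eqF// divr_gt0.
  have : `|phi 0 - phi (e / 2)| < `|phi 0|.
    by apply: he; rewrite /ball_/= sub0r normrN gtr0_norm ?divr_gt0// ltr_pdivrMr// ltr_pMr// ltr1n.
  apply: contraTN => /eqP ->; by rewrite subr0 ltxx.
apply: (@lt_le_trans _ _ `|s|); first by rewrite normr_gt0.
by apply: ub_le_sup; [case: (absupp_sup cphi ne)|exists s].
Qed.

Lemma kernel_base : exists phi : R -> R, Aq 0 phi.
Proof.
pose b t : R := bump (1 * t + 1) * bump (-1 * t + 1).
have sb : smooth1 b.
  by apply: smooth1_mul; apply: smooth1_affine; exact: bump_smooth1.
have cb : compact_supp1 b.
  exists 1 => t t1; rewrite /b mul1r mulN1r.
  move: t1; rewrite ltr_normr => /orP[h|h].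
    by rewrite [X in _ * X]bump_eq0 ?mulr0//; lra.
  by rewrite [X in X * _]bump_eq0 ?mul0r//; lra.
have bE u : 1 / 2 <= u -> expR (- 2) <= bump u :> R.
  move=> hu; have u0 : 0 < u by lra.
  rewrite /bump /flat u0 hornerC mul1r ler_expR lerN2.
  by rewrite invf_ple ?posrE// ; lra.
(* On [-1/2, 1/2) both arguments of the bump factors are at least 1/2, so [b] dominates a positive
   step function. *)
have i0 : 0 < int1 b.
  pose c (j : 'I_1) : R := expR (-2) * expR (-2).
  pose st (t : R) : R := \sum_(j < 1) c j * \1_(`[(- (1 / 2)), (- (1 / 2) + 1)[%classic) t.
  have ist : int1 st = expR (-2) * expR (-2).
    by rewrite /st int1_step// big_ord1 mul1r.
  apply: (@lt_le_trans _ _ (int1 st)); first by rewrite ist mulr_gt0// expR_gt0.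
  apply: le_Rintegral => //.
  - have -> : EFin \o st = (fun t => ((expR (-2) * expR (-2))%:E * (EFin \o \1_(`[(- (1 / 2))%R, (- (1 / 2) + 1)%R[%classic)) t)%E).
      by apply/funext => t; rewrite /= /st big_ord1.
    by apply: integrableZl => //; exact: integrable_indic_itv.
  - exact: cpt_integrable.
  - move=> t _; rewrite /st big_ord1 indicE.
    have b0 : 0 <= b t by rewrite mulr_ge0// bump_ge0.
    have [|] := boolP (t \in _); last by rewrite mulr0.
    rewrite inE/= in_itv/= => /andP[t1 t2]; rewrite mulr1.
    by apply: ler_pM; rewrite ?expR_ge0// bE//; lra.
exists (fun t => (int1 b)^-1 * b t); split.
- exact: smooth1_mul (smooth1_cst _) sb.
- exact: compact_supp1_mul.
- rewrite /int1 RintegralZl//; last exact: cpt_integrable.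
  by rewrite -/(int1 b) mulVf// gt_eqF.
- by case.
Qed.

Lemma int1_lin f g (a b : R) : smooth1 f -> compact_supp1 f -> smooth1 g -> compact_supp1 g ->
  int1 (fun t => a * f t + b * g t) = a * int1 f + b * int1 g.
Proof.
move=> sf cf sg cg.
have sa := smooth1_mul (smooth1_cst a) sf; have sb := smooth1_mul (smooth1_cst b) sg.
have ca := compact_supp1_mul (fun _ => a) cf; have cb := compact_supp1_mul (fun _ => b) cg.
rewrite /int1 RintegralD//; try exact: cpt_integrable.
by congr (_ + _); rewrite RintegralZl//; exact: cpt_integrable.
Qed.

(* [a phi(t) + (b/2) phi(t/2)] multiplies the j-th moment by [a + b 2^j]. *)
Lemma kernel_exists q : exists phi : R -> R, Aq q phi.
Proof.
elim: q => [|q [phi [sp cp i1 mom]]]; first exact: kernel_base.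
pose c : R := 2 ^+ q.+1.
have c1 : 1 < c by rewrite exprn_egt1// ltr1n.
have cn : c - 1 != 0 by rewrite gt_eqF// subr_gt0.
(* The solution of a + b = 1 and a + b c = 0: the integral is kept, the moment of order q + 1 is
   cancelled, and the lower ones stay zero. *)
pose a : R := c / (c - 1); pose b : R := - (c - 1)^-1.
pose phi2 t := phi (2^-1 * t).
have sp2 : smooth1 phi2.
  by have := smooth1_affine 2^-1 0 sp; under eq_fun do rewrite addr0.
have cp2 : compact_supp1 phi2.
  have [r hr] := cp; exists (2 * r) => t rt; apply: hr.
  by rewrite normrM ger0_norm ?invr_ge0// ltr_pdivlMl.
have M j : int1 (fun t => t ^+ j * (a * phi t + b / 2 * phi2 t)) =
    (a + b * 2 ^+ j) * int1 (fun t => t ^+ j * phi t).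
  have sj := smooth1_mul (smooth1_exp R j) sp.
  have cj := compact_supp1_mul (fun t : R => t ^+ j) cp.
  have sj2 : smooth1 (fun t => (2^-1 * t) ^+ j * phi (2^-1 * t)).
    by have := smooth1_affine 2^-1 0 sj; under eq_fun do rewrite addr0.
  have cj2 := compact_supp1_mul (fun t : R => (2^-1 * t) ^+ j) cp2.
  have -> : (fun t => t ^+ j * (a * phi t + b / 2 * phi2 t)) =
     (fun t => a * (t ^+ j * phi t) + (b / 2 * 2 ^+ j) * ((2^-1 * t) ^+ j * phi (2^-1 * t))).
    apply/funext => t; rewrite exprMn exprVn /phi2.
    have : 2 ^+ j != 0 :> R by rewrite expf_neq0.
    by move: (2 ^+ j) => d d0; field.
  rewrite (int1_lin a (b / 2 * 2 ^+ j) sj cj sj2 cj2).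
  have := int1_scale2 sj cj => ->.
  by field.
exists (fun t => a * phi t + b / 2 * phi2 t); split.
- exact: smooth1_add (smooth1_mul (smooth1_cst a) sp) (smooth1_mul (smooth1_cst (b / 2)) sp2).
- have [r hr] := cp; have [r2 hr2] := cp2; exists (Num.max r r2) => t.
  by rewrite gt_max => /andP[h1 h2]; rewrite hr// hr2// !mulr0 addr0.
- have := M 0%N; under eq_fun do rewrite expr0 mul1r.
  move=> ->; under eq_fun do rewrite expr0 mul1r.
  by rewrite i1 expr0 /a /b; field.
- move=> j /andP[j1 jq]; rewrite M.
  move: jq; rewrite leq_eqVlt => /orP[/eqP ->|jq].
    suff -> : a + b * 2 ^+ q.+1 = 0 by rewrite mul0r.
    by rewrite -/c /a /b mulNr mulrC subrr.
  by rewrite mom ?mulr0// j1.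
Qed.

End TestKernels.

(** * Comparison of the wave front sets *)

Section Cones.
Variables (R : realType) (m : nat).
Local Notation V := 'rV[R]_m.
Local Notation C := R[i].

Lemma norm_le_enorm (x : V) : `|x| <= enorm x.
Proof.
apply: norm_le_coord; first exact: sqrtr_ge0.
move=> i; rewrite -sqrtr_sqr ler_sqrt; last by apply: sumr_ge0 => j _; rewrite -expr2 sqr_ge0.
by rewrite /dot (bigD1 i)//= -expr2 lerDl sumr_ge0// => j _; rewrite -expr2 sqr_ge0.
Qed.

Lemma enorm_le_norm (x : V) : enorm x <= m.+1%:R * `|x|.
Proof.
rewrite -[leRHS]ger0_norm ?mulr_ge0// -sqrtr_sqr ler_sqrt ?sqr_ge0//.
apply: (@le_trans _ _ (\sum_(i < m) `|x| ^+ 2)).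
  apply: ler_sum => i _; rewrite -expr2 -real_normK ?num_real// lerXn2r ?nnegrE//.
  exact: coord_le_norm.
rewrite sumr_const card_ord exprMn -[leLHS]mulr_natl ler_wpM2r ?sqr_ge0//.
rewrite -natrX ler_nat; exact: leq_trans (leqnSn m) (leq_pmulr _ _).
Qed.

Lemma onenX_le_enorm k (x : V) : (1 + `|x|) ^+ k <= (1 + enorm x) ^+ k.
Proof. by rewrite lerXn2r ?nnegrE ?addr_ge0 ?sqrtr_ge0// lerD2l norm_le_enorm. Qed.

Lemma enormX_le_onen k (x : V) : (1 + enorm x) ^+ k <= m.+1%:R ^+ k * (1 + `|x|) ^+ k.
Proof.
rewrite -exprMn lerXn2r ?nnegrE ?mulr_ge0 ?addr_ge0 ?sqrtr_ge0// mulrDr mulr1.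
by rewrite lerD ?enorm_le_norm// ler1n.
Qed.

(** [G'] is the cone over a ball of half the radius. If t xi lies in that ball, then t |xi| <= |xi0|
    + e, so the choice of [c] gives |t ze| <= e, and t (xi - ze) stays in the full ball. *)
Lemma cone_shrink (G : set V) (xi0 : V) : open_cone_nbhd G xi0 ->
  exists G' c, [/\ open_cone_nbhd G' xi0, 0 < c &
    forall xi ze, G' xi -> `|ze| <= c * `|xi| -> G (xi - ze)].
Proof.
move=> [oG G0 cG].
have /nbhs_normP[rho /= rho0 hrho] : nbhs xi0 G by exact: open_nbhs_nbhs.
pose e := rho / 2; have e0 : 0 < e by rewrite divr_gt0.
pose G' := \bigcup_(t in [set t : R | 0 < t]) [set xi : V | `|t *: xi + - xi0| < e].
pose c := e / (`|xi0| + e).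
have d0 : 0 < `|xi0| + e by rewrite ltr_wpDl.
exists G', c; split; last 2 first.
- by rewrite divr_gt0.
- move=> xi ze [t /= t0 ht] hze.
  have tx : t * `|xi| <= `|xi0| + e.
    rewrite -{1}(ger0_norm (ltW t0)) -normrZ -[t *: xi](subrK xi0) addrC.
    by apply: le_trans (ler_normD _ _) _; rewrite lerD2l ltW.
  have : G (t *: (xi - ze)).
    apply: hrho; rewrite /= /ball_/= distrC scalerBr addrAC.
    apply: le_lt_trans (ler_normB _ _) _.
    have -> : rho = e + e by rewrite /e -splitr.
    rewrite ltr_leD// normrZ (ger0_norm (ltW t0)).
    apply: (@le_trans _ _ (c * (t * `|xi|))).
      by rewrite mulrCA ler_wpM2l// ltW.
    apply: (@le_trans _ _ (c * (`|xi0| + e))).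
      by rewrite ler_wpM2l// divr_ge0 ?(ltW e0) ?(ltW d0).
    by rewrite /c divfK// gt_eqF.
  move=> h; have t0' : 0 < t^-1 by rewrite invr_gt0.
  have := cG _ _ h t0'.
  by rewrite scalerA mulVf ?gt_eqF// scale1r.
split.
- apply: bigcup_open => t _.
  have cf : continuous (fun xi : V => `|t *: xi + - xi0|).
    apply: (continuous_circ (@norm_continuous R V)); exact: continuous_affine.
  have := open_comp (fun x _ => cf x) (@open_lt R e).
  by congr open.
- by exists 1 => //=; rewrite scale1r subrr normr0.
- move=> xi t [s /= s0 hs] t0; exists (s / t) => /=; first by rewrite divr_gt0.
  by rewrite scalerA divfK ?gt_eqF.
Qed.

(** The ambient norm is the sup norm, which is not smooth; cutoffs are built from the squared
    Euclidean distance instead. *)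
Definition sqdist (x0 x : V) : R := \sum_i (x 0 i - x0 0 i) ^+ 2.

Lemma smooth_sqdist x0 : smooth (sqdist x0).
Proof.
apply: smooth_sum => i.
have s : smooth (fun x : V => x 0 i - x0 0 i).
  by apply: smooth_add; [exact: smooth_coord|exact: smooth_cst].
by have := smooth_mul s s; under eq_fun do rewrite -expr2.
Qed.

Lemma norm_sub_le (d : R) x0 x : 0 <= d -> sqdist x0 x <= d ^+ 2 -> `|x - x0| <= d.
Proof.
move=> d0 h; apply: norm_le_coord => // i; rewrite !mxE.
rewrite -(@ler_pXn2r _ 2)// ?nnegrE// real_normK ?num_real//.
apply: le_trans h; rewrite /sqdist (bigD1 i)//= lerDl sumr_ge0// => j _; exact: sqr_ge0.
Qed.

Lemma sqdist_trans x0 x z : sqdist x0 x <= 2 * sqdist x0 (x + z) + 2 * m%:R * `|z| ^+ 2.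
Proof.
have -> : 2 * m%:R * `|z| ^+ 2 = 2 * \sum_(i < m) `|z| ^+ 2.
  by rewrite -mulrA sumr_const card_ord; congr (_ * _); rewrite mulr_natl.
rewrite /sqdist -mulrDr -big_split/= mulr_sumr; apply: ler_sum => i _.
rewrite !mxE.
have h : (z 0 i) ^+ 2 <= `|z| ^+ 2.
  by rewrite -real_normK ?num_real// lerXn2r ?nnegrE// coord_le_norm.
have := sqr_ge0 (x 0 i - x0 0 i + 2 * z 0 i); nra.
Qed.

(* Division by [psi] near [x0]: [beta] below vanishes near [x0] and keeps
   [|psi|^2 + beta] positive everywhere. *)
Lemma localization (psi : V -> C) (x0 : V) : ctest psi -> psi x0 != 0 ->
  exists (psi' : V -> C) (kappa : V -> V -> C) (d r : R),
  [/\ ctest psi', psi' x0 != 0, 0 < d, (forall z, ctest (kappa z)) &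
   [/\ forall z x, `|z| <= d -> kappa z x * psi x = psi' (x + z),
    forall z x, `|z| <= d -> r < `|x| -> kappa z x = 0 &
    forall n N, exists M, forall z, `|z| <= d -> cdbound n (kappa z) (fun x => M * wt N x)]].
Proof.
move=> tpsi px0; have /ctestP[[sr si] [r hr]] := tpsi.
pose a (x : V) := cRe (psi x) ^+ 2 + cIm (psi x) ^+ 2.
have sa : smooth a.
  have := smooth_add (smooth_mul sr sr) (smooth_mul si si).
  by under eq_fun do rewrite -!expr2.
have a0 : 0 < a x0.
  have : cabs (psi x0) != 0.
    apply: contraNneq px0 => h; rewrite -normr_eq0 -cabsE h//.
  rewrite /cabs sqrtr_eq0 -ltNge//.
have a_ge0 x : 0 <= a x by rewrite addr_ge0 ?sqr_ge0.
have /nbhs_normP[e /= e0 he] : nbhs x0 [set x | 0 < a x].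
  have ca : continuous a := smooth_continuous sa.
  exact: (cvgr_gt (a x0) (ca x0) 0 a0).
pose d1 := e / 2; have d10 : 0 < d1 by rewrite divr_gt0.
pose beta x : R := bump (sqdist x0 x - d1 ^+ 2).
have sbeta : smooth beta.
  apply: (smooth_comp (bump_smooth1 R)); apply: smooth_add; first exact: smooth_sqdist.
  exact: smooth_cst.
have pos x : 0 < a x + beta x.
  have [h|h] := leP (sqdist x0 x) (d1 ^+ 2); last first.
    by rewrite ltr_wpDl// bump_gt0// subr_gt0.
  rewrite ltr_pwDl ?bump_ge0//; apply: he; rewrite /= /ball_/= distrC.
  apply: le_lt_trans (norm_sub_le (ltW d10) h) _.
  by rewrite /d1 ltr_pdivrMr// ltr_pMr// ltr1n.
pose q x : R := (a x + beta x)^-1.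
have sq : smooth q.
  by apply: smooth_inv; [exact: smooth_add|move=> x; rewrite gt_eqF].
(* The conjugate of psi divided by |psi|^2 + beta: smooth with compact support, and equal to 1/psi
   wherever [beta] vanishes. *)
pose rho x : C := (cRe (psi x) * q x) +i* (- cIm (psi x) * q x).
have trho : ctest rho.
  apply/ctestP; split.
    by split; [exact: smooth_mul sr sq|exact: smooth_mul (smooth_opp si) sq].
  by exists r => x rx; rewrite /rho hr//= oppr0 !mul0r.
pose psi' x : C := (bump (d1 ^+ 2 / 4 - sqdist x0 x))%:C.
have tpsi' : ctest psi'.
  apply/ctestP; split.
    split; last exact: smooth_cst.
    apply: (smooth_comp (bump_smooth1 R)); apply: smooth_add; first exact: smooth_cst.
    by apply: smooth_opp; exact: smooth_sqdist.
  exists (`|x0| + d1) => x hx; rewrite /psi' bump_eq0// subr_le0.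
  rewrite leNgt; apply/negP => h.
  have : `|x - x0| <= d1.
    apply: norm_sub_le; first exact: ltW.
    by apply: le_trans (ltW h) _; rewrite ler_pdivrMr// ler_peMr ?sqr_ge0// ler1n.
  move: hx; rewrite ltNge -{1}(subrK x0 x) => /negP hx h1; apply: hx.
  by apply: le_trans (ler_normD _ _) _; rewrite addrC lerD2l.
(* This gives m |z|^2 <= d1^2/4 for |z| <= d. If x + z is in the support of psi', then [sqdist x0 x]
   is at most 2 d1^2/4 + 2 d1^2/4 = d1^2, where [beta] is zero. *)
pose d := d1 / (2 * m.+1%:R).
have d0 : 0 < d by rewrite divr_gt0.
exists psi', (fun z x => psi' (x + z) * rho x), d, r; split; [exact: tpsi'| |exact: d0| |].
- rewrite /psi' /sqdist big1; last by move=> i _; rewrite subrr expr0n.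
  rewrite subr0 eq_complex /= eqxx andbT gt_eqF// bump_gt0// divr_gt0// exprn_gt0//.
- move=> z; apply: ctest_mul (ctest_trans z tpsi'); by have /ctestP[] := trho.
split.
- move=> z x hz; rewrite -mulrA /psi'.
  have [h|h] := leP (sqdist x0 (x + z)) (d1 ^+ 2 / 4); last first.
    by rewrite bump_eq0 ?mul0r// subr_le0 ltW.
  have sx : sqdist x0 x <= d1 ^+ 2.
    apply: le_trans (sqdist_trans x0 x z) _.
    have hd : m%:R * `|z| ^+ 2 <= d1 ^+ 2 / 4.
      apply: (@le_trans _ _ (m.+1%:R ^+ 2 * d ^+ 2)); last first.
        apply: le_of_eq; rewrite -exprMn /d.
        by field; rewrite ?natr1 ?nat1r pnatr_eq0.
      rewrite ler_pM ?sqr_ge0//; last by rewrite lerXn2r ?nnegrE// ltW.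
      rewrite -natrX ler_nat; exact: leq_trans (leqnSn m) (leq_pmulr _ _).
    lra.
  have bx : beta x = 0 by rewrite /beta bump_eq0// subr_le0.
  suff -> : rho x * psi x = 1 by rewrite mulr1.
  have : a x * q x = 1 by rewrite /q bx addr0 divff// gt_eqF//; have := pos x; rewrite bx addr0.
  rewrite /rho /a; case: (psi x) => u v /= E; simpc.
  by apply/eqP; rewrite eq_complex/=; apply/andP; split; apply/eqP; [rewrite -E|]; ring.
- by move=> z x _ rx; rewrite /rho hr//= oppr0 !mul0r mulr0.
move=> n N; have [M1 M10 h1] := cschwartz_bound n 0 (ctest_schwartz tpsi').
have [M2 M20 h2] := cschwartz_bound n N (ctest_schwartz trho).
exists (2 ^+ n.+1 * (2 ^+ n * M1 * M2)) => z hz.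
apply: cdbound_le (cdbound_mul (cdbound_trans z h1) h2) => x.
by rewrite /wt expr0 invr1 mulr1 !mulrA.
Qed.

End Cones.

(** * The two inclusions *)

Section Comparison.
Variables (R : realType) (m : nat).
Local Notation V := 'rV[R]_m.
Local Notation C := R[i].
Variables (w : (V -> C) -> C) (gamma : R -> R) (chi : V -> C).
Hypotheses (hw : tempered w) (hgamma : admissible gamma) (hchi : cschwartz chi) (chi1 : cint chi = 1).

Lemma embedE phi0 : embed gamma chi w phi0 = mollify w chi (gamma (lsupp phi0)).
Proof. by []. Qed.

(** The scaling is continuous and unbounded near 0, so every value above [gamma r] is attained below
    [r]. Thus the scale can be adapted to the frequency. *)
Lemma gamma_hits (r T : R) : 0 < r < 1 -> gamma r <= T -> exists2 c, 0 < c <= r & gamma c = T.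
Proof.
move=> /andP[r0 r1] gT; have [cg _ _ ginf _] := hgamma.
have [d [d0 hd]] := ginf T.
pose r2 := Num.min d r / 2.
have m0 : 0 < Num.min d r by rewrite lt_min d0.
have r20 : 0 < r2 by rewrite divr_gt0.
have r2m : r2 < Num.min d r by rewrite ltr_pdivrMr// ltr_pMr// ltr1n.
have r2d : r2 < d by apply: lt_le_trans r2m _; rewrite ge_min lexx.
have r2r : r2 < r by apply: lt_le_trans r2m _; rewrite ge_min lexx orbT.
have g2 : T < gamma r2 by apply: hd; rewrite r20.
have cs : {within `[r2, r], continuous gamma}.
  apply: continuous_subspaceW cg => t /=; rewrite in_itv/= => /andP[a b].
  by rewrite (lt_le_trans r20 a) (le_lt_trans b r1).
have [|c] := @IVT R gamma r2 r T (ltW r2r) cs.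
  by rewrite ge_min gT orbT/= le_max (ltW g2).
rewrite in_itv/= => /andP[a b] <-; exists c => //.
by rewrite (lt_le_trans r20 a).
Qed.

(** The same cutoff and cone work. For each frequency, eps is chosen so that the scale equals T = (1
    + |xi|)^(P + k), measured in the Euclidean norm. *)
Lemma Sigma_of_SigmaG (psi : V -> C) (xi0 : V) : ctest psi ->
  not_in_SigmaG gamma (embed gamma chi w) psi xi0 -> not_in_Sigma w psi xi0.
Proof.
move=> tpsi [G [hG [N hN]]]; exists G; split => // k.
have [K1 [p1 [K10 h1]]] := mollify_FT_close hw hchi chi1 tpsi.
have [K2 [p2 [K20 h2]]] := distFT_bound hw tpsi.
pose P := (p1 + p2)%N.
(* The order of decay exceeds [k] by exactly the amount that cancels T^N on the right. In [P], [p1]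
   offsets the growth of the approximation error and [p2] the a priori growth of the transform. *)
have [M hM] := hN (N * (P + k) + k)%N.
have [phi0 aphi] := kernel_exists R M.
have [K [d [d0 hd]]] := hM _ aphi.
have [ne l0] := kernel_absupp aphi; set l := lsupp phi0 in l0 hd.
have [_ cphi _ _] := aphi.
(* Below 1, where [gamma] is continuous, and below d l, so that eps = c/l is smaller than [d] for
   every c <= r1. *)
pose r1 := Num.min 1 (d * l) / 2.
have m0 : 0 < Num.min 1 (d * l) by rewrite lt_min ltr01 mulr_gt0.
have r10 : 0 < r1 by rewrite divr_gt0.
have r1m : r1 < Num.min 1 (d * l) by rewrite ltr_pdivrMr// ltr_pMr// ltr1n.
have r11 : r1 < 1 by apply: lt_le_trans r1m _; rewrite ge_min lexx.
have r1d : r1 < d * l by apply: lt_le_trans r1m _; rewrite ge_min lexx orbT.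
exists (K2 * `|gamma r1| + (`|K| + K1)) => xi Gxi.
set u := cabs (distFT w psi xi); have u0 : 0 <= u by exact: cabs_ge0.
have en0 : 0 <= enorm xi by exact: sqrtr_ge0.
have en1 : 1 <= 1 + enorm xi by rewrite lerDl.
pose T := (1 + enorm xi) ^+ (P + k).
have T1 : 1 <= T by rewrite exprn_ege1.
have T0 : 0 < T by rewrite (lt_le_trans ltr01).
(* If T < gamma r1 the scale T need not be attained, but such frequencies are bounded and polynomial
   growth of the transform suffices. *)
have [gT|gT] := leP (gamma r1) T; last first.
  apply: (@le_trans _ _ (K2 * `|gamma r1|)); last by rewrite lerDl addr_ge0.
  apply: (@le_trans _ _ (K2 * T)); last by rewrite ler_wpM2l// (le_trans (ltW gT))// ler_norm.
  rewrite /T exprD mulrA [leRHS]mulrC ler_wpM2l ?exprn_ge0 ?addr_ge0//.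
  apply: le_trans (h2 xi) _; rewrite ler_wpM2l//.
  apply: le_trans (onenX_le_enorm _ _) _; by rewrite ler_weXn2l// leq_addl.
have r101 : 0 < r1 < 1 by rewrite r10.
have [c /andP[c0 cr] gc] := gamma_hits r101 gT.
have e0 : 0 < c / l by rewrite divr_gt0.
have ed : 0 < c / l < d by rewrite e0 ltr_pdivrMr// (le_lt_trans cr).
have := hd _ ed xi Gxi.
have el : c / l * l = c by rewrite divfK// gt_eqF.
rewrite embedE (lsupp_scale e0 cphi ne) -/l el gc.
set F := cFT _ _ => hF.
have hF' : (1 + enorm xi) ^+ k * cabs F <= `|K|.
  have TN : 0 < T ^+ N by rewrite exprn_gt0.
  rewrite -(ler_pM2l TN); apply: le_trans (_ : K * T ^+ N <= _); last first.
    by rewrite mulrC ler_wpM2l ?(ltW TN)// ler_norm.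
  by move: hF; rewrite exprD mulnC exprM -/T mulrA.
have hc := h1 T xi T1; rewrite -/F in hc.
have hd' : (1 + enorm xi) ^+ k * cabs (F - distFT w psi xi) <= K1.
  apply: (@le_trans _ _ ((1 + enorm xi) ^+ k * (K1 * (1 + `|xi|) ^+ p1 / T))).
    by rewrite ler_wpM2l ?exprn_ge0 ?addr_ge0.
  rewrite mulrA ler_pdivrMr// mulrCA ler_wpM2l// /T exprD mulrC.
  rewrite ler_wpM2r ?exprn_ge0 ?addr_ge0//.
  apply: le_trans (onenX_le_enorm _ _) _; by rewrite ler_weXn2l// leq_addr.
apply: (@le_trans _ _ (`|K| + K1)); last by rewrite lerDr mulr_ge0.
have uE : u <= cabs F + cabs (F - distFT w psi xi).
  rewrite /u; have {1}-> : distFT w psi xi = F - (F - distFT w psi xi) by rewrite subKr.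
  exact: cabsB.
apply: le_trans (_ : (1 + enorm xi) ^+ k * (cabs F + cabs (F - distFT w psi xi)) <= _).
  by rewrite ler_wpM2l ?exprn_ge0 ?addr_ge0.
by rewrite mulrDr lerD.
Qed.

Section ConeEstimate.
Variables (psi : V -> C) (d : R) (Gam : set V).
Hypotheses (tpsi : ctest psi) (d0 : 0 < d).
Hypothesis small : forall k, exists2 K, 0 <= K & forall z xi, `|z| <= d -> Gam xi ->
  (1 + `|xi|) ^+ k * cabs (w (fun x => psi (x + z) * wave xi x)) <= K.

(* For large scales the kernel is concentrated where the translated cutoffs are
   under control; the tail of [chi] gains arbitrary powers of [1 / g]. *)
Lemma mollify_FT_cone k : exists2 K, 0 <= K & forall g xi, 1 <= g -> 1 + `|xi| <= g ^+ 2 -> Gam xi ->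
  (1 + `|xi|) ^+ k * cabs (cFT (fun x => psi x * mollify w chi g x) xi) <= K.
Proof.
have [Kw [N [Kw0 hKw]]] := tempered_bound hw.
have [A A0 hA] := test_wave_bound N N tpsi.
have [Ks Ks0 hKs] := small k.
pose Q := ((N + k) + (N + k))%N.
have [M M0 hM] := cschwartz_bound 0 (m.*2 + (N + Q))%N hchi.
pose B0 := 2 * M * (Ks + Kw * (2 ^+ N * A) / d ^+ Q).
have dQ : 0 < d ^+ Q by rewrite exprn_gt0.
have B00 : 0 <= B0.
  by rewrite /B0 mulr_ge0 ?mulr_ge0// addr_ge0// divr_ge0 ?(ltW dQ)// !mulr_ge0// exprn_ge0.
exists (5 ^+ m * B0); first by rewrite mulr_ge0// exprn_ge0.
move=> g xi g1 gx Gx; have g0 : 0 < g by rewrite (lt_le_trans ltr01).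
set X := (1 + `|xi|) ^+ k; have X0 : 0 < X by rewrite exprn_gt0// onen_gt0.
have tG := ctest_wave xi tpsi.
have BX : 0 <= B0 / X by rewrite divr_ge0// ltW.
have close : forall z, cabs (chi z) * cabs (w (fun y => psi (y + g^-1 *: z) * wave xi (y + g^-1 *: z)) - 0)
    <= B0 / X * wt m.*2 z.
  move=> z; rewrite subr0; set z' := g^-1 *: z.
  have z'z : `|z'| = `|z| / g by rewrite normrZ ger0_norm ?invr_ge0 ?(ltW g0)// mulrC.
  have z'1 : `|z'| <= `|z| by rewrite z'z ler_piMr// invf_le1.
  have wc : wt (m.*2 + (N + Q)) z * (1 + `|z|) ^+ (N + Q) = wt m.*2 z.
    exact: wt_absorb.
  have W : cabs (w (fun y => psi (y + z') * wave xi (y + z'))) <=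
      (Ks + Kw * (2 ^+ N * A) / d ^+ Q) / X * (1 + `|z|) ^+ (N + Q).
    (* For |z/g| <= d the translated wave is the wave times a constant phase, and the hypothesis on
       translated cutoffs applies. Otherwise |z| > d g, so (1 + |z|)^Q exceeds d^Q g^Q, and Q = 2(N
       + k) makes g^Q at least (1 + |xi|)^(N+k). *)
    have [hz|hz] := leP `|z'| d.
      have s1 : cschwartz (fun y => psi (y + z') * wave xi y).
        by apply: ctest_schwartz; apply: ctest_wave; exact: ctest_trans.
      have -> : (fun y => psi (y + z') * wave xi (y + z')) = (fun y => wave xi z' * (psi (y + z') * wave xi y)).
        by apply/funext => y; rewrite waveD mulrA mulrC.
      rewrite (tempered_scale hw)// cabsM cabs_wave mul1r.
      apply: (@le_trans _ _ (Ks / X)); first by rewrite ler_pdivlMr// mulrC hKs.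
      rewrite -[leLHS]mulr1 ler_pM ?divr_ge0 ?(ltW X0) ?onenX_ge1//.
      rewrite ler_wpM2r ?invr_ge0 ?(ltW X0)// lerDl divr_ge0 ?(ltW dQ)// mulr_ge0// mulr_ge0// exprn_ge0//.
    have h := hKw _ _ (cschwartz_trans z' (ctest_schwartz tG)) (cdbound_trans_wt z' (hA xi)).
    apply: le_trans h _.
    have gd : 1 <= (1 + `|z|) ^+ Q * (d ^+ Q)^-1 / ((1 + `|xi|) ^+ (N + k)).
      rewrite mulrAC ler_pdivlMr// mul1r ler_pdivlMr ?exprn_gt0 ?onen_gt0//.
      apply: (@le_trans _ _ (d ^+ Q * g ^+ Q)).
        rewrite ler_wpM2l ?(ltW dQ)// /Q addnn -mul2n exprM lerXn2r ?nnegrE ?exprn_ge0 ?addr_ge0// ltW//.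
      rewrite -exprMn lerXn2r ?nnegrE ?mulr_ge0 ?addr_ge0 ?(ltW d0) ?(ltW g0)//.
      apply: (@le_trans _ _ `|z|); last by rewrite lerDr.
      by rewrite -ler_pdivlMr// -z'z ltW.
    set Z := 1 + `|z|; set Y := 1 + `|xi|.
    have Z0 : 0 <= Z by rewrite addr_ge0.
    have Y0 : 0 < Y by rewrite onen_gt0.
    apply: (@le_trans _ _ (Kw * (2 ^+ N * Z ^+ N * (A * Y ^+ N)))).
      rewrite ler_wpM2l// ler_wpM2r ?mulr_ge0 ?exprn_ge0 ?(ltW Y0)//.
      rewrite ler_wpM2l ?exprn_ge0// lerXn2r ?nnegrE ?addr_ge0// lerD2l//.
    set E := Kw * _; have E0 : 0 <= E.
      by rewrite !mulr_ge0 ?exprn_ge0 ?(ltW Y0).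
    apply: (@le_trans _ _ (E * (Z ^+ Q * (d ^+ Q)^-1 / Y ^+ (N + k)))).
      by rewrite ler_peMr.
    have -> : E * (Z ^+ Q * (d ^+ Q)^-1 / Y ^+ (N + k)) = Kw * (2 ^+ N * A) / d ^+ Q / X * Z ^+ (N + Q).
      rewrite /E /X -/Y !exprD; field.
      by rewrite !expf_neq0// gt_eqF.
    rewrite ler_wpM2r ?exprn_ge0// ler_wpM2r ?invr_ge0 ?(ltW X0)// lerDr//.
  apply: le_trans (ler_pM (cabs_ge0 _) (cabs_ge0 _) (cdbound_cabs hM z) W) _.
  by apply: le_of_eq; rewrite -wc /B0; ring.
have := mollify_pairing_close hw hchi chi1 g1 tG BX close.
rewrite subr0 -cFT_mollify => h.
rewrite mulrC -ler_pdivlMr//; apply: le_trans h _; by rewrite mulrA.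
Qed.

End ConeEstimate.

(** The cutoff has to change: translates of psi' must remain multiples of psi with uniformly bounded
    quotients. A nonzero [xi0] provides the coordinate [i0] for summation by parts. *)
Lemma SigmaG_of_Sigma (psi : V -> C) (x0 xi0 : V) : ctest psi -> psi x0 != 0 -> xi0 != 0 ->
  not_in_Sigma w psi xi0 -> exists psi', [/\ ctest psi', psi' x0 != 0 &
    not_in_SigmaG gamma (embed gamma chi w) psi' xi0].
Proof.
move=> tpsi px0 xi00 [G [hG decG]].
have [i0 _] : exists i, xi0 0 i != 0.
  apply/existsP; rewrite -negb_forall; apply: contra xi00 => /forallP h.
  by apply/eqP/rowP => i; rewrite mxE; exact/eqP.
have [psi' [kappa [d [r [tpsi' p'x0 d0 tk [kE kr kb]]]]]] := localization tpsi px0.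
exists psi'; split => //.
have [G' [c [hG' c0 cone]]] := cone_shrink hG.
have dec k : exists K, forall eta, G eta -> (1 + `|eta|) ^+ k * cabs (distFT w psi eta) <= K.
  have [K hK] := decG k; exists K => eta Geta; apply: le_trans (hK eta Geta).
  by rewrite ler_wpM2r ?cabs_ge0// onenX_le_enorm.
pose I := {z : V | `|z| <= d}.
have small k : exists2 K, 0 <= K & forall z xi, `|z| <= d -> G' xi ->
    (1 + `|xi|) ^+ k * cabs (w (fun x => psi' (x + z) * wave xi x)) <= K.
  have [K K0 hK] := @cone_decay_mul R m w hw i0 I (fun z => kappa (sval z)) psi G G' c r tpsi
    (fun z => tk _) (fun z x => kr (sval z) x (svalP z))
    (fun n N => let: ex_intro M hM := kb n N in ex_intro _ M (fun z => hM _ (svalP z)))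
    c0 cone dec k.
  exists K => // z xi hz gx; have := hK (exist _ z hz) xi gx.
  suff -> : (fun x => kappa z x * (psi x * wave xi x)) = (fun x => psi' (x + z) * wave xi x) by [].
  by apply/funext => x; rewrite mulrA kE.
have [N0 hdec] := mollify_FT_decay hw hchi tpsi' i0.
exists G'; split => //; exists N0 => k; exists 0%N => phi0 aphi.
have [ne l0] := kernel_absupp aphi; set l := lsupp phi0 in l0 *.
have [_ cphi _ _] := aphi.
have [_ _ _ ginf _] := hgamma.
have [d1 [d10 hd1]] := ginf 1.
(* Decay of order 2k is used where g^2 < 1 + |xi|: half of it compensates g^(2k), the other half is
   the decay to be proved, and the remaining g^N0 has an exponent fixed before [k]. *)
have [K1 K10 h1] := hdec (k + k)%N.
have [K2 K20 h2] := mollify_FT_cone tpsi' d0 small k.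
exists (m.+1%:R ^+ k * (K1 + K2)), (d1 / l); split; first by rewrite divr_gt0.
move=> eps /andP[e0 ed] xi gxi.
rewrite embedE (lsupp_scale e0 cphi ne) -/l.
set g := gamma (eps * l).
have g1 : 1 <= g by apply: ltW; apply: hd1; rewrite mulr_gt0//= -ltr_pdivlMr.
have g0 : 0 <= g by rewrite (le_trans ler01).
set F := cabs _; have F0 : 0 <= F by exact: cabs_ge0.
apply: (@le_trans _ _ (m.+1%:R ^+ k * ((1 + `|xi|) ^+ k * F))).
  by rewrite mulrA ler_wpM2r// enormX_le_onen.
rewrite -[leRHS]mulrA ler_wpM2l ?exprn_ge0//.
have gN : 1 <= g ^+ N0 by rewrite exprn_ege1.
have gN0 : 0 <= g ^+ N0 by rewrite (le_trans ler01).
rewrite mulrDl; have [gx|gx] := leP (1 + `|xi|) (g ^+ 2).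
  apply: (@le_trans _ _ (K2 * g ^+ N0)); last by rewrite lerDr mulr_ge0.
  by apply: le_trans (h2 g xi g1 gx gxi) _; rewrite ler_peMr.
apply: (@le_trans _ _ (K1 * g ^+ N0)); last by rewrite lerDl mulr_ge0.
have X0 : 0 < (1 + `|xi|) ^+ k by rewrite exprn_gt0// onen_gt0.
rewrite -(ler_pM2l X0) mulrA -exprD; apply: le_trans (h1 g xi g1) _.
have -> : K1 * g ^+ (k + k + N0) = g ^+ (k + k) * (K1 * g ^+ N0).
  by rewrite exprD mulrCA.
rewrite ler_wpM2r ?mulr_ge0//.
by rewrite addnn -mul2n exprM lerXn2r ?nnegrE ?exprn_ge0 ?addr_ge0// ltW.
Qed.

End Comparison.

Theorem mainTheorem6 (R : realType) (m : nat)
    (w : ('rV[R]_m -> R[i]) -> R[i]) (gamma : R -> R) (chi : 'rV[R]_m -> R[i]) :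
  tempered w -> admissible gamma -> cschwartz chi -> cint chi = 1 ->
  WFg gamma (embed gamma chi w) = WF w.
Proof.
move=> hw hgamma hchi chi1; apply/seteqP; split => -[x0 xi0] /= [xi00 h]; split => //=.
  move=> psi tpsi px0 nS.
  have [psi' [tpsi' p'x0 nSG]] := SigmaG_of_Sigma hw hgamma hchi chi1 tpsi px0 xi00 nS.
  exact: h _ tpsi' p'x0 nSG.
move=> psi tpsi px0 nSG; apply: (h _ tpsi px0).
exact: Sigma_of_SigmaG nSG.
Qed.
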